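(* For an integer $c$, Chromatic Sum for graphs of clique-width at most $c$ is polynomial-time solvable if $c\leq 2$ and NP-complete if $c\geq 3$.
   Context: All graphs are finite, undirected and simple. A colouring of a graph $G=(V,E)$ is a function $c:V\to\{1,2,\ldots\}$ with $c(u)\neq c(v)$ for every edge $uv\in E$; its sum is $\sum_{v\in V}c(v)$. The decision problem Chromatic Sum takes a graph $G$ and an integer $k$ and asks whether $G$ admits a colouring with sum at most $k$. A statement about the problem ''for'' a graph class refers to the problem with input graphs restricted to that class. Clique-width is the standard graph parameter: the minimum number of labels needed to construct the graph by creating single labelled vertices, taking disjoint unions, adding all edges between vertices of label $i$ and vertices of label $j$ ($i\ne j$), and relabelling all vertices of label $i$ to label $j$. *)

(* Defs.v *)
From HB Require Import structures.
From mathcomp Require Import all_boot all_order all_algebra.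
Set Implicit Arguments. Unset Strict Implicit. Unset Printing Implicit Defensive.

Record sgraph := SGraph {
  svertex :> finType;
  sedge : rel svertex;
  sedge_sym : symmetric sedge;
  sedge_irr : irreflexive sedge }.

Definition colouring (G : sgraph) (c : G -> nat) : Prop :=
  (forall v, 0 < c v) /\ (forall u v, sedge u v -> c u <> c v).

Definition isomorphic (G H : sgraph) : Prop :=
  exists2 f : G -> H, bijective f & forall u v, sedge (f u) (f v) = sedge u v.

Record lgraph (k : nat) := LGraph {
  lgraph_graph :> sgraph;
  label : lgraph_graph -> 'I_k }.

Section LabelledGraphOperations.
Variable k : nat.

Definition lvertex (i : 'I_k) : lgraph k :=
  @LGraph k (@SGraph unit (fun _ _ => false) (fun _ _ => erefl) (fun _ => erefl))
    (fun _ => i).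

Section Union.
Variables A B : lgraph k.
Definition union_edge : rel (A + B)%type := fun x y =>
  match x, y with
  | inl u, inl v => sedge u v
  | inr u, inr v => sedge u v
  | _, _ => false
  end.
Lemma union_edge_sym : symmetric union_edge.
Proof. by case=> u [] v //=; apply: sedge_sym. Qed.
Lemma union_edge_irr : irreflexive union_edge.
Proof. by case=> u /=; apply: sedge_irr. Qed.
Definition lunion : lgraph k :=
  @LGraph k (SGraph union_edge_sym union_edge_irr)
    (fun x => match x with inl u => label u | inr u => label u end).
End Union.

Section Join.
Variables (i j : 'I_k) (neq_ij : i != j) (A : lgraph k).
Definition join_edge : rel A := fun u v =>
  [|| sedge u v, (label u == i) && (label v == j)
    | (label u == j) && (label v == i)].
Lemma join_edge_sym : symmetric join_edge.
Proof.
move=> u v; rewrite /join_edge sedge_sym; congr orb.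
by rewrite orbC; congr orb; rewrite andbC.
Qed.
Lemma join_edge_irr : irreflexive join_edge.
Proof.
move=> u; rewrite /join_edge sedge_irr /= andbC orbb.
by apply: contraNF neq_ij => /andP[/eqP<- /eqP<-].
Qed.
Definition ljoin : lgraph k :=
  @LGraph k (SGraph join_edge_sym join_edge_irr) (fun u => label u).
End Join.

Definition lrelabel (i j : 'I_k) (A : lgraph k) : lgraph k :=
  @LGraph k A (fun u => if label u == i then j else label u).

Inductive cwexpr : Type :=
| CWVertex of 'I_k
| CWUnion of cwexpr & cwexpr
| CWJoin (i j : 'I_k) of i != j & cwexpr
| CWRelabel of 'I_k & 'I_k & cwexpr.

Fixpoint cweval (e : cwexpr) : lgraph k :=
  match e with
  | CWVertex i => lvertex i
  | CWUnion e1 e2 => lunion (cweval e1) (cweval e2)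
  | CWJoin i j neq_ij e1 => ljoin neq_ij (cweval e1)
  | CWRelabel i j e1 => lrelabel i j (cweval e1)
  end.

End LabelledGraphOperations.

(** An expression always has at least one vertex; the graph without vertices is
    regarded as built by no operation at all, hence with 0 labels. *)
Definition cw_constructible (k : nat) (G : sgraph) : Prop :=
  #|G| = 0 \/ exists e : cwexpr k, isomorphic (cweval e) G.

Definition is_cliquewidth (G : sgraph) (w : nat) : Prop :=
  cw_constructible w G /\ forall k, cw_constructible k G -> w <= k.

Definition cliquewidth_at_most (c : int) (G : sgraph) : Prop :=
  exists2 w, is_cliquewidth G w & (w%:Z <= c)%R.

Inductive move := MoveLeft | MoveStay | MoveRight.

(** A deterministic machine with [tm_tapes.+1] two-way infinite tapes. The tape
    alphabet is [option (bool + tm_extra)]: [None] is the blank, [Some (inl b)] is an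
    input/output bit and [Some (inr a)] is an auxiliary symbol. A transition
    [None] means that the machine halts. *)
Record tm := TM {
  tm_tapes : nat;
  tm_state : finType;
  tm_extra : finType;
  tm_start : tm_state;
  tm_accept : pred tm_state;
  tm_trans : tm_state ->
             {ffun 'I_tm_tapes.+1 -> option (bool + tm_extra)} ->
             option (tm_state *
               {ffun 'I_tm_tapes.+1 -> option (bool + tm_extra) * move}) }.

Section Run.
Variable M : tm.

Definition symbol : Type := option (bool + tm_extra M).

(** [tape_left] lists the cells left of the head, nearest first; [tape_right]
    lists the scanned cell and the cells to its right. All other cells are
    blank. *)
Record tape := Tape { tape_left : seq symbol; tape_right : seq symbol }.

Definition tape_read (t : tape) : symbol := head None (tape_right t).

Definition tape_write_move (a : symbol) (d : move) (t : tape) : tape :=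
  let: Tape l r := t in
  match d with
  | MoveLeft => Tape (behead l) [:: head None l, a & behead r]
  | MoveStay => Tape l (a :: behead r)
  | MoveRight => Tape (a :: l) (behead r)
  end.

Record config := Config {
  cfg_state : tm_state M;
  cfg_tapes : {ffun 'I_(tm_tapes M).+1 -> tape} }.

Definition tm_step (C : config) : option config :=
  if tm_trans (cfg_state C) [ffun i => tape_read (cfg_tapes C i)] is Some (q, a)
  then Some (Config q
         [ffun i => tape_write_move (a i).1 (a i).2 (cfg_tapes C i)])
  else None.

(** [run t C] is the halting configuration reached from [C] if [M] halts within
    [t] steps, and [None] otherwise. *)
Fixpoint run (t : nat) (C : config) : option config :=
  match tm_step C with
  | None => Some C
  | Some C' => if t is t'.+1 then run t' C' else None
  end.

(** The [i]-th input string is written on tape [i], with the head on its first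
    bit; the remaining tapes are blank. *)
Definition tm_init (inputs : seq (seq bool)) : config :=
  Config (tm_start M)
    [ffun i : 'I_(tm_tapes M).+1 =>
       Tape [::] [seq Some (inl b) | b <- nth [::] inputs i]].

Definition accepting (C : config) : bool := tm_accept (cfg_state C).

Fixpoint leading_bits (s : seq symbol) : seq bool :=
  if s is Some (inl b) :: s' then b :: leading_bits s' else [::].

(** The output is the string of bits on tape 0 starting at the head and ending
    before the first cell that does not contain a bit. *)
Definition output (C : config) : seq bool :=
  leading_bits (tape_right (cfg_tapes C ord0)).

End Run.

(** [dp_valid] singles out the admissible inputs: an algorithm for the problem
    may assume it, and a reduction to the problem must guarantee it. *)
Record decision_problem := DecisionProblem {
  dp_input : Type;
  dp_encode : dp_input -> seq bool;
  dp_valid : dp_input -> Prop;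
  dp_yes : dp_input -> Prop }.

Definition language_problem (L : seq bool -> Prop) : decision_problem :=
  @DecisionProblem (seq bool) id (fun _ => True) L.

Definition polytime_solvable (P : decision_problem) : Prop :=
  exists (M : tm) (p : {poly nat}),
  forall I : dp_input P, dp_valid I ->
  let x := dp_encode I in
  exists2 C, run p.[size x]%R (tm_init M [:: x]) = Some C &
    accepting C <-> dp_yes I.

(** The verifier receives the input on tape 0 and the certificate on tape 1. *)
Definition in_NP (P : decision_problem) : Prop :=
  exists (M : tm) (p q : {poly nat}),
  forall I : dp_input P, dp_valid I ->
  let x := dp_encode I in
  (forall y : seq bool, size y <= q.[size x]%R ->
     exists C, run p.[size x]%R (tm_init M [:: x; y]) = Some C) /\
  (dp_yes I <->
     exists2 y : seq bool, size y <= q.[size x]%R &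
     exists2 C, run p.[size x]%R (tm_init M [:: x; y]) = Some C & accepting C).

Definition polytime_computable (f : seq bool -> seq bool) : Prop :=
  exists (M : tm) (p : {poly nat}),
  forall x, exists2 C,
    run p.[size x]%R (tm_init M [:: x]) = Some C & output C = f x.

Definition polytime_reducible (L : seq bool -> Prop) (P : decision_problem) :
    Prop :=
  exists2 f, polytime_computable f &
  forall x, exists I : dp_input P,
    [/\ f x = dp_encode I, dp_valid I & L x <-> dp_yes I].

Definition NP_hard (P : decision_problem) : Prop :=
  forall L, in_NP (language_problem L) -> polytime_reducible L P.

Definition NP_complete (P : decision_problem) : Prop := in_NP P /\ NP_hard P.

(** Binary representation, least significant bit first; 0 is the empty string. *)
Fixpoint positive_bits (p : BinNums.positive) : seq bool :=
  match p with
  | BinNums.xH => [:: true]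
  | BinNums.xO p' => false :: positive_bits p'
  | BinNums.xI p' => true :: positive_bits p'
  end.

Definition nat_bits (n : nat) : seq bool :=
  if bin_of_nat n is BinNums.Npos p then positive_bits p else [::].

Definition int_bits (z : int) : seq bool := (z < 0)%R :: nat_bits `|z|%N.

(** The order of the graph in unary followed by a [false], then its adjacency
    matrix row by row (for the order of the vertices given by [enum]), then the
    sign and the binary representation of the threshold. *)
Definition encode_graph_int (Gk : sgraph * int) : seq bool :=
  let: (G, k) := Gk in
  nseq #|G| true ++ false :: [seq sedge u v | u <- enum G, v <- enum G]
    ++ int_bits k.

Definition chromatic_sum (graph_class : sgraph -> Prop) : decision_problem :=
  @DecisionProblem (sgraph * int) encode_graph_int
    (fun Gk => graph_class Gk.1)
    (fun Gk => exists2 c : Gk.1 -> nat, colouring c &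
       ((\sum_(v : Gk.1) c v)%N%:Z <= Gk.2)%R).

(* Main.v *)
Require Import Defs.
From mathcomp Require Import all_boot all_order all_algebra.
From mathcomp Require Import zify.
From Stdlib Require Import FunctionalExtensionality Classical.
Set Implicit Arguments. Unset Strict Implicit. Unset Printing Implicit Defensive.

(** A graph of clique-width at most 2 is a cograph and shrinks to a single vertex by
    contracting twins. A cograph has a colouring whose [k] largest classes cover, for all [k] at
    once, as many vertices as any [k] independent sets; it minimises the sum. Its class sizes form a
    Young diagram: contracting false twins adds the rows of two diagrams, contracting true twins adds
    the columns.

    For hardness, a computation of a verifier is described by one value per time step, and its
    correctness by constraints between the values of two steps, so that accepted inputs correspond
    to large independent sets in a conflict graph. Given a conflict graph on [n] vertices, take for
    every conflict [i < j] a clique of cores, one for each of [L >= n] levels, and two satellites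
    completing the cores [i] and [j] to an induced path on four vertices; add rulers, one per level,
    adjacent to everything. Weights, realised by independent copies, force the cores and the ruler of
    level [a] to take the colours [2a+1] and [2a+2], in the same order in all components: the order
    encodes whether [a] is chosen, the rulers reward chosen levels, and the satellites of a conflict
    become expensive exactly when both ends are chosen. Joins, unions and substitutions into a path
    on four vertices need only three labels.

    Machines are obtained by compiling arithmetic terms with bounded sums and truncated iteration. *)

(** * Programs over tapes *)

(** The obstacle on the hardness side is that conflicts are binary, whereas the symbol in a tape
    cell depends on an unbounded past. A value therefore also guesses when each scanned cell was
    visited last; a wrong guess is contradicted by the value of one other time step, so pairs are
    enough. The constants of the graph follow from a comparison of costs. A chosen level saves
    [ruler_excess], which is [n ^ 3 + 1]; a conflict with exactly its smaller end chosen costs a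
    little, and all these small costs together stay at most [n ^ 3]; a conflict with both ends
    chosen costs at least [ruler_excess]. Violating a conflict therefore never gains more than
    giving up one of its ends. On the machine side, the value of a term is bounded by a polynomial
    in its arguments, so the running time of its program is polynomial by recursion on the term. The
    price is that large quantities, such as binary thresholds and powers of two, must be truncated
    without changing the answer. *)

Definition upd (A : Type) (f : nat -> A) (a : nat) (b : A) : nat -> A :=
  fun x => if x == a then b else f x.

Definition displace (d : move) (h : nat) : nat :=
  match d with MoveLeft => h.-1 | MoveStay => h | MoveRight => h.+1 end.

(* The cells to the left of the origin of [c] are left unconstrained. *)
Definition tape_rep (M : tm) (t : tape M) (c : nat -> symbol M) (h : nat) : Prop :=
  (forall j, nth None (tape_right t) j = c (h + j)) /\
  (forall j, j < h -> nth None (tape_left t) j = c (h.-1 - j)).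

Lemma tape_rep_read (M : tm) (t : tape M) c h :
  tape_rep t c h -> tape_read t = c h.
Proof. by case=> /(_ 0); rewrite addn0 nth0. Qed.

(** Positions are natural numbers counted from an origin, so [displace] is faithful to a left move
    only away from position 0; hence the side condition. *)
Lemma tape_rep_write_move (M : tm) (t : tape M) c h a d :
  (d = MoveLeft -> 0 < h) -> tape_rep t c h ->
  tape_rep (tape_write_move a d t) (upd c h a) (displace d h).
Proof.
case: t => l r hd [/= Hr Hl]; rewrite /tape_rep /upd.
have Hr' j : nth None (behead r) j = c (h + j.+1).
  by rewrite -Hr nth_behead.
case: d hd => [/(_ erefl) h0 | _ | _] /=; split.
- case=> [|[|j]] /=.
  + have -> : (h.-1 + 0 == h) = false by lia.
    by rewrite -nth0 Hl // subn0 addn0.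
  + by have -> : (h.-1 + 1 == h) = true by lia.
  + have -> : (h.-1 + j.+2 == h) = false by lia.
    by rewrite Hr'; congr c; lia.
- move=> j jh; rewrite nth_behead Hl; last lia.
  have -> : (h.-1.-1 - j == h) = false by lia.
  by congr c; lia.
- case=> [|j] /=; first by have -> : (h + 0 == h) = true by lia.
  have -> : (h + j.+1 == h) = false by lia.
  by rewrite Hr'.
- move=> j jh; rewrite Hl //.
  by have -> : (h.-1 - j == h) = false by lia.
- move=> j; have -> : (h.+1 + j == h) = false by lia.
  by rewrite Hr'; congr c; lia.
- case=> [|j] jh /=; first by rewrite subn0 eqxx.
  rewrite Hl; last lia.
  have -> : (h - j.+1 == h) = false by lia.
  by congr c; lia.
Qed.

Definition tsym := option (bool + unit).

(** A structured layer between terms and transition tables: correctness is proved along the syntax,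
    and jumps appear in one compilation lemma only. *)
Inductive prog :=
| Skip
| Seq of prog & prog
| Mv (r : nat) (right : bool)
| Wr (r : nat) (a : tsym)
| If (r : nat) (test : pred tsym) of prog & prog
| While (r : nat) (test : pred tsym) of prog.

Definition store := ((nat -> nat -> tsym) * (nat -> nat))%type.

Definition scanned (s : store) (r : nat) : tsym := s.1 r (s.2 r).

(** The step counts are those of the compiled code: one for a test, and one more for the
    unconditional jump behind the first branch of [If] and behind the body of [While]. A left move
    at the origin has no derivation. *)
Inductive ev : prog -> store -> nat -> store -> Prop :=
| EvSkip s : ev Skip s 0 s
| EvSeq p q s n s' m s'' : ev p s n s' -> ev q s' m s'' -> ev (Seq p q) s (n + m) s''
| EvRight r s : ev (Mv r true) s 1 (s.1, upd s.2 r (s.2 r).+1)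
| EvLeft r s : 0 < s.2 r -> ev (Mv r false) s 1 (s.1, upd s.2 r (s.2 r).-1)
| EvWr r a s : ev (Wr r a) s 1 (upd s.1 r (upd (s.1 r) (s.2 r) a), s.2)
| EvIfT r (test : pred tsym) p q s n s' :
    test (scanned s r) -> ev p s n s' -> ev (If r test p q) s n.+2 s'
| EvIfF r (test : pred tsym) p q s n s' :
    ~~ test (scanned s r) -> ev q s n s' -> ev (If r test p q) s n.+1 s'
| EvWhileF r (test : pred tsym) p s : ~~ test (scanned s r) -> ev (While r test p) s 1 s
| EvWhileT r (test : pred tsym) p s n s' m s'' :
    test (scanned s r) -> ev p s n s' -> ev (While r test p) s' m s'' ->
    ev (While r test p) s (n.+2 + m) s''.

Fixpoint width (p : prog) : nat :=
  match p with
  | Skip => 0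
  | Seq p q => maxn (width p) (width q)
  | Mv r _ | Wr r _ => r.+1
  | If r _ p q => maxn r.+1 (maxn (width p) (width q))
  | While r _ p => maxn r.+1 (width p)
  end.

Inductive instr :=
| IMove (r : nat) (right : bool)
| IWrite (r : nat) (a : tsym)
| IBranch (r : nat) (test : pred tsym) (target1 target2 : nat).

(** Jump targets are absolute, so the address [base] of the first instruction must be known at
    compilation. *)
Fixpoint compile (p : prog) (base : nat) : seq instr :=
  match p with
  | Skip => [::]
  | Seq p q => let cp := compile p base in cp ++ compile q (base + size cp)
  | Mv r d => [:: IMove r d]
  | Wr r a => [:: IWrite r a]
  | If r test p q =>
      let cp := compile p base.+1 in
      let cq := compile q (base.+1 + size cp).+1 in
      let fin := (base.+1 + size cp).+1 + size cq in
      IBranch r test base.+1 (base.+1 + size cp).+1 ::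
        cp ++ IBranch 0 xpredT fin fin :: cq
  | While r test p =>
      let cp := compile p base.+1 in
      IBranch r test base.+1 (base.+1 + size cp).+1 ::
        rcons cp (IBranch 0 xpredT base base)
  end.

Section Compiled.
Variables (p : prog) (K : nat).

Definition is_one : pred tsym := fun a => a == Some (inl true).

(** The last instruction turns the verdict on tape 0 into a state. Both its targets lie behind the
    code, where no instruction is found and the machine halts; the first of them is the accepting
    state. *)
Definition code := let c := compile p 0 in
  rcons c (IBranch 0 is_one (size c).+1 (size c).+2).

Definition tm_act (reads : {ffun 'I_K.+1 -> tsym}) (r : nat) (f : tsym -> tsym * move) :
    {ffun 'I_K.+1 -> tsym * move} :=
  [ffun i : 'I_K.+1 => if i == r :> nat then f (reads i) else (reads i, MoveStay)].

Definition code_trans (pc : 'I_(size code).+2) (reads : {ffun 'I_K.+1 -> tsym}) :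
    option ('I_(size code).+2 * {ffun 'I_K.+1 -> tsym * move}) :=
  if onth code pc is Some i then
    Some match i with
    | IMove r d => (inord pc.+1,
        tm_act reads r (fun a => (a, if d then MoveRight else MoveLeft)))
    | IWrite r a => (inord pc.+1, tm_act reads r (fun _ => (a, MoveStay)))
    | IBranch r test t1 t2 =>
        (inord (if test (reads (inord r)) then t1 else t2),
         [ffun i => (reads i, MoveStay)])
    end
  else None.

Definition machine : tm :=
  @TM K 'I_(size code).+2 unit (inord 0)
    (fun pc => pc == size (compile p 0) + 1 :> nat) code_trans.

Definition cfg_rep (C : config machine) (pc : nat) (s : store) : Prop :=
  [/\ val (cfg_state C : 'I_(size code).+2) = pc &
      forall i : 'I_K.+1, tape_rep (cfg_tapes C i) (s.1 i) (s.2 i)].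

Lemma upd_id (A : Type) (f : nat -> A) a : upd f a (f a) = f.
Proof.
by apply: functional_extensionality => x; rewrite /upd; case: eqP => [->|].
Qed.

Lemma cfg_rep_branch C pc s r (test : pred tsym) t1 t2 :
  cfg_rep C pc s -> onth code pc = Some (IBranch r test t1 t2) -> r <= K ->
  t1 < (size code).+2 -> t2 < (size code).+2 ->
  exists2 C', cfg_rep C' (if test (scanned s r) then t1 else t2) s &
    forall t, run t.+1 C = run t C'.
Proof.
move=> [Hpc HC] Hc rK h1 h2.
pose pc' : tm_state machine := inord (if test (scanned s r) then t1 else t2).
pose tp := [ffun i : 'I_K.+1 =>
  tape_write_move (tape_read (cfg_tapes C i)) MoveStay (cfg_tapes C i)].
exists (@Config machine pc' tp).
  split; first by rewrite /= inordK //; case: ifP.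
  move=> i; rewrite /= ffunE.
  have H : MoveStay = MoveLeft -> 0 < s.2 i by [].
  have := @tape_rep_write_move _ _ _ _ (tape_read (cfg_tapes C i)) _ H (HC i).
  by rewrite (tape_rep_read (HC i)) upd_id.
move=> t; rewrite /= /tm_step /= /code_trans Hpc Hc; congr run.
congr Config; last by apply/ffunP => i; rewrite !ffunE.
by rewrite /pc' ffunE (tape_rep_read (HC _)) inordK.
Qed.

(** Moves and writes are instances of one action, a write followed by a move: a pure move rewrites
    the scanned symbol. *)
Definition act_code (i : instr) r (f : tsym -> tsym * move) : Prop :=
  (i = IMove r true /\ f = fun a => (a, MoveRight)) \/
  (i = IMove r false /\ f = fun a => (a, MoveLeft)) \/
  (exists a, i = IWrite r a /\ f = fun _ => (a, MoveStay)).

Lemma cfg_rep_act C pc s r i (f : tsym -> tsym * move) :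
  cfg_rep C pc s -> r <= K -> onth code pc = Some i -> act_code i r f ->
  ((f (scanned s r)).2 = MoveLeft -> 0 < s.2 r) ->
  exists2 C', cfg_rep C' pc.+1
     (upd s.1 r (upd (s.1 r) (s.2 r) (f (scanned s r)).1),
      upd s.2 r (displace (f (scanned s r)).2 (s.2 r))) &
    forall t, run t.+1 C = run t C'.
Proof.
move=> [Hpc HC] rK Hn Hi hd.
have psz : pc < size code by rewrite -onthTE Hn.
have Htr reads (pc' : 'I_(size code).+2) : val pc' = pc ->
    code_trans pc' reads = Some (inord pc.+1, tm_act reads r f).
  rewrite /code_trans => E; rewrite /= in E; rewrite E Hn.
  by case: Hi => [[-> ->]|[[-> ->]|[a [-> ->]]]].
pose tp := [ffun i : 'I_K.+1 => let a := tm_act [ffun i => tape_read (cfg_tapes C i)] r f i in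
  tape_write_move (M := machine) a.1 a.2 (cfg_tapes C i)].
exists (@Config machine (inord pc.+1 : 'I_(size code).+2) tp).
  split; first by rewrite /= inordK //; lia.
  move=> j; rewrite /= !ffunE (tape_rep_read (HC j)) /upd.
  case: eqP => [Ei|_].
    rewrite Ei /scanned; have := HC j; rewrite Ei => HCi.
    by apply: tape_rep_write_move.
  have H : MoveStay = MoveLeft -> 0 < s.2 j by [].
  have := @tape_rep_write_move machine _ _ _ (s.1 j (s.2 j) : symbol machine) _ H (HC j).
  by rewrite upd_id.
move=> t; rewrite /= /tm_step /= Htr //.
Qed.

Lemma cfg_rep_pc C pc pc' s : cfg_rep C pc s -> pc = pc' -> cfg_rep C pc' s.
Proof. by move=> + <-. Qed.

Lemma onth_code_mid pre i post : code = pre ++ i :: post ->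
  onth code (size pre) = Some i.
Proof. by move=> ->; rewrite onth_cat ltnn subnn. Qed.

Arguments run : simpl never.

(** Induction on the evaluation rather than on the program, because of loops. The remaining fuel [t]
    is arbitrary, so that consecutive pieces compose by rewriting, and so are [pre] and [post],
    because subprograms are compiled in place. *)
Lemma ev_compile q s n s' : ev q s n s' ->
  forall pre post, code = pre ++ compile q (size pre) ++ post ->
  width q <= K.+1 -> forall C, cfg_rep C (size pre) s ->
  exists2 C', cfg_rep C' (size pre + size (compile q (size pre))) s' &
    forall t, run (n + t) C = run t C'.
Proof.
elim=> {q s n s'}.
- by move=> s pre post Hc w C HC; exists C => //; rewrite addn0.
- move=> p1 q s n s' m s'' _ IHp _ IHq pre post /= Hc.
  rewrite geq_max => /andP[w1 w2] C HC.
  rewrite -catA in Hc.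
  case: (IHp _ _ Hc w1 _ HC) => C1 HC1 R1.
  have := IHq (pre ++ compile p1 (size pre)) post.
  rewrite size_cat -catA => /(_ Hc w2 _ HC1) [C2 HC2 R2].
  exists C2; first by rewrite size_cat addnA.
  by move=> t; rewrite -addnA R1 R2.
- move=> r s pre post /= Hc w C HC.
  case: (cfg_rep_act (r := r) HC w (onth_code_mid Hc) (or_introl (conj erefl erefl))) => //= C'.
  by rewrite upd_id upd_id -addn1; exists C'.
- move=> r s h0 pre post /= Hc w C HC.
  case: (cfg_rep_act (r := r) HC w (onth_code_mid Hc)
     (or_intror (or_introl (conj erefl erefl)))) => //= C'.
  by rewrite upd_id upd_id -addn1; exists C'.
- move=> r a s pre post /= Hc w C HC.
  have Ha : act_code (IWrite r a) r (fun=> (a, MoveStay)) by right; right; exists a.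
  case: (cfg_rep_act (r := r) HC w (onth_code_mid Hc) Ha) => //= C'.
  by rewrite upd_id -addn1; exists C'.
- move=> r test p1 q s n s' Ht _ IHp pre post /= Hc.
  rewrite !geq_max => /and3P[wr w1 w2] C HC.
  have psz := congr1 size Hc; rewrite size_cat /= size_cat /= size_cat /= in psz.
  case: (cfg_rep_branch HC (onth_code_mid Hc)); rewrite ?Ht; try lia.
  move=> C1 HC1 R1.
  rewrite -cat_rcons -catA cat_cons in Hc; set pre1 := rcons pre _ in Hc.
  have S1 : size pre1 = (size pre).+1 by rewrite size_rcons.
  have Hc1 := Hc; rewrite -S1 in Hc1 HC1.
  have [C2 HC2 R2] := IHp _ _ Hc1 w1 _ HC1; rewrite S1 in HC2.
  rewrite catA in Hc; have := onth_code_mid Hc.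
  rewrite size_cat S1 => Hj.
  case: (cfg_rep_branch HC2 Hj); try lia.
  move=> C3 HC3 R3; exists C3 => [|t].
    by rewrite size_cat /=; apply: cfg_rep_pc HC3 _; lia.
  by have -> : n.+2 + t = (n + t.+1).+1; [lia | rewrite R1 R2 R3].
- move=> r test p1 q s n s' Ht _ IHq pre post /= Hc.
  rewrite !geq_max => /and3P[wr w1 w2] C HC.
  have psz := congr1 size Hc; rewrite size_cat /= size_cat /= size_cat /= in psz.
  case: (cfg_rep_branch HC (onth_code_mid Hc)); rewrite ?(negbTE Ht); try lia.
  move=> C1 HC1 R1.
  rewrite -cat_rcons -catA cat_cons catA -cat_rcons in Hc.
  set pre1 := rcons (rcons _ _ ++ _) _ in Hc.
  have S1 : size pre1 = ((size pre).+1 + size (compile p1 (size pre).+1)).+1.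
    by rewrite size_rcons size_cat size_rcons.
  rewrite -S1 in Hc HC1 *.
  have [C2 HC2 R2] := IHq _ _ Hc w2 _ HC1; rewrite S1 in HC2 *.
  exists C2 => [|t]; last by rewrite addSn R1 R2.
  by rewrite size_cat /=; apply: cfg_rep_pc HC2 _; lia.
- move=> r test p1 s Ht pre post /= Hc.
  rewrite !geq_max => /andP[wr w1] C HC.
  have psz := congr1 size Hc; rewrite size_cat /= size_cat size_rcons in psz.
  case: (cfg_rep_branch HC (onth_code_mid Hc)); rewrite ?(negbTE Ht); try lia.
  move=> C1 HC1 R1; exists C1 => [|t]; last by rewrite add1n R1.
  by rewrite size_rcons; apply: cfg_rep_pc HC1 _; lia.
- move=> r test p1 s n s' m s'' Ht _ IHp _ IHw pre post /= Hc.
  rewrite !geq_max => /andP[wr w1] C HC.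
  have psz := congr1 size Hc; rewrite size_cat /= size_cat size_rcons in psz.
  have Hc0 := Hc.
  case: (cfg_rep_branch HC (onth_code_mid Hc)); rewrite ?Ht; try lia.
  move=> C1 HC1 R1.
  rewrite cat_rcons -cat_rcons in Hc; set pre1 := rcons pre _ in Hc.
  have S1 : size pre1 = (size pre).+1 by rewrite size_rcons.
  have Hc1 := Hc; rewrite -S1 in Hc1 HC1.
  have [C2 HC2 R2] := IHp _ _ Hc1 w1 _ HC1; rewrite S1 in HC2.
  rewrite catA in Hc; have := onth_code_mid Hc.
  rewrite size_cat S1 => Hj.
  case: (cfg_rep_branch HC2 Hj); try lia.
  move=> C3 HC3 R3; case: (IHw _ _ Hc0 _ C3 HC3) => [|C4 HC4 R4].
    by rewrite /= geq_max wr w1.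
  exists C4 => // t.
  by have -> : n.+2 + m + t = (n + (m + t).+1).+1; [lia | rewrite R1 R2 R3 R4].
Qed.

Lemma run_machine n C s s' : width p <= K.+1 -> ev p s n s' -> cfg_rep C 0 s ->
  exists2 C', run n.+1 C = Some C' &
    accepting C' = is_one (scanned s' 0) /\
    (forall i : 'I_K.+1, tape_rep (cfg_tapes C' i) (s'.1 i) (s'.2 i)).
Proof.
move=> w e HC.
have E : code = [::] ++ compile p (size ([::] : seq instr)) ++
   [:: IBranch 0 is_one (size (compile p 0)).+1 (size (compile p 0)).+2].
  by rewrite /code cats1.
case: (ev_compile e E w HC) => C1 HC1 R1.
rewrite /= add0n in HC1 *.
have Hb : onth code (size (compile p 0)) =
    Some (IBranch 0 is_one (size (compile p 0)).+1 (size (compile p 0)).+2).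
  by apply: (@onth_code_mid (compile p 0) _ [::]).
have Hsz : size code = (size (compile p 0)).+1 by rewrite size_rcons.
case: (cfg_rep_branch HC1 Hb); rewrite ?Hsz //.
move=> C2 [Hpc HC2] R2; exists C2; last split => //.
  rewrite -addn1 R1 R2 /run /= /tm_step /= /code_trans.
  rewrite /= in Hpc; rewrite Hpc.
  by rewrite onth_default // Hsz; case: ifP.
rewrite /accepting /= /in_mem /=; rewrite /= in Hpc; rewrite Hpc.
by case: ifP => _; lia.
Qed.

End Compiled.

(** * Arithmetic terms and their compilation *)

(* A register is a tape whose origin carries the auxiliary symbol; its value is the position of
   the head. *)
Definition register : nat -> tsym := fun j => if j == 0 then Some (inr tt) else None.

Definition nonzero : pred tsym := fun a => a == None.

Definition setr (s : store) (r v : nat) : store := (s.1, upd s.2 r v).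

(** Upper bounds rather than exact times: the cost of a loop depends on register contents, of which
    only bounds are tracked. *)
Definition evb (p : prog) (s : store) (B : nat) (s' : store) : Prop :=
  exists2 n, n <= B & ev p s n s'.

Lemma evb_eq p s B s' s0 B0 s0' :
  evb p s B s' -> s = s0 -> s' = s0' -> B <= B0 -> evb p s0 B0 s0'.
Proof. by case=> n nB e <- <- BB; exists n => //; lia. Qed.

Lemma evb_seq p q s B s' C s'' :
  evb p s B s' -> evb q s' C s'' -> evb (Seq p q) s (B + C) s''.
Proof.
by case=> n nB e [m mC e']; exists (n + m); [lia | apply: EvSeq e e'].
Qed.

Lemma evb_skip s : evb Skip s 0 s.
Proof. by exists 0 => //; constructor. Qed.

Lemma evb_inc r s : evb (Mv r true) s 1 (setr s r (s.2 r).+1).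
Proof. by exists 1 => //; constructor. Qed.

Lemma evb_dec r s : 0 < s.2 r -> evb (Mv r false) s 1 (setr s r (s.2 r).-1).
Proof. by exists 1 => //; constructor. Qed.

Lemma evb_if r (test : pred tsym) p q s B s' :
  evb (if test (scanned s r) then p else q) s B s' -> evb (If r test p q) s B.+2 s'.
Proof.
case=> n nB; case: ifP => Ht e.
  by exists n.+2 => //; apply: EvIfT.
by exists n.+1; [lia | apply: EvIfF => //; rewrite Ht].
Qed.

Lemma setr_setr s r v w : setr (setr s r v) r w = setr s r w.
Proof.
congr pair; apply: functional_extensionality => x; rewrite /= /upd.
by case: eqP.
Qed.

Lemma setr_id s r : setr s r (s.2 r) = s.
Proof. by case: s => k h; rewrite /setr upd_id. Qed.

Lemma upd_same A (f : nat -> A) a b : upd f a b a = b.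
Proof. by rewrite /upd eqxx. Qed.

Lemma upd_other A (f : nat -> A) a b x : x != a -> upd f a b x = f x.
Proof. by rewrite /upd => /negbTE ->. Qed.

Lemma nonzeroE s r : s.1 r = register -> nonzero (scanned s r) = (s.2 r != 0).
Proof. by move=> E; rewrite /scanned E /register /nonzero; case: (s.2 r). Qed.

Definition PLoop (r : nat) (p : prog) : prog := While r nonzero (Seq (Mv r false) p).

(** [F i] is the store after [i] rounds, up to the counter; the body starts with the counter already
    decremented and must preserve it. The 3 additional steps per round are the test, the decrement
    and the jump back. *)
Lemma evb_loop r p n t (F : nat -> store) :
  (forall i, i <= n -> (F i).1 r = register) ->
  (forall i, i < n -> evb p (setr (F i) r (n - i.+1)) t (setr (F i.+1) r (n - i.+1))) ->
  evb (PLoop r p) (setr (F 0) r n) (n * (t + 3) + 1) (setr (F n) r 0).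
Proof.
move=> Hr Hp.
suff H j : j <= n -> evb (PLoop r p) (setr (F (n - j)) r j) (j * (t + 3) + 1) (setr (F n) r 0).
  by have := H n (leqnn n); rewrite subnn.
elim: j => [|j IH] jn.
  rewrite subn0; exists 1 => //; apply: EvWhileF.
  by rewrite nonzeroE /= ?upd_same ?Hr.
have [m mB e] := IH (ltnW jn).
have [|k kB e'] := Hp (n - j.+1); first lia.
exists ((1 + k).+2 + m); first by rewrite mulSn; lia.
have E1 : n - (n - j.+1).+1 = j by lia.
have E2 : (n - j.+1).+1 = n - j by lia.
rewrite E1 E2 in e'.
apply: EvWhileT e.
  by rewrite nonzeroE /= ?upd_same ?Hr //; lia.
apply: EvSeq e'.
have := @EvLeft r (setr (F (n - j.+1)) r j.+1).
rewrite /= upd_same => /(_ isT).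
by rewrite (_ : (_, _) = setr (setr (F (n - j.+1)) r j.+1) r j) // setr_setr.
Qed.

Lemma store_ext (s s' : store) : s.1 = s'.1 -> s.2 =1 s'.2 -> s = s'.
Proof.
by case: s s' => [k h] [k' h'] /= -> H; congr pair; apply: functional_extensionality.
Qed.

Ltac store_eq := apply: store_ext => //= ?; rewrite /= /upd /=;
  repeat match goal with |- context [?a == ?b :> nat] => case: (@eqP _ a b) => ? end; subst; try lia.

Definition move_to (a b : nat) : prog := PLoop a (Mv b true).

Lemma evb_move a b s : a != b -> s.1 a = register ->
  evb (move_to a b) s (s.2 a * 4 + 1) (setr (setr s b (s.2 b + s.2 a)) a 0).
Proof.
move=> ab Ha.
apply: evb_eq (@evb_loop a (Mv b true) (s.2 a) 1 (fun i => setr s b (s.2 b + i)) _ _) _ _ _ => //=.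
- move=> i ia; apply: evb_eq (evb_inc _ _) _ _ _ => //.
  by store_eq.
- by rewrite addn0 !setr_id.
Qed.

Definition clear (r : nat) : prog := PLoop r Skip.

Lemma evb_clear r s : s.1 r = register -> evb (clear r) s (s.2 r * 3 + 1) (setr s r 0).
Proof.
move=> Hr.
apply: evb_eq (@evb_loop r Skip (s.2 r) 0 (fun=> s) _ _) _ _ _ => //.
  by move=> i _; apply: evb_skip.
by rewrite setr_id.
Qed.

(** Reading a register empties it, so the value is duplicated and the second duplicate is moved
    back. *)
Definition copy_to (x d : nat) : prog :=
  Seq (PLoop x (Seq (Mv d true) (Mv d.+1 true))) (move_to d.+1 x).

Lemma evb_copy x d s : x < d -> s.1 x = register -> s.1 d.+1 = register ->
  s.2 d.+1 = 0 -> s.2 d = 0 -> evb (copy_to x d) s (s.2 x * 9 + 2) (setr s d (s.2 x)).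
Proof.
move=> xd Hx Hd H0 H1.
have -> : s.2 x * 9 + 2 = (s.2 x * 5 + 1) + (s.2 x * 4 + 1) by lia.
pose s1 := setr (setr (setr s d (s.2 x)) d.+1 (s.2 x)) x 0.
apply: (@evb_seq _ _ _ _ s1).
  apply: evb_eq (@evb_loop x _ (s.2 x) 2
    (fun i => setr (setr s d i) d.+1 i) _ _) _ _ _ => //=; try by store_eq.
  move=> i ia; apply: (@evb_seq _ _ _ 1 _ 1); first exact: evb_inc.
  by apply: evb_eq (evb_inc _ _) _ _ _ => //; store_eq.
have E1 : s1.2 d.+1 = s.2 x by rewrite /= upd_other ?upd_same //; lia.
have E2 : s1.2 x = 0 by rewrite /= upd_same.
apply: evb_eq (@evb_move d.+1 x s1 _ _) _ _ _ => //; rewrite ?E1 ?E2 //; first lia.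
by store_eq.
Qed.

(** Variables are de Bruijn indices: [TSum] and [TRec] push onto the environment. [TDrop] is
    weakening; it lets a term be reused under a binder without renumbering. *)
Inductive term :=
| TVar (i : nat)
| TCst (n : nat)
| TAdd of term & term
| TSub of term & term
| TSum of term & term
| TRec of term & term & term & term
| TRd (a : 'I_3) of term
| TDrop of term.

Definition oracle := nat -> nat -> bool.

(* The truncation in [TRec] keeps the values polynomially bounded. *)
Fixpoint den (t : term) (o : oracle) (e : seq nat) : nat :=
  match t with
  | TVar i => nth 0 e i
  | TCst n => n
  | TAdd a b => den a o e + den b o e
  | TSub a b => den a o e - den b o e
  | TSum a b => \sum_(i < den a o e) den b o (nat_of_ord i :: e)
  | TRec n a b c =>
      iteri (den n o e) (fun i x => minn (den c o e) (den b o (x :: i :: e))) (den a o e)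
  | TRd a t => o a (den t o e)
  | TDrop t => den t o (behead e)
  end.

(** Every iterate of [TRec] is either the start or a minimum with [c], so its bound does not grow
    with the number of rounds. This is what keeps the bound polynomial. *)
Fixpoint value_bound (t : term) (B : nat) : nat :=
  match t with
  | TVar i => B
  | TCst n => n
  | TAdd a b => value_bound a B + value_bound b B
  | TSub a b => value_bound a B
  | TSum a b => value_bound a B * value_bound b (B + value_bound a B)
  | TRec n a b c => value_bound a B + value_bound c B
  | TRd a t => 1
  | TDrop t => value_bound t B
  end.

Lemma leq_sum_const n F c : (forall i, i < n -> F i <= c) -> \sum_(i < n) F (nat_of_ord i) <= n * c.
Proof.
move=> H; rewrite -[n in n * c]card_ord -sum_nat_const.
by apply: leq_sum => i _; apply: H.
Qed.

Lemma iteri_bound n (f : nat -> nat -> nat) x a c :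
  x <= a -> (forall i y, f i y <= c) -> iteri n f x <= a + c.
Proof. by move=> xa fc; case: n => [|n] /=; [lia | have := fc n (iteri n f x); lia]. Qed.

Lemma den_bound t o e B :
  all (fun v => v <= B) e -> den t o e <= value_bound t B.
Proof.
elim: t e B => [i|n|a IHa b IHb|a IHa b IHb|a IHa b IHb|n IHn a IHa b IHb c IHc|r a IHa|t IHt] e B H /=.
- case: (ltnP i (size e)) => ie; first by apply: (allP H); rewrite mem_nth.
  by rewrite nth_default.
- by [].
- by apply: leq_add; auto.
- by apply: leq_trans (IHa _ _ H); lia.
- have Ha := IHa _ _ H.
  apply: leq_trans (leq_mul Ha (leqnn _)).
  apply: (@leq_sum_const _ (fun i => den b o (i :: e))) => i ia; apply: IHb => /=.
  apply/andP; split; first lia.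
  by apply: sub_all H => v /= ?; lia.
- by apply: iteri_bound => [|i y]; [auto | rewrite geq_min IHc].
- by case: (o r _).
- apply: IHt; apply/allP => v /mem_behead; exact: (allP H).
Qed.

Fixpoint time_bound (t : term) (B : nat) : nat :=
  match t with
  | TVar i => B * 9 + 2
  | TCst n => n
  | TAdd a b => time_bound a B + (time_bound b B + (value_bound b B * 4 + 1))
  | TSub a b => time_bound a B + (time_bound b B + (value_bound b B * 6 + 1))
  | TSum a b =>
      let V := value_bound a B in
      let B' := B + V in
      time_bound a B +
      (V * (time_bound b B' + ((value_bound b B' * 4 + 1) + 1) + 3) + 1 + (V * 3 + 1))
  | TRec n a b c =>
      let N := value_bound n B in
      let V := value_bound a B + value_bound c B in
      let B' := B + (N + V) in
      time_bound a B + (time_bound n B +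
      (N * (time_bound b B' + (time_bound c B + ((V * 3 + 1) + ((value_bound b B' * 7 + 1) +
        ((V * 3 + 1) + 1)))) + 3) + 1 + (N * 3 + 1)))
  | TRd a t => time_bound t B + ((value_bound t B * 5 + 1) + (3 + (value_bound t B * 4 + 1)))
  | TDrop t => time_bound t B
  end.

Definition dec_sat (r : nat) : prog := If r nonzero (Mv r false) Skip.

(** Stack discipline: registers from [d] on are zero at the start; at the end [d] holds the value
    and the later ones are zero again. In [TRec], [d] is the iterate, [d.+1] the rounds left, [d.+2]
    the index; the minimum of [d.+3] and the cap [d.+4] is formed by running both down together.
    [TRd] walks along the data tape and back. *)
Fixpoint compile_term (t : term) (ctx : seq nat) (d : nat) : prog :=
  match t with
  | TVar i => if i < size ctx then copy_to (nth 0 ctx i) d else Skip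
  | TCst n => iter n (fun p => Seq p (Mv d true)) Skip
  | TAdd a b => Seq (compile_term a ctx d) (Seq (compile_term b ctx d.+1) (move_to d.+1 d))
  | TSub a b => Seq (compile_term a ctx d) (Seq (compile_term b ctx d.+1) (PLoop d.+1 (dec_sat d)))
  | TSum a b =>
      Seq (compile_term a ctx d.+1)
        (Seq (PLoop d.+1 (Seq (compile_term b (d.+2 :: ctx) d.+3)
                            (Seq (move_to d.+3 d) (Mv d.+2 true))))
           (clear d.+2))
  | TRec n a b c =>
      Seq (compile_term a ctx d) (Seq (compile_term n ctx d.+1)
        (Seq (PLoop d.+1 (Seq (compile_term b [:: d, d.+2 & ctx] d.+3) (Seq (compile_term c ctx d.+4)
            (Seq (clear d) (Seq (PLoop d.+3 (If d.+4 nonzero (Seq (Mv d.+4 false) (Mv d true)) Skip))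
              (Seq (clear d.+4) (Mv d.+2 true)))))))
           (clear d.+2)))
  | TRd a t =>
      Seq (compile_term t ctx d) (Seq (PLoop d (Seq (Mv d.+1 true) (Mv a true)))
        (Seq (If a is_one (Mv d true) Skip) (PLoop d.+1 (Mv a false))))
  | TDrop t => compile_term t (behead ctx) d
  end.

Definition oracle_of (s : store) : oracle := fun a j => is_one (s.1 a j).

Record ready (s : store) (d : nat) : Prop := Ready {
  ready_reg : forall r, 3 <= r -> s.1 r = register;
  ready_home : forall r, r < 3 -> s.2 r = 0;
  ready_zero : forall r, d <= r -> s.2 r = 0;
  ready_d : 3 <= d }.

Definition good_ctx (ctx : seq nat) (d : nat) : bool := all (fun r => 3 <= r < d) ctx.

Lemma ready_setr s d r v d' : ready s d -> d <= r < d' -> ready (setr s r v) d'.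
Proof.
case=> H1 H2 H3 H4 H; split=> //= [x x3|x xd|]; rewrite ?upd_other; try lia; auto.
by apply: H3; lia.
Qed.

Lemma ready_setr_lt s d r v : ready s d -> 3 <= r < d -> ready (setr s r v) d.
Proof.
case=> H1 H2 H3 H4 H; split=> //= [x x3|x xd]; rewrite ?upd_other; try lia; auto.
Qed.

Lemma readyW s d d' : ready s d -> d <= d' -> ready s d'.
Proof. by case=> H1 H2 H3 H4 H; split=> // [x xd|]; [apply: H3|]; lia. Qed.

Lemma good_ctxS ctx d d' : d <= d' -> good_ctx ctx d -> good_ctx ctx d'.
Proof. by move=> dd; apply: sub_all => r; lia. Qed.

Lemma map_setr ctx s d r v : good_ctx ctx d -> d <= r ->
  [seq (setr s r v).2 x | x <- ctx] = [seq s.2 x | x <- ctx].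
Proof.
move=> /allP H dr; apply/eq_in_map => x /H xd /=; rewrite upd_other //; lia.
Qed.

Definition compile_spec t := forall ctx d s B, ready s d -> good_ctx ctx d ->
  all (fun v => v <= B) [seq s.2 r | r <- ctx] ->
  evb (compile_term t ctx d) s (time_bound t B) (setr s d (den t (oracle_of s) [seq s.2 r | r <- ctx])).

Lemma compile_var i : compile_spec (TVar i).
Proof.
move=> ctx d s B [H1 H2 H3 H4] Hc HB /=.
case: ltnP => ic; last first.
  rewrite nth_default ?size_map // -(H3 d) // setr_id.
  by apply: evb_eq (evb_skip _) _ _ _ => //; lia.
have /= Hn := allP Hc _ (mem_nth 0 ic).
rewrite (nth_map 0) //.
apply: evb_eq (evb_copy _ _ _ _ _) _ _ _ => //; try lia; rewrite ?H1 ?(H3 d) ?(H3 d.+1) //; try lia.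
have := allP HB (s.2 (nth 0 ctx i)); rewrite map_f ?mem_nth // => /(_ isT) /=; lia.
Qed.

Lemma compile_cst n : compile_spec (TCst n).
Proof.
move=> ctx d s B [H1 H2 H3 H4] Hc HB /=.
elim: n => [|n IH] /=; first by apply: evb_eq (evb_skip s) _ _ _ => //; rewrite -(H3 d) ?setr_id.
rewrite -addn1; apply: evb_seq IH _.
apply: evb_eq (evb_inc _ _) _ _ _ => //.
by rewrite /= upd_same setr_setr addn1.
Qed.

Lemma compile_add a b : compile_spec a -> compile_spec b -> compile_spec (TAdd a b).
Proof.
move=> IHa IHb ctx d s B Hs Hc HB /=.
apply: evb_seq (IHa _ _ _ _ Hs Hc HB) _.
set va := den a _ _.
have Hs1 : ready (setr s d va) d.+1 by apply: ready_setr Hs _; lia.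
apply: evb_seq.
  apply: IHb (Hs1) _ _; first exact: good_ctxS Hc.
  by rewrite (map_setr _ _ Hc).
rewrite (map_setr _ _ Hc) //; set vb := den b _ _.
have Eb : vb <= value_bound b B by apply: den_bound.
have H0 := ready_zero Hs (leqnSn d); have H3 := ready_d Hs.
apply: evb_eq (evb_move _ _) (erefl _) _ _; rewrite /= ?upd_same; try lia.
- by apply: (ready_reg Hs); lia.
- by rewrite upd_other ?upd_same; [store_eq | lia].
Qed.

Lemma scanned_register s r : s.1 r = register -> nonzero (scanned s r) = (0 < s.2 r).
Proof. by move=> /nonzeroE ->; rewrite lt0n. Qed.

Lemma evb_dec_sat r s : s.1 r = register -> evb (dec_sat r) s 3 (setr s r (s.2 r).-1).
Proof.
move=> Hr; apply: evb_if; rewrite scanned_register //; case: ltnP => H.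
  exact: evb_dec.
apply: evb_eq (evb_skip s) _ _ _ => //.
by rewrite (_ : (s.2 r).-1 = s.2 r) ?setr_id //; lia.
Qed.

Lemma compile_sub a b : compile_spec a -> compile_spec b -> compile_spec (TSub a b).
Proof.
move=> IHa IHb ctx d s B Hs Hc HB /=.
apply: evb_seq (IHa _ _ _ _ Hs Hc HB) _.
set va := den a _ _.
have Hs1 : ready (setr s d va) d.+1 by apply: ready_setr Hs _; lia.
apply: evb_seq.
  apply: IHb (Hs1) _ _; first exact: good_ctxS Hc.
  by rewrite (map_setr _ _ Hc).
rewrite (map_setr _ _ Hc) //; set vb := den b _ _.
have Eb : vb <= value_bound b B by apply: den_bound.
have H0 := ready_zero Hs (leqnSn d); have H3 := ready_d Hs.
apply: evb_eq (@evb_loop d.+1 _ vb 3 (fun i => setr s d (va - i)) _ _) _ _ _.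
- by move=> i _; apply: (ready_reg Hs); lia.
- move=> i ib; apply: evb_eq (evb_dec_sat _) (erefl _) _ _ => //.
    by apply: (ready_reg Hs); lia.
  by rewrite /= upd_other ?upd_same; [store_eq | lia].
- by rewrite subn0.
- by store_eq.
- by lia.
Qed.

Lemma compile_rd r a : compile_spec a -> compile_spec (TRd r a).
Proof.
move=> IHa ctx d s B Hs Hc HB /=.
apply: evb_seq (IHa _ _ _ _ Hs Hc HB) _.
set va := den a _ _.
have Ea : va <= value_bound a B by apply: den_bound.
have H0 := ready_zero Hs (leqnSn d); have H3 := ready_d Hs.
have H1 := ready_zero Hs (leqnn d).
have Hr : s.2 r = 0 by apply: (ready_home Hs); case: (r) => /=.
have rd : r < d by case: (r) => /= m mr; lia.
have Hreg x : 3 <= x -> s.1 x = register by apply: (ready_reg Hs).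
(* The head of the data tape stands on the wanted cell, and [d.+1] remembers the way back. *)
pose s1 := setr (setr s d.+1 va) r va.
apply: (@evb_seq _ _ _ _ s1).
  apply: evb_eq (@evb_loop d _ va 2 (fun i => setr (setr s d.+1 i) r i) _ _) _ _ _.
  - by move=> i _; apply: Hreg.
  - move=> i ia; apply: (@evb_seq _ _ _ 1 _ 1); first exact: evb_inc.
    apply: evb_eq (evb_inc _ _) _ _ _ => //.
    by rewrite /= !(upd_same, upd_other) //; [store_eq | lia ..].
  - by store_eq.
  - by store_eq.
  - by lia.
pose b := oracle_of s r va.
have -> : (oracle_of s r va : nat) = b by [].
apply: (@evb_seq _ _ _ _ (setr s1 d b)).
  apply: (@evb_if _ _ _ _ _ 1).
  have -> : is_one (scanned s1 r) = b by rewrite /scanned /= upd_same.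
  case: (b).
    apply: evb_eq (evb_inc _ _) _ _ _ => //=.
    by rewrite /= !(upd_same, upd_other) ?H1 //; [lia..].
  by apply: evb_eq (evb_skip _) _ _ _ => //; store_eq.
apply: evb_eq (@evb_loop d.+1 _ va 1 (fun i => setr (setr s d b) r (va - i)) _ _) _ _ _.
- by move=> i _; apply: Hreg; lia.
- move=> i ia; apply: evb_eq (evb_dec _) (erefl _) _ _ => //.
    by rewrite /= !(upd_same, upd_other) //; [lia..].
  by rewrite /= !(upd_same, upd_other) //; [store_eq | lia ..].
- by store_eq.
- by store_eq.
- by lia.
Qed.

Lemma compile_drop t : compile_spec t -> compile_spec (TDrop t).
Proof.
move=> IH ctx d s B Hs Hc HB /=.
have E (f : nat -> nat) : [seq f r | r <- behead ctx] = behead [seq f r | r <- ctx] by case: (ctx).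
rewrite -E; apply: IH => //.
  by apply/allP => r /mem_behead; exact: (allP Hc).
by rewrite E; apply/allP => r /mem_behead; exact: (allP HB).
Qed.

Lemma compile_sum a b : compile_spec a -> compile_spec b -> compile_spec (TSum a b).
Proof.
move=> IHa IHb ctx d s B Hs Hc HB /=.
have Z x : d <= x -> s.2 x = 0 by apply: (ready_zero Hs).
have H3 := ready_d Hs.
have Hreg x : 3 <= x -> s.1 x = register by apply: (ready_reg Hs).
have Hs1 : ready s d.+1 by apply: readyW Hs _.
apply: evb_seq (IHa _ _ _ _ Hs1 (good_ctxS (leqnSn d) Hc) HB) _.
set e := [seq s.2 r | r <- ctx].
set va := den a _ _.
have Ea : va <= value_bound a B by apply: den_bound.
set V := value_bound a B in Ea *.
pose o := oracle_of s.
pose acc i := \sum_(j < i) den b o (nat_of_ord j :: e).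
pose F i := setr (setr s d (acc i)) d.+2 i.
set X := time_bound b (B + V) + _.
apply: (@evb_seq _ _ _ (V * (X + 3) + 1) (setr (F va) d.+1 0)).
  apply: evb_eq (@evb_loop d.+1 _ va X F _ _) _ _ _.
  - by move=> i _; apply: Hreg; lia.
  - move=> i ia.
    set s1 := setr (F i) d.+1 _.
    have Hs2 : ready s1 d.+3.
      by do 3!(apply: ready_setr_lt; last lia); apply: readyW Hs _; lia.
    have Em : [seq s1.2 r | r <- d.+2 :: ctx] = i :: e.
      rewrite map_cons; congr cons; first by rewrite /= !(upd_same, upd_other); lia.
      by rewrite /s1 /F !(map_setr _ _ Hc) //; lia.
    have Hc1 : good_ctx (d.+2 :: ctx) d.+3.
      by rewrite /= (good_ctxS _ Hc); lia.
    have HB1 : all (leq^~ (B + V)) [seq s1.2 r | r <- d.+2 :: ctx].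
      rewrite Em /=; apply/andP; split; first lia.
      by apply: sub_all HB => v /=; lia.
    have Eb := den_bound b o HB1.
    apply: evb_seq (IHb _ _ _ _ Hs2 Hc1 HB1) _; rewrite Em in Eb *.
    set vb := den b _ _.
    have Evb : vb <= value_bound b (B + V) by [].
    apply: evb_seq.
      apply: evb_eq (evb_move _ _) (erefl _) (erefl _) _; first lia.
        by apply: Hreg; lia.
      by rewrite /= upd_same; lia.
    apply: evb_eq (evb_inc _ _) (erefl _) _ _ => //.
    have Eacc : acc i.+1 = acc i + vb by rewrite /acc big_ord_recr.
    rewrite /F Eacc /s1 /F /= !(upd_same, upd_other); try lia.
    have Z3 : s.2 d.+3 = 0 by apply: Z; lia.
    store_eq.
  - have Z2 : s.2 d.+2 = 0 by apply: Z; lia.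
    have Z0 : s.2 d = 0 by apply: Z.
    have A0 : acc 0 = 0 by rewrite /acc big_ord0.
    rewrite /F A0; store_eq.
  - by [].
  - by apply: leq_add => //; apply: leq_mul.
apply: evb_eq (evb_clear _) (erefl _) _ _; first by apply: Hreg; lia.
  have Z2 : s.2 d.+2 = 0 by apply: Z; lia.
  have Z1 : s.2 d.+1 = 0 by apply: Z; lia.
  by rewrite -/(acc va) /F; store_eq.
by rewrite /= !(upd_same, upd_other); lia.
Qed.

Lemma compile_rec n a b c : compile_spec n -> compile_spec a -> compile_spec b -> compile_spec c ->
  compile_spec (TRec n a b c).
Proof.
move=> IHn IHa IHb IHc ctx d s B Hs Hc HB /=.
have Z x : d <= x -> s.2 x = 0 by apply: (ready_zero Hs).
have H3 := ready_d Hs.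
have Hreg x : 3 <= x -> s.1 x = register by apply: (ready_reg Hs).
set e := [seq s.2 r | r <- ctx] in HB *.
pose o := oracle_of s.
have En : den n o e <= value_bound n B by apply: den_bound.
have Ea : den a o e <= value_bound a B by apply: den_bound.
have Ec : den c o e <= value_bound c B by apply: den_bound.
set N := value_bound n B in En *.
set V := value_bound a B + value_bound c B.
pose f i x := minn (den c o e) (den b o [:: x, i & e]).
pose x i := iteri i f (den a o e).
have xV i : x i <= V by apply: iteri_bound => // j y; rewrite geq_min Ec.
pose F i := setr (setr s d (x i)) d.+2 i.
apply: evb_seq (IHa _ _ _ _ Hs Hc HB) _.
apply: evb_seq.
  apply: (IHn ctx d.+1 _ B); last by rewrite (map_setr _ _ Hc).
    by apply: ready_setr Hs _; lia.
  exact: good_ctxS Hc.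
rewrite (map_setr _ _ Hc) // -/e -/o -/(den n o e).
set X := time_bound b _ + _.
apply: (@evb_seq _ _ _ (N * (X + 3) + 1) (setr (F (den n o e)) d.+1 0)).
  apply: evb_eq (@evb_loop d.+1 _ (den n o e) X F _ _) _ _ _.
  - by move=> i _; apply: Hreg; lia.
  - move=> i ia.
    set s1 := setr (F i) d.+1 _.
    have Hs2 : ready s1 d.+3.
      by do 3!(apply: ready_setr_lt; last lia); apply: readyW Hs _; lia.
    have Em0 : [seq s1.2 r | r <- ctx] = e by rewrite /s1 /F !(map_setr _ _ Hc) //; lia.
    have Em : [seq s1.2 r | r <- [:: d, d.+2 & ctx]] = [:: x i, i & e].
      by rewrite !map_cons Em0 /= !(upd_same, upd_other) //; lia.
    have Hc1 : good_ctx [:: d, d.+2 & ctx] d.+3.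
      by rewrite /= (good_ctxS _ Hc); lia.
    have HB1 : all (leq^~ (B + (N + V))) [seq s1.2 r | r <- [:: d, d.+2 & ctx]].
      rewrite Em /=; have xVi := xV i; apply/and3P; split; try lia.
      by apply: sub_all HB => v /=; lia.
    have Eb := den_bound b o HB1.
    apply: evb_seq (IHb _ _ _ _ Hs2 Hc1 HB1) _; rewrite Em in Eb *.
    set vb := den b _ _.
    have Evb : vb <= value_bound b (B + (N + V)) by [].
    set s2 := setr s1 d.+3 vb.
    have Hc2 : good_ctx ctx d.+3 by apply: good_ctxS Hc; lia.
    have Em2 : [seq s2.2 r | r <- ctx] = e by rewrite /s2 (map_setr _ _ Hc2).
    apply: evb_seq.
      apply: (IHc ctx d.+4 s2 B); last by rewrite Em2.
        by apply: ready_setr Hs2 _; lia.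
      exact: good_ctxS Hc2.
    rewrite Em2; set vc := den c _ _.
    have Evc : vc <= value_bound c B by [].
    apply: evb_seq.
      apply: evb_eq (evb_clear _) (erefl _) (erefl _) _; first by apply: Hreg; lia.
      by rewrite /= !(upd_same, upd_other); have := xV i; lia.
    (* After [k] units of the new value are consumed, [d] holds those that the cap could match and
       [d.+4] what remains of the cap. *)
    pose G k := setr (setr (setr (setr (setr s d.+1 (den n o e - i.+1)) d.+2 i) d.+3 vb)
       d (minn vc k)) d.+4 (vc - k).
    apply: (@evb_seq _ _ _ _ (setr (G vb) d.+3 0)).
      apply: evb_eq (@evb_loop d.+3 _ vb 4 G _ _) _ _ _.
      + by move=> k _; apply: Hreg.
      + move=> k kb; apply: (@evb_if _ _ _ _ _ 2).
        rewrite scanned_register; last by apply: Hreg.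
        rewrite /= !(upd_same, upd_other); try lia.
        case: ltnP => H.
          apply: (@evb_seq _ _ _ 1 _ 1).
            apply: evb_eq (evb_dec _) (erefl _) (erefl _) _ => //.
            by rewrite /= !(upd_same, upd_other); lia.
          apply: evb_eq (evb_inc _ _) (erefl _) _ _ => //.
          by rewrite /G /= !(upd_same, upd_other); try lia; store_eq.
        by apply: evb_eq (evb_skip _) _ _ _ => //; rewrite /G; store_eq.
      + by rewrite /G /s2 /s1 /F; store_eq.
      + by [].
      + by lia.
    apply: evb_seq.
      apply: evb_eq (evb_clear _) (erefl _) (erefl _) _; first by apply: Hreg; lia.
      by rewrite /= !(upd_same, upd_other); rewrite /V; lia.
    apply: evb_eq (evb_inc _ _) (erefl _) _ _ => //.
    have Ex : x i.+1 = minn vc vb by [].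
    have Z3 : s.2 d.+3 = 0 by apply: Z; lia.
    have Z4 : s.2 d.+4 = 0 by apply: Z; lia.
    by rewrite /F Ex /G /= !(upd_same, upd_other); try lia; store_eq.
  - have Z2 : s.2 d.+2 = 0 by apply: Z; lia.
    by rewrite /F /x /=; store_eq.
  - by [].
  - by apply: leq_add => //; apply: leq_mul.
apply: evb_eq (evb_clear _) (erefl _) _ _; first by apply: Hreg; lia.
  have Z2 : s.2 d.+2 = 0 by apply: Z; lia.
  have Z1 : s.2 d.+1 = 0 by apply: Z; lia.
  by rewrite -/(x (den n o e)) /F; store_eq.
by rewrite /= !(upd_same, upd_other); lia.
Qed.

Lemma compile_correct t : compile_spec t.
Proof.
elim: t => *; by [apply: compile_var | apply: compile_cst | apply: compile_add | apply: compile_sub |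
  apply: compile_sum | apply: compile_rec | apply: compile_rd | apply: compile_drop].
Qed.

Definition poly_fun (f : nat -> nat) : Prop := exists p : {poly nat}, forall n, f n = p.[n]%R.

Lemma poly_fun_id : poly_fun id.
Proof. by exists ('X)%R => n; rewrite hornerX. Qed.

Lemma poly_fun_const c : poly_fun (fun=> c).
Proof. by exists (c%:P)%R => n; rewrite hornerC. Qed.

Lemma poly_fun_add f g : poly_fun f -> poly_fun g -> poly_fun (fun n => f n + g n).
Proof. by case=> p Hp [q Hq]; exists (p + q)%R => n; rewrite hornerD Hp Hq. Qed.

Lemma poly_fun_mul f g : poly_fun f -> poly_fun g -> poly_fun (fun n => f n * g n).
Proof. by case=> p Hp [q Hq]; exists (p * q)%R => n; rewrite hornerM Hp Hq. Qed.

Lemma poly_fun_comp f g : poly_fun f -> poly_fun g -> poly_fun (fun n => f (g n)).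
Proof. by case=> p Hp [q Hq]; exists (p \Po q)%R => n; rewrite horner_comp Hp Hq. Qed.

Ltac poly_fun_tac := repeat first [assumption | apply: poly_fun_id | apply: poly_fun_const
  | apply: poly_fun_add | apply: poly_fun_mul].

Lemma poly_fun_value t : poly_fun (value_bound t).
Proof.
elim: t => /= [i|n|a Ha b Hb|a Ha b Hb|a Ha b Hb|n Hn a Ha b Hb c Hc|r a Ha|t Ht]; poly_fun_tac.
by apply: poly_fun_comp => //; poly_fun_tac.
Qed.

Lemma poly_fun_time t : poly_fun (time_bound t).
Proof.
elim: t => /= [i|n|a Ha b Hb|a Ha b Hb|a Ha b Hb|n Hn a Ha b Hb c Hc|r a Ha|t Ht];
  poly_fun_tac; try exact: poly_fun_value;
  by apply: poly_fun_comp => //; first [exact: poly_fun_value | idtac]; poly_fun_tac; exact: poly_fun_value.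
Qed.

(** * Filling a bit array by course-of-values recursion *)

Definition write_at (a i v tmp : nat) : prog :=
  Seq (PLoop i (Seq (Mv tmp true) (Mv a true)))
    (Seq (If v nonzero (Wr a (Some (inl true))) (Wr a (Some (inl false))))
      (Seq (PLoop tmp (Seq (Mv i true) (Mv a false))) (clear v))).

Lemma evb_write_at a i v tmp s : uniq [:: a; i; v; tmp] ->
  s.1 i = register -> s.1 v = register -> s.1 tmp = register ->
  s.2 a = 0 -> s.2 tmp = 0 ->
  evb (write_at a i v tmp) s (s.2 i * 10 + s.2 v * 3 + 6)
    (setr (upd s.1 a (upd (s.1 a) (s.2 i) (Some (inl (s.2 v != 0)))), s.2) v 0).
Proof.
rewrite /= !inE !negb_or => /and3P[/and3P[ai av at_] /andP[iv it_] /andP[vt _]] Hi Hv Ht Ha Htmp.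
set n := s.2 i.
have Hn : s.2 i = n by [].
pose s1 := setr (setr (setr s tmp n) a n) i 0.
pose s2 : store := (upd s.1 a (upd (s.1 a) n (Some (inl (s.2 v != 0)))), s1.2).
have -> : n * 10 + s.2 v * 3 + 6 = (n * 5 + 1) + (3 + ((n * 5 + 1) + (s.2 v * 3 + 1))) by lia.
apply: (@evb_seq _ _ _ _ s1).
  apply: evb_eq (@evb_loop i _ n 2 (fun k => setr (setr s tmp k) a k) _ _) _ _ _ => //.
    move=> k kn; apply: (@evb_seq _ _ _ 1 _ 1); first exact: evb_inc.
    apply: evb_eq (evb_inc _ _) (erefl _) _ _ => //.
    by rewrite /= !(upd_same, upd_other) //; [store_eq | lia ..].
  by store_eq.
apply: (@evb_seq _ _ _ _ s2).
  apply: (@evb_if _ _ _ _ _ 1); rewrite scanned_register // lt0n.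
  have E b : evb (Wr a (Some (inl b))) s1 1
      (upd s.1 a (upd (s.1 a) n (Some (inl b))), s1.2).
    exists 1 => //; have := @EvWr a (Some (inl b)) s1.
    by rewrite (_ : s1.2 a = n) //= upd_other // upd_same.
  rewrite /s2 (_ : s1.2 v = s.2 v); last by rewrite /= !upd_other // eq_sym.
  by case: (s.2 v) => [|m] /=; apply: E.
apply: (@evb_seq _ _ _ _ (setr (setr (setr s2 a 0) i n) tmp 0)).
  apply: evb_eq (@evb_loop tmp _ n 2 (fun k => setr (setr s2 a (n - k)) i k) _ _) _ _ _ => //.
  - by move=> k _; rewrite /= upd_other // eq_sym.
  - move=> k kn; apply: (@evb_seq _ _ _ 1 _ 1); first exact: evb_inc.
    apply: evb_eq (evb_dec _) (erefl _) _ _ => //.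
      by rewrite /= !(upd_same, upd_other) //; lia.
    by rewrite /= !(upd_same, upd_other) //; try lia; store_eq.
  - by store_eq.
  - by store_eq.
apply: evb_eq (evb_clear _) (erefl _) _ _ => //.
- by rewrite /= upd_other // eq_sym.
- by rewrite /s2 /s1; store_eq.
- by rewrite /= !(upd_same, upd_other) //; lia.
Qed.

Definition set_array (s : store) (a n : nat) (b : nat -> bool) : store :=
  (upd s.1 a (fun j => if j < n then Some (inl (b j)) else s.1 a j), s.2).

(** Register 6 is the position and register 7 counts the entries left. While the array on tape 2 is
    filled, [TRd] sees the entries already written and reads the blanks behind them as false, so an
    entry may depend on all earlier ones. Iterating an operation on whole data structures is reduced
    to this. *)
Definition fill (a : nat) (t : term) (ctx : seq nat) : prog :=
  PLoop 7 (Seq (compile_term t (6 :: ctx) 8) (Seq (write_at a 6 8 9) (Mv 6 true))).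

Lemma evb_fill (a : 'I_3) t ctx s n b B :
  ready s 6 -> good_ctx ctx 6 -> all (leq^~ B) [seq s.2 r | r <- ctx] -> n <= B ->
  (forall p, p < n ->
     (den t (oracle_of (set_array s a p b)) (p :: [seq s.2 r | r <- ctx]) != 0) = b p) ->
  evb (fill a t ctx) (setr s 7 n)
    (n * (time_bound t B + ((B * 10 + value_bound t B * 3 + 6) + 1) + 3) + 1)
    (setr (set_array s a n b) 6 n).
Proof.
move=> Hs Hc HB nB Hb.
have Z x : 6 <= x -> s.2 x = 0 by apply: (ready_zero Hs).
have Z6 := Z 6 (leqnn _); have Z7 := Z 7 isT; have Z8 := Z 8 isT; have Z9 := Z 9 isT.
have Za : s.2 a = 0 by apply: (ready_home Hs).
have a3 : a < 3 by [].
pose F i := setr (set_array s a i b) 6 i.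
have Hreg i x : 3 <= x -> (set_array s a i b).1 x = register.
  by move=> x3; rewrite /= upd_other ?(ready_reg Hs) //; lia.
have Hs1 i : ready (set_array s a i b) 8.
  split=> // [r r3|r r3|r r8].
  - exact: Hreg.
  - exact: (ready_home Hs).
  - by apply: Z; lia.
apply: evb_eq (@evb_loop 7 _ n _ F _ _) _ _ (leqnn _); last 2 first.
- apply: store_ext => [|x] /=; last by rewrite /upd; do 2!case: eqP => // ?; subst; lia.
  apply: functional_extensionality => x; rewrite /upd; case: eqP => // ->.
  exact: functional_extensionality.
- by store_eq.
- by move=> i _; apply: Hreg.
move=> i iltn; set s1 := setr (F i) 7 _.
have Hs2 : ready s1 8 by do 2!(apply: ready_setr_lt; last by []).
have Em0 : [seq s1.2 r | r <- ctx] = [seq s.2 r | r <- ctx].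
  by rewrite /s1 /F !(map_setr _ _ Hc).
have Em : [seq s1.2 r | r <- 6 :: ctx] = i :: [seq s.2 r | r <- ctx].
  by rewrite map_cons Em0.
have Hc1 : good_ctx (6 :: ctx) 8 by rewrite /= (good_ctxS _ Hc).
have HB1 : all (leq^~ B) [seq s1.2 r | r <- 6 :: ctx] by rewrite Em /= HB andbT; lia.
have Ev := den_bound t (oracle_of s1) HB1.
apply: evb_seq (compile_correct t Hs2 Hc1 HB1) _; rewrite Em in Ev *.
set v := den t _ _.
have Ebv : (v != 0) = b i by apply: Hb.
have Evb : v <= value_bound t B by [].
apply: evb_seq.
  apply: evb_eq (evb_write_at _ _ _ _ _ _) (erefl _) (erefl _) _.
  - by rewrite /= !inE; case: (a : nat) a3 => [|[|[|]]].
  - exact: Hreg.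
  - exact: Hreg.
  - exact: Hreg.
  - by rewrite /= /upd; case: (a : nat) a3 Za => [|[|[|]]].
  - by [].
  - by rewrite /= !(upd_same, upd_other) //; lia.
apply: evb_eq (evb_inc _ _) (erefl _) _ _ => //.
rewrite /= !(upd_same, upd_other) //.
apply: store_ext => [|x] /=; last first.
  by rewrite /upd; repeat (case: eqP => // ?); subst; lia.
apply: functional_extensionality => x; rewrite /upd; case: eqP => // _.
apply: functional_extensionality => j; rewrite ?eqxx Ebv ltnS.
by case: eqP => [->|/eqP/negbTE ne]; [rewrite leqnn | rewrite (leq_eqVlt j i) ne].
Qed.

(** Work tapes start blank; the origin symbol that ends every [PLoop] has to be written first. *)
Definition marks (K : nat) : prog :=
  foldr (fun r p => Seq (Wr r (Some (inr tt))) p) Skip (iota 3 K).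

Lemma width_marks K : width (marks K) <= K + 3.
Proof.
rewrite /marks; have : forall m, width (foldr (fun r p => Seq (Wr r (Some (inr tt))) p) Skip (iota m K)) <= K + m.
  by elim: K => //= K IH m; rewrite geq_max; have := IH m.+1; lia.
exact.
Qed.

Lemma evb_marks K m s : (forall r, m <= r < m + K -> s.2 r = 0 /\ s.1 r = fun=> None) ->
  evb (foldr (fun r p => Seq (Wr r (Some (inr tt))) p) Skip (iota m K)) s K
    ((fun r => if m <= r < m + K then register else s.1 r), s.2).
Proof.
elim: K m s => [|K IH] m s H /=.
  apply: evb_eq (evb_skip s) (erefl _) _ _ => //.
  apply: store_ext => //=; apply: functional_extensionality => r.
  by have -> : (m <= r < m + 0) = false by lia.
have [H0 H1] := H m (ltac:(lia)).
apply: (@evb_seq _ _ _ 1 (upd s.1 m register, s.2) K).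
  exists 1 => //; have := @EvWr m (Some (inr tt)) s; rewrite H0 H1.
  rewrite (_ : upd (fun=> None) 0 (Some (inr tt)) = register) //.
apply: evb_eq (IH m.+1 _ _) (erefl _) _ _ => //= [r rm|].
  have [h0 h1] := H r (ltac:(lia)).
  by rewrite upd_other //; lia.
apply: store_ext => //=; apply: functional_extensionality => r; rewrite /upd.
have [->|ne] := eqVneq r m.
  by rewrite if_same ifT //; lia.
by have -> : (m < r < m.+1 + K) = (m <= r < m + K.+1) by move/eqP: ne; lia.
Qed.

Definition is_bit : pred tsym := fun a => if a is Some (inl _) then true else false.

Definition scan : prog :=
  Seq (While 0 is_bit (Seq (Mv 0 true) (Seq (Mv 3 true) (Mv 4 true))))
    (PLoop 4 (Mv 0 false)).

Definition input_cells (x : seq bool) : nat -> tsym :=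
  fun j => nth None [seq Some (inl b) | b <- x] j.

Lemma is_bit_cells x j : is_bit (input_cells x j) = (j < size x).
Proof.
rewrite /input_cells; case: (ltnP j (size x)) => H; first by rewrite (nth_map false).
by rewrite nth_default ?size_map.
Qed.

Lemma is_one_cells x j : is_one (input_cells x j) = nth false x j.
Proof.
rewrite /input_cells; case: (ltnP j (size x)) => H.
  by rewrite (nth_map false) // /is_one; case: nth.
by rewrite !nth_default ?size_map.
Qed.

Lemma evb_scan s x : s.1 0 = input_cells x -> s.1 4 = register ->
  s.2 0 = 0 -> s.2 3 = 0 -> s.2 4 = 0 ->
  evb scan s ((size x * 5 + 1) + (size x * 4 + 1)) (setr s 3 (size x)).
Proof.
move=> Hx H4 Z0 Z3 Z4; set n := size x.
pose F j := setr (setr (setr s 0 j) 3 j) 4 j.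
apply: (@evb_seq _ _ _ _ (F n)).
  apply: evb_eq (_ : evb _ (F 0) (n * 5 + 1) (F n)) _ (erefl _) (leqnn _); last first.
    by rewrite /F; store_eq.
  suff H k : k <= n -> evb (While 0 is_bit (Seq (Mv 0 true) (Seq (Mv 3 true) (Mv 4 true))))
      (F (n - k)) (k * 5 + 1) (F n).
    by have := H n (leqnn n); rewrite subnn.
  elim: k => [|k IH] kn.
    rewrite subn0; exists 1 => //; apply: EvWhileF.
    by rewrite /scanned /= Hx !(upd_same, upd_other) // is_bit_cells ltnn.
  have [m mB e] := IH (ltnW kn).
  exists ((1 + (1 + 1)).+2 + m); first lia.
  have E : n - k = (n - k.+1).+1 by lia.
  apply: EvWhileT e.
    by rewrite /scanned /= Hx !(upd_same, upd_other) // is_bit_cells; lia.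
  apply: EvSeq; first exact: EvRight.
  apply: EvSeq; first exact: EvRight.
  have := @EvRight 4; set s1 := (_, _); move=> /(_ s1); rewrite E.
  have -> // : (s1.1, upd s1.2 4 (s1.2 4).+1) = F (n - k.+1).+1.
  by rewrite /s1 /F; store_eq.
apply: evb_eq (@evb_loop 4 _ n 1 (fun k => setr (setr s 0 (n - k)) 3 n) _ _) _ _ _ => //.
- move=> k kn; apply: evb_eq (evb_dec _) (erefl _) _ _ => //.
    by rewrite /= !(upd_same, upd_other) //; lia.
  by rewrite /= !(upd_same, upd_other) //; store_eq.
- by rewrite /F; store_eq.
- by store_eq.
Qed.

(** The input may be longer than the output that overwrites it, so a blank is written right behind
    the output, whose length is in register 6. *)
Definition finish : prog :=
  Seq (PLoop 6 (Seq (Mv 8 true) (Mv 0 true))) (Seq (Wr 0 None) (PLoop 8 (Mv 0 false))).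

Lemma evb_finish s : s.1 6 = register -> s.1 8 = register -> s.2 0 = 0 -> s.2 8 = 0 ->
  evb finish s ((s.2 6 * 5 + 1) + (1 + (s.2 6 * 4 + 1)))
    (upd s.1 0 (upd (s.1 0) (s.2 6) None), upd s.2 6 0).
Proof.
move=> H6 H8 Z0 Z8; set n := s.2 6.
have Hn : s.2 6 = n by [].
pose s1 := setr (setr (setr s 8 n) 0 n) 6 0.
pose s2 : store := (upd s.1 0 (upd (s.1 0) n None), s1.2).
apply: (@evb_seq _ _ _ _ s1).
  apply: evb_eq (@evb_loop 6 _ n 2 (fun k => setr (setr s 8 k) 0 k) _ _) _ _ _ => //.
    move=> k kn; apply: (@evb_seq _ _ _ 1 _ 1); first exact: evb_inc.
    apply: evb_eq (evb_inc _ _) (erefl _) _ _ => //.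
    by rewrite /= !(upd_same, upd_other) //; store_eq.
  by store_eq.
apply: (@evb_seq _ _ _ _ s2).
  exists 1 => //; have := @EvWr 0 None s1.
  by rewrite (_ : s1.2 0 = n) //= upd_other // upd_same.
apply: evb_eq (@evb_loop 8 _ n 1 (fun k => setr (setr s2 0 (n - k)) 6 0) _ _) _ _ _ => //.
- move=> k kn; apply: evb_eq (evb_dec _) (erefl _) _ _ => //.
    by rewrite /= !(upd_same, upd_other) //; lia.
  by rewrite /= !(upd_same, upd_other) //; store_eq.
- by store_eq.
- by store_eq.
Qed.

Lemma leading_bits_eq (M : tm) (r : seq (symbol M)) n (b : nat -> bool) :
  (forall j, j < n -> nth None r j = Some (inl (b j))) -> nth None r n = None ->
  leading_bits r = mkseq b n.
Proof.
elim: n r b => [|n IH] r b H0 H1; first by case: r H0 H1 => [|a r] // _ /= ->.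
have := H0 0 isT; case: r H0 H1 => [|a r] //= H0 H1 ->.
rewrite (IH r (fun j => b j.+1)) //; last by move=> j jn; apply: (H0 j.+1).
by rewrite /mkseq /= (iotaDl 1 0 n) -map_comp.
Qed.

Section Main.
Variables tL t toff : term.

(** Registers 3, 4 and 5 hold the length of the input, the length of the array and the start of the
    output in it. The array is built on tape 2, and its part from [toff] on is then copied over the
    input; what precedes [toff] is scratch space. *)
Definition body : prog :=
  Seq scan (Seq (compile_term tL [:: 3] 4) (Seq (compile_term toff [:: 3] 5)
    (Seq (copy_to 4 7) (Seq (fill 2 t [:: 3]) (Seq (clear 6)
      (Seq (compile_term (TSub (TVar 0) (TVar 1)) [:: 4; 5] 7)
        (Seq (fill 0 (TRd (@Ordinal 3 2 isT) (TAdd (TVar 0) (TVar 1))) [:: 5]) finish))))))).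

Definition fill_time u B := time_bound u B + ((B * 10 + value_bound u B * 3 + 6) + 1) + 3.

Definition body_time (n : nat) : nat :=
  let V := value_bound tL n in
  let V' := value_bound toff n in
  let tcopy := TRd (@Ordinal 3 2 isT) (TAdd (TVar 0) (TVar 1)) in
  ((n * 5 + 1) + (n * 4 + 1)) + (time_bound tL n + (time_bound toff n + ((V * 9 + 2) +
   ((V * fill_time t (n + V) + 1) + ((V * 3 + 1) +
     (time_bound (TSub (TVar 0) (TVar 1)) (V + V') +
      ((V * fill_time tcopy (V + V') + 1) + ((V * 5 + 1) + (1 + (V * 4 + 1)))))))))).

Lemma poly_fun_fill_time u : poly_fun (fill_time u).
Proof. by rewrite /fill_time; poly_fun_tac; [apply: poly_fun_time | apply: poly_fun_value]. Qed.

Lemma poly_fun_body_time : poly_fun body_time.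
Proof.
rewrite /body_time; poly_fun_tac; try first [apply: poly_fun_time | apply: poly_fun_value];
  by apply: poly_fun_comp; try first [apply: poly_fun_fill_time | apply: poly_fun_time];
     poly_fun_tac; apply: poly_fun_value.
Qed.

Lemma den_ext u o o' e : (forall a j, a < 3 -> o a j = o' a j) -> den u o e = den u o' e.
Proof.
move=> H; elim: u e => //= [a IHa b IHb|a IHa b IHb|a IHa b IHb|n IHn a IHa b IHb c IHc|r a IHa] e.
- by rewrite IHa IHb.
- by rewrite IHa IHb.
- by rewrite IHa; apply: eq_bigr => i _.
- by rewrite IHn IHa IHc; elim: (den n o' e) => //= k ->; rewrite IHb.
- by rewrite IHa H.
Qed.

Definition array_oracle (x y : seq bool) (p : nat) (b : nat -> bool) : oracle :=
  fun a j => if a is a'.+1 then if a' is 0 then nth false y j else (j < p) && b j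
             else nth false x j.

Lemma evb_body s x y b :
  s.1 0 = input_cells x -> s.1 1 = input_cells y -> s.1 2 = (fun=> None) ->
  (forall r, 3 <= r -> s.1 r = register) -> (forall r, s.2 r = 0) ->
  let L := den tL (array_oracle x y 0 b) [:: size x] in
  let off := den toff (array_oracle x y 0 b) [:: size x] in
  (forall p, p < L -> b p = (den t (array_oracle x y p b) [:: p; size x] != 0)) ->
  exists2 s', evb body s (body_time (size x)) s' &
    [/\ s'.2 0 = 0, (forall j, j < L - off -> s'.1 0 j = Some (inl (b (off + j)))) &
        s'.1 0 (L - off) = None].
Proof.
move=> Hx Hy HS Hreg Z L off Hb; set n := size x in L off Hb *.
have Hs4 : ready (setr s 3 n) 4.
  split=> // [r r3|r r4].
    by rewrite /= upd_other ?Z //; lia.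
  by rewrite /= upd_other ?Z //; lia.
have Oeq (s1 : store) : s1.1 = s.1 ->
    forall a j, a < 3 -> oracle_of s1 a j = array_oracle x y 0 b a j.
  move=> E [|[|[|a]]] j //= _; rewrite /oracle_of E ?Hx ?Hy ?HS //; exact: is_one_cells.
have EL : den tL (oracle_of (setr s 3 n)) [seq (setr s 3 n).2 r | r <- [:: 3]] = L.
  by rewrite /= upd_same; apply: den_ext; apply: Oeq.
pose s2 := setr (setr (setr s 3 n) 4 L) 5 off.
have Hs5 : ready (setr (setr s 3 n) 4 L) 5 by apply: ready_setr Hs4 _.
have Hs6 : ready s2 6 by apply: ready_setr Hs5 _.
have Eoff : den toff (oracle_of (setr (setr s 3 n) 4 L))
    [seq (setr (setr s 3 n) 4 L).2 r | r <- [:: 3]] = off.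
  by rewrite /= !(upd_same, upd_other) //; apply: den_ext; apply: Oeq.
set V := value_bound tL n; set V' := value_bound toff n.
have LV : L <= V by apply: den_bound; rewrite /= leqnn.
have offV : off <= V' by apply: den_bound; rewrite /= leqnn.
pose s3 := set_array s2 2 L b.
have Hs7 : ready s3 6.
  case: Hs6 => h1 h2 h3 h4; split => // r r3; rewrite /s3 /= upd_other ?Hreg //; lia.
pose b' i := b (off + i).
pose s4 := setr (set_array s3 0 (L - off) b') 6 (L - off).
exists (upd s4.1 0 (upd (s4.1 0) (s4.2 6) None), upd s4.2 6 0); last first.
  rewrite /s4 /=; split.
  - by rewrite !(upd_same, upd_other) ?Z.
  - by move=> j jL; rewrite !upd_same upd_other ?jL //; lia.
  - by rewrite !upd_same.
rewrite /body /body_time -/n -/V -/V'.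
apply: evb_seq; first by apply: evb_scan => //; rewrite ?Hreg ?Z.
apply: evb_seq.
  apply: compile_correct (Hs4) _ _ => //=; by rewrite /= upd_same leqnn.
rewrite EL; apply: evb_seq.
  apply: compile_correct (Hs5) _ _ => //=; by rewrite /= !(upd_same, upd_other) ?leqnn.
rewrite Eoff -/s2.
apply: evb_seq.
  apply: evb_eq (evb_copy _ _ _ _ _) (erefl _) (erefl _) _; rewrite ?(ready_reg Hs6) //;
    try by apply: (ready_zero Hs6).
  by rewrite /s2 /= !(upd_same, upd_other) //; lia.
rewrite (_ : s2.2 4 = L) //.
apply: evb_seq.
  apply: evb_eq (@evb_fill (@Ordinal 3 2 isT) t [:: 3] s2 L b (n + V) _ _ _ _ _) _ _ _ => //.
  - by rewrite /= !(upd_same, upd_other) //; lia.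
  - by lia.
  - move=> p pL; rewrite Hb //= !(upd_same, upd_other) //; congr (_ != _).
    apply: den_ext => a j a3; rewrite /oracle_of /set_array /upd /=.
    case: a a3 => [|[|[|a]]] //= _; rewrite ?Hx ?Hy ?HS ?is_one_cells //.
    by case: ifP => //= _; case: (b j).
  - by rewrite /fill_time leq_add2r leq_mul2r LV orbT.
rewrite -/s3.
apply: evb_seq.
  apply: evb_eq (evb_clear _) (erefl _) (_ : _ = s3) _; first by rewrite /s3 /= upd_other ?Hreg.
    by rewrite /s3; store_eq; rewrite Z.
  by rewrite /= upd_same; lia.
apply: evb_seq.
  apply: evb_eq (@compile_correct (TSub (TVar 0) (TVar 1)) [:: 4; 5] 7 s3 (V + V') _ _ _)
    (erefl _) (erefl _) (leqnn _) => //.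
    by apply: readyW Hs7 _.
  by rewrite /= !(upd_same, upd_other) //; lia.
rewrite /= !(upd_same, upd_other) //.
apply: evb_seq.
  apply: evb_eq (@evb_fill (@Ordinal 3 0 isT) _ [:: 5] s3 (L - off) b' (V + V') _ _ _ _ _) _ _ _ => //.
  - by rewrite /= !(upd_same, upd_other) //; lia.
  - by lia.
  - move=> p pL; rewrite /= !(upd_same, upd_other) //.
    rewrite /oracle_of /set_array /upd /=.
    rewrite ?upd_same; have -> : p + off < L by lia.
    by rewrite /is_one /b' addnC; case: (b _).
  - by rewrite /fill_time leq_add2r leq_mul2r; apply/orP; right; lia.
rewrite -/s4.
have E6 : s4.2 6 = L - off by [].
apply: evb_eq (evb_finish _ _ _ _) (erefl _) (erefl _) _; rewrite ?E6.
- by rewrite /s4 /= !upd_other ?Hreg.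
- by rewrite /s4 /= !upd_other ?Hreg.
- by rewrite /s4 /= !upd_other ?Z.
- by rewrite /s4 /= !upd_other ?Z.
- by lia.
Qed.

(** The array enters as any [b] that satisfies its own recursion equation, so a closed description
    of the bits can be supplied. The same machine serves as a transducer and, through its first
    output bit, as a decider. *)
Theorem fill_machine : exists (M : tm) (P : {poly nat}), forall x y b,
  let L := den tL (array_oracle x y 0 b) [:: size x] in
  let off := den toff (array_oracle x y 0 b) [:: size x] in
  (forall p, p < L -> b p = (den t (array_oracle x y p b) [:: p; size x] != 0)) ->
  exists C, [/\ run P.[size x]%R (tm_init M [:: x; y]) = Some C,
    output C = mkseq (fun i => b (off + i)) (L - off) &
    accepting C = (off < L) && b off].
Proof.
have [K HK] : exists K, width body = K by exists (width body).
pose p := Seq (marks K) body.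
have [P HP] : poly_fun (fun n => (K + body_time n).+1).
  have [P HP] := poly_fun_body_time; exists (P + (K.+1)%:P)%R => n.
  by rewrite hornerD hornerC -HP /=; lia.
exists (machine p K.+2), P => x y b L off Hb.
(* Tapes beyond those of the machine are declared to be marked registers, since [evb_body] asks for
   a register at every index from 3 on. *)
pose k0 r : nat -> tsym := if r <= K.+2 then input_cells (nth [::] [:: x; y] r) else register.
pose s0 : store := (k0, fun=> 0).
pose s1 : store := ((fun r => if 3 <= r < 3 + K then register else k0 r), fun=> 0).
have e1 : evb (marks K) s0 K s1.
  apply: evb_marks => r r3; split=> //=; rewrite /k0 ifT; last lia.
  by case: r r3 => [|[|[|r]]] // _; apply: functional_extensionality => j; rewrite /input_cells /= !nth_nil.
have [|||||s' e2 [H0 Hj HL]] := @evb_body s1 x y b _ _ _ _ _ Hb.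
- by [].
- by [].
- by apply: functional_extensionality => j; rewrite /s1 /k0 /= /input_cells nth_nil.
- by move=> r r3; rewrite /s1 /= /k0; case: ifP => // h; rewrite ifF //; lia.
- by [].
have [n nB e] := evb_seq e1 e2.
have Hw : width p <= K.+2.+1.
  rewrite [width p]/(maxn (width (marks K)) (width body)) HK geq_max.
  by have := width_marks K; lia.
have HC : cfg_rep (tm_init (machine p K.+2) [:: x; y]) 0 s0.
  split; first by rewrite /= inordK.
  move=> i; rewrite /= ffunE; split => // j.
  by rewrite /= add0n /k0 ifT //; rewrite -ltnS.
have [C RC [Ha Ht]] := run_machine Hw e HC.
have Hacc : scanned s' 0 = if off < L then Some (inl (b off)) else None.
  rewrite /scanned H0; case: ltnP => oL; first by rewrite Hj ?addn0 //; lia.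
  by rewrite -HL; congr (s'.1 0 _); lia.
exists C; split.
- have run_mono (M : tm) u v (D D' : config M) : u <= v -> run u D = Some D' -> run v D = Some D'.
    elim: u v D => [|u IH] [|v] D //= uv; rewrite /run -/run; case: (tm_step D) => //= D1; exact: IH.
  by apply: run_mono RC; rewrite -HP ltnS.
- rewrite /output; apply: leading_bits_eq => [j jL|]; have [Hr _] := Ht ord0; rewrite Hr /= H0 add0n.
    exact: Hj.
  exact: HL.
- by rewrite Ha Hacc; case: ifP => //= _; case: (b off).
Qed.

End Main.

(** * Functions denoted by terms *)

(* In an oracle, [o 0] is the input, [o 1] the certificate and [o 2] the part of the output array
   that is already filled; [e] lists the variables, innermost first. *)
Definition PT (f : oracle -> seq nat -> nat) : Prop :=
  exists t, forall o e, den t o e = f o e.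

Lemma PT_ext f g : (forall o e, f o e = g o e) -> PT f -> PT g.
Proof. by move=> H [t Ht]; exists t => o e; rewrite Ht. Qed.

Lemma PT_cst n : PT (fun _ _ => n).
Proof. by exists (TCst n). Qed.

Lemma PT_head : PT (fun _ e => head 0 e).
Proof. by exists (TVar 0) => o e /=; rewrite nth0. Qed.

Lemma PT_behead f : PT f -> PT (fun o e => f o (behead e)).
Proof. by case=> t Ht; exists (TDrop t) => o e /=. Qed.

Lemma PT_add a b : PT a -> PT b -> PT (fun o e => a o e + b o e).
Proof. by case=> t Ht [u Hu]; exists (TAdd t u) => o e /=; rewrite Ht Hu. Qed.

Lemma PT_sub a b : PT a -> PT b -> PT (fun o e => a o e - b o e).
Proof. by case=> t Ht [u Hu]; exists (TSub t u) => o e /=; rewrite Ht Hu. Qed.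

Lemma PT_succ a : PT a -> PT (fun o e => (a o e).+1).
Proof. by move=> Ha; apply: PT_ext (PT_add Ha (PT_cst 1)) => o e; rewrite addn1. Qed.

Lemma PT_read (k : 'I_3) a : PT a -> PT (fun o e => o k (a o e)).
Proof. by case=> t Ht; exists (TRd k t) => o e /=; rewrite Ht. Qed.

Lemma PT_read0 a : PT a -> PT (fun o e => o 0 (a o e)).
Proof. exact: (@PT_read (@Ordinal 3 0 isT)). Qed.

Lemma PT_read1 a : PT a -> PT (fun o e => o 1 (a o e)).
Proof. exact: (@PT_read (@Ordinal 3 1 isT)). Qed.

Lemma PT_read2 a : PT a -> PT (fun o e => o 2 (a o e)).
Proof. exact: (@PT_read (@Ordinal 3 2 isT)). Qed.

Definition sumf (n : nat) (f : nat -> nat) : nat := \sum_(0 <= i < n) f i.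
Definition allf (n : nat) (f : pred nat) : bool := all f (iota 0 n).
Definition hasf (n : nat) (f : pred nat) : bool := has f (iota 0 n).
Definition findf (n : nat) (f : pred nat) : nat := find f (iota 0 n).

Lemma allfP n (f : pred nat) : reflect (forall i, i < n -> f i) (allf n f).
Proof.
apply: (iffP allP) => H i; first by move=> ii; apply: H; rewrite mem_iota.
by rewrite mem_iota; apply: H.
Qed.

Lemma hasfP n (f : pred nat) : reflect (exists2 i, i < n & f i) (hasf n f).
Proof.
apply: (iffP hasP) => [[i]|[i ii fi]]; first by rewrite mem_iota; exists i.
by exists i => //; rewrite mem_iota.
Qed.

Lemma sumfE n f : sumf n f = \sum_(i < n) f i.
Proof. by rewrite /sumf big_mkord. Qed.

Lemma sumfS n f : sumf n.+1 f = sumf n f + f n.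
Proof. by rewrite /sumf big_nat_recr. Qed.

(** The body is a function of the outer environment and the index; the second premise says that
    under the binder the index is the head of the environment. *)
Lemma PT_sum a (f : oracle -> seq nat -> nat -> nat) :
  PT a -> PT (fun o e => f o (behead e) (head 0 e)) -> PT (fun o e => sumf (a o e) (f o e)).
Proof.
case=> t Ht [u Hu]; exists (TSum t u) => o e /=.
by rewrite sumfE Ht; apply: eq_bigr => i _; rewrite Hu.
Qed.

Lemma PT_mul a b : PT a -> PT b -> PT (fun o e => a o e * b o e).
Proof.
move=> Ha Hb; apply: PT_ext (PT_sum (f := fun o e _ => b o e) Ha (PT_behead Hb)) => o e.
by rewrite sumfE sum_nat_const card_ord.
Qed.

Lemma PT_iteri n a c (f : oracle -> seq nat -> nat -> nat -> nat) :
  PT n -> PT a -> PT c ->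
  PT (fun o e => f o (behead (behead e)) (head 0 (behead e)) (head 0 e)) ->
  PT (fun o e => iteri (n o e) (fun i x => minn (c o e) (f o e i x)) (a o e)).
Proof.
case=> t Ht [u Hu] [v Hv] [w Hw]; exists (TRec t u w v) => o e /=.
rewrite Ht Hu; elim: (n o e) => //= m ->.
by rewrite Hv Hw.
Qed.

Lemma PT_negb b : PT (fun o e => nat_of_bool (b o e)) -> PT (fun o e => nat_of_bool (~~ b o e)).
Proof. by move=> Hb; apply: PT_ext (PT_sub (PT_cst 1) Hb) => o e; case: (b o e). Qed.

Lemma PT_andb b c : PT (fun o e => nat_of_bool (b o e)) -> PT (fun o e => nat_of_bool (c o e)) ->
  PT (fun o e => nat_of_bool (b o e && c o e)).
Proof. by move=> Hb Hc; apply: PT_ext (PT_mul Hb Hc) => o e; case: (b o e); case: (c o e). Qed.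

Lemma PT_orb b c : PT (fun o e => nat_of_bool (b o e)) -> PT (fun o e => nat_of_bool (c o e)) ->
  PT (fun o e => nat_of_bool (b o e || c o e)).
Proof.
move=> Hb Hc; apply: PT_ext (PT_negb (PT_andb (PT_negb Hb) (PT_negb Hc))) => o e.
by rewrite negb_and !negbK.
Qed.

Lemma PT_implyb b c : PT (fun o e => nat_of_bool (b o e)) -> PT (fun o e => nat_of_bool (c o e)) ->
  PT (fun o e => nat_of_bool (b o e ==> c o e)).
Proof.
by move=> Hb Hc; apply: PT_ext (PT_orb (PT_negb Hb) Hc) => o e; rewrite implybE.
Qed.

Lemma PT_leq a b : PT a -> PT b -> PT (fun o e => nat_of_bool (a o e <= b o e)).
Proof.
move=> Ha Hb; apply: PT_ext (PT_sub (PT_cst 1) (PT_sub Ha Hb)) => o e.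
by case: leqP; lia.
Qed.

Lemma PT_eqn a b : PT a -> PT b -> PT (fun o e => nat_of_bool (a o e == b o e)).
Proof.
move=> Ha Hb; apply: PT_ext (PT_andb (PT_leq Ha Hb) (PT_leq Hb Ha)) => o e.
by rewrite eqn_leq.
Qed.

Lemma PT_eqb b c : PT (fun o e => nat_of_bool (b o e)) -> PT (fun o e => nat_of_bool (c o e)) ->
  PT (fun o e => nat_of_bool (b o e == c o e)).
Proof.
move=> Hb Hc; apply: PT_ext (PT_eqn Hb Hc) => o e.
by case: (b o e); case: (c o e).
Qed.

Lemma PT_if b x y : PT (fun o e => nat_of_bool (b o e)) -> PT x -> PT y ->
  PT (fun o e => if b o e then x o e else y o e).
Proof.
move=> Hb Hx Hy; apply: PT_ext (PT_add (PT_mul Hb Hx) (PT_mul (PT_negb Hb) Hy)) => o e.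
by case: (b o e) => /=; rewrite ?mul0n ?mul1n ?addn0.
Qed.

Lemma PT_ifb b x y : PT (fun o e => nat_of_bool (b o e)) ->
  PT (fun o e => nat_of_bool (x o e)) -> PT (fun o e => nat_of_bool (y o e)) ->
  PT (fun o e => nat_of_bool (if b o e then x o e else y o e)).
Proof.
by move=> Hb Hx Hy; apply: PT_ext (PT_if Hb Hx Hy) => o e; case: (b o e).
Qed.

Lemma PT_allf a (f : oracle -> seq nat -> nat -> bool) :
  PT a -> PT (fun o e => nat_of_bool (f o (behead e) (head 0 e))) ->
  PT (fun o e => nat_of_bool (allf (a o e) (f o e))).
Proof.
move=> Ha Hf.
have Hs := PT_sum (f := fun o e i => nat_of_bool (~~ f o e i)) Ha (PT_negb Hf).
apply: PT_ext (PT_eqn Hs (PT_cst 0)) => o e.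
rewrite sumfE sum_nat_eq0; congr nat_of_bool.
apply/forallP/allfP => H i; last by have /= -> := H i (ltn_ord i).
by move=> ia; have := H (Ordinal ia); rewrite /= eqb0 negbK.
Qed.

Lemma PT_hasf a (f : oracle -> seq nat -> nat -> bool) :
  PT a -> PT (fun o e => nat_of_bool (f o (behead e) (head 0 e))) ->
  PT (fun o e => nat_of_bool (hasf (a o e) (f o e))).
Proof.
move=> Ha Hf.
have := PT_negb (PT_allf (f := fun o e i => ~~ f o e i) Ha (PT_negb Hf)).
apply: PT_ext => o e; congr nat_of_bool; rewrite /allf /hasf -has_predC.
by apply: eq_has => i /=; rewrite negbK.
Qed.

(** Search becomes counting: [p] contributes as long as there is no hit up to and including [p],
    which also yields [n] if there is none at all. *)
Lemma findfE n f : findf n f = sumf n (fun p => allf p.+1 (fun i => ~~ f i)).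
Proof.
rewrite /findf; elim: n => [|n IH]; first by rewrite /sumf big_nil.
rewrite sumfS -IH -[in LHS]addn1 iotaD find_cat size_iota /= add0n.
have -> : allf n.+1 (fun i => ~~ f i) = ~~ has f (iota 0 n) && ~~ f n.
  by rewrite /allf -addn1 iotaD all_cat /= add0n andbT -all_predC.
case: ifP => H /=; first by rewrite addn0.
by rewrite hasNfind ?H // size_iota; case: (f n).
Qed.

Lemma PT_findf a (f : oracle -> seq nat -> nat -> bool) :
  PT a -> PT (fun o e => nat_of_bool (f o (behead (behead e)) (head 0 e))) ->
  PT (fun o e => findf (a o e) (f o e)).
Proof.
move=> Ha Hf.
pose g o (e : seq nat) (p : nat) : nat := allf p.+1 (fun i => ~~ f o e i).
apply: (@PT_ext (fun o e => sumf (a o e) (g o e))) => [o e|]; first by rewrite findfE.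
apply: PT_sum Ha _; rewrite /g.
apply: (PT_allf (f := fun o e i => ~~ f o (behead e) i)); first exact: PT_succ PT_head.
exact: PT_negb.
Qed.

Lemma sumf_ltn n k : sumf n (fun i => i < k) = minn n k.
Proof.
elim: n => [|n IH]; first by rewrite /sumf big_nil min0n.
by rewrite sumfS IH; case: ltnP; lia.
Qed.

(** The quotient counts the positive multiples of [d] up to [m]; the factor [0 < d] reproduces the
    convention for division by zero. *)
Lemma divn_sum m d : m %/ d = sumf m (fun i => (0 < d) && (i.+1 * d <= m)).
Proof.
case: (posnP d) => [->|d0]; first by rewrite divn0 sumfE big1.
rewrite (_ : sumf _ _ = sumf m (fun i => i < m %/ d)); last first.
  by rewrite !sumfE; apply: eq_bigr => i _; rewrite leq_divRL.
by rewrite sumf_ltn; apply/esym/minn_idPr/leq_div.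
Qed.

Lemma modn_sub m d : m %% d = m - m %/ d * d.
Proof. by rewrite {2}(divn_eq m d); lia. Qed.

Lemma PT_div a b : PT a -> PT b -> PT (fun o e => a o e %/ b o e).
Proof.
move=> Ha Hb.
pose g o (e : seq nat) i : nat := (0 < b o e) && (i.+1 * b o e <= a o e).
apply: (@PT_ext (fun o e => sumf (a o e) (g o e))) => [o e|]; first by rewrite divn_sum.
apply: (PT_sum Ha _); rewrite /g; have Hb' := PT_behead Hb.
apply: PT_andb (PT_leq (PT_cst 1) Hb') _.
exact: PT_leq (PT_mul (PT_succ PT_head) Hb') (PT_behead Ha).
Qed.

Lemma PT_mod a b : PT a -> PT b -> PT (fun o e => a o e %% b o e).
Proof.
move=> Ha Hb; apply: PT_ext (PT_sub Ha (PT_mul (PT_div Ha Hb) Hb)) => o e.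
by rewrite modn_sub.
Qed.

Lemma PT_odd a : PT a -> PT (fun o e => nat_of_bool (odd (a o e))).
Proof.
by move=> Ha; apply: PT_ext (PT_mod Ha (PT_cst 2)) => o e; rewrite modn2.
Qed.

(** An arbitrary function on a bounded range is a finite case distinction. This is how the
    transition table of a fixed machine enters terms. *)
Lemma PT_table a (g : nat -> nat) Z : PT a -> (forall o e, a o e < Z) ->
  PT (fun o e => g (a o e)).
Proof.
move=> Ha HZ.
apply: (@PT_ext (fun o e => \sum_(j <- iota 0 Z) (a o e == j) * g j)) => [o e|].
  rewrite (bigD1_seq (a o e)) ?mem_iota ?iota_uniq //= eqxx mul1n big1 ?addn0 // => j.
  by rewrite eq_sym => /negbTE ->.
elim: (iota 0 Z) => [|j s IH].
  by apply: PT_ext (PT_cst 0) => o e; rewrite big_nil.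
apply: PT_ext (PT_add (PT_mul (PT_eqn Ha (PT_cst j)) (PT_cst (g j))) IH) => o e.
by rewrite big_cons.
Qed.

Lemma PT_all_const (s : seq nat) (f : nat -> oracle -> seq nat -> bool) :
  (forall i, PT (fun o e => nat_of_bool (f i o e))) ->
  PT (fun o e => nat_of_bool (all (fun i => f i o e) s)).
Proof.
by move=> H; elim: s => [|i s IH] /=; [apply: PT_cst | apply: PT_andb].
Qed.

Lemma PT_exp a k : PT a -> PT (fun o e => a o e ^ k).
Proof.
move=> Ha; elim: k => [|k IH]; first exact: PT_cst 1.
by apply: PT_ext (PT_mul Ha IH) => o e; rewrite expnS.
Qed.

Lemma PT_horner (p : {poly nat}) a : PT a -> PT (fun o e => p.[a o e]%R).
Proof.
move=> Ha; rewrite /horner; elim: (polyseq p) => [|c s IH] /=; first exact: PT_cst 0.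
by apply: PT_ext (PT_add (PT_mul IH Ha) (PT_cst c)).
Qed.

(** A hook, rebound whenever new functions have received their closure lemmas, so that [pt] stops at
    them instead of at their bodies. *)
Ltac pt_user := fail.

Lemma PT_var k : PT (fun _ e => head 0 (iter k behead e)).
Proof.
by elim: k => [|k IH]; [apply: PT_head | apply: PT_ext (PT_behead IH) => o e; rewrite -iterSr].
Qed.

Ltac pt_hyp H d :=
  first [exact H | lazymatch d with S ?d' => pt_hyp (PT_behead H) d' end].

Ltac pt_leaf :=
  match goal with
  | |- PT (fun o e => head 0 (@?l o e)) =>
      first [exact (PT_var 0) | exact (PT_var 1) | exact (PT_var 2) | exact (PT_var 3)
        | exact (PT_var 4) | exact (PT_var 5) | exact (PT_var 6) | exact (PT_var 7)]
  | H : PT ?a |- PT (fun o e => ?a o (@?l o e)) => pt_hyp H 7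
  | H : PT (fun o e => nat_of_bool (?a o e)) |- PT (fun o e => nat_of_bool (?a o (@?l o e))) =>
      pt_hyp H 7
  end.

Ltac pt_step :=
  lazymatch goal with
  | |- PT (fun o e => nat_of_bool (o 0 (@?a o e))) => apply PT_read0
  | |- PT (fun o e => nat_of_bool (o 1 (@?a o e))) => apply PT_read1
  | |- PT (fun o e => nat_of_bool (o 2 (@?a o e))) => apply PT_read2
  | |- PT (fun o e => nat_of_bool (leq (@?a o e) (@?b o e))) => apply PT_leq
  | |- PT (fun o e => nat_of_bool (@eq_op ?T (@?a o e) (@?b o e))) =>
      first [apply PT_eqn | apply PT_eqb]
  | |- PT (fun o e => nat_of_bool (andb (@?a o e) (@?b o e))) => apply PT_andb
  | |- PT (fun o e => nat_of_bool (orb (@?a o e) (@?b o e))) => apply PT_orb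
  | |- PT (fun o e => nat_of_bool (implb (@?a o e) (@?b o e))) => apply PT_implyb
  | |- PT (fun o e => nat_of_bool (negb (@?a o e))) => apply PT_negb
  | |- PT (fun o e => nat_of_bool (odd (@?a o e))) => apply PT_odd
  | |- PT (fun o e => nat_of_bool (allf (@?a o e) (@?b o e))) => apply PT_allf
  | |- PT (fun o e => nat_of_bool (hasf (@?a o e) (@?b o e))) => apply PT_hasf
  | |- PT (fun o e => findf (@?a o e) (@?b o e)) => apply PT_findf
  | |- PT (fun o e => sumf (@?a o e) (@?b o e)) => apply PT_sum
  | |- PT (fun o e => S (@?a o e)) => apply PT_succ
  | |- PT (fun o e => addn (@?a o e) (@?b o e)) => apply PT_add
  | |- PT (fun o e => subn (@?a o e) (@?b o e)) => apply PT_sub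
  | |- PT (fun o e => muln (@?a o e) (@?b o e)) => apply PT_mul
  | |- PT (fun o e => divn (@?a o e) (@?b o e)) => apply PT_div
  | |- PT (fun o e => modn (@?a o e) (@?b o e)) => apply PT_mod
  | |- PT (fun o e => expn (@?a o e) ?k) => apply PT_exp
  end.

Ltac pt_closed := match goal with |- PT (fun _ _ => ?n) => apply PT_cst end.

Ltac pt := cbv beta; first
  [ assumption | pt_closed | solve [pt_leaf] | pt_user; pt | pt_step; pt | apply PT_ifb; pt | apply PT_if; pt ].

(** * Encodings *)

Lemma findf_eq n m (f : pred nat) :
  m <= n -> (m < n -> f m) -> (forall i, i < m -> ~~ f i) -> findf n f = m.
Proof.
move=> mn fm Hm; rewrite /findf -(subnKC mn) iotaD find_cat size_iota add0n.
rewrite ifF; last by apply/hasP => -[i]; rewrite mem_iota /= => /Hm/negbTE ->.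
case: (ltnP m n) => H; last by rewrite (_ : n - m = 0) ?addn0 //; lia.
have -> : n - m = (n - m).-1.+1 by lia.
by rewrite /= fm // addn0.
Qed.

Lemma pair_index_lt u v a b : u < a -> v < b -> u * b + v < a * b.
Proof.
move=> ua vb; have : u.+1 * b <= a * b by rewrite leq_mul2r ua orbT.
by rewrite mulSn; lia.
Qed.

Definition bits_val (s : seq bool) : nat := foldr (fun (b : bool) v => b + v.*2) 0 s.

Lemma bits_val_positive p : bits_val (positive_bits p) = nat_of_pos p.
Proof. by elim: p => //= p ->; rewrite ?NatTrec.doubleE ?add1n ?add0n. Qed.

Lemma bits_val_nat n : bits_val (nat_bits n) = n.
Proof.
by rewrite /nat_bits; case E : (bin_of_nat n) => [|p]; rewrite -[RHS]bin_of_natK E //= bits_val_positive.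
Qed.

Lemma odd_bits_val s j : odd (bits_val s %/ 2 ^ j) = nth false s j.
Proof.
elim: j s => [|j IH] [|b s] //=; rewrite ?div0n ?nth_nil //.
  by rewrite divn1 oddD odd_double addbF oddb.
by rewrite expnS divnMA divn2 half_bit_double IH.
Qed.

Lemma bits_val_lt s : bits_val s < 2 ^ size s.
Proof. by elim: s => //= b s IH; rewrite expnS; case: b => /=; lia. Qed.

Lemma bits_val_ge s : last true s -> s != [::] -> 2 ^ (size s).-1 <= bits_val s.
Proof.
elim: s => // b [|c s] IH //=; first by case: b.
move=> Hl _; have := IH Hl isT; rewrite /= expnS; case: b; lia.
Qed.

Lemma last_positive_bits p : last true (positive_bits p) /\ positive_bits p != [::].
Proof. by elim: p => //= p [H H']; case: positive_bits H H'. Qed.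

(** The last bit of a non-empty encoding is set, so its length is the least [j] with [n < 2 ^ j]. *)
Lemma nat_bitsE n :
  nat_bits n = mkseq (fun j => odd (n %/ 2 ^ j)) (findf n.+1 (fun j => n < 2 ^ j)).
Proof.
have Hv := bits_val_nat n.
have Hs : findf n.+1 (fun j => n < 2 ^ j) = size (nat_bits n).
  have Hlt := bits_val_lt (nat_bits n); rewrite Hv in Hlt.
  have Hmin i : i < size (nat_bits n) -> 2 ^ i <= n.
    move=> H; rewrite -[leqRHS]Hv.
    have Hne : nat_bits n != [::] by case: nat_bits H.
    apply: leq_trans (bits_val_ge _ Hne); last first.
      move: Hne; rewrite /nat_bits; case: bin_of_nat => // p _.
      by case: (last_positive_bits p).
    by rewrite leq_exp2l //; case: (size _) H => // m; rewrite ltnS.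
  apply: findf_eq => [|_|i /Hmin]; [|exact: Hlt|by rewrite -leqNgt].
  case E : (size (nat_bits n)) => [|m] //; have := Hmin m; rewrite E ltnS leqnn => /(_ isT).
  by have := ltn_expl m (isT : 1 < 2); lia.
apply: (@eq_from_nth _ false); first by rewrite size_mkseq Hs.
by move=> i Hi; rewrite nth_mkseq ?Hs // -[in RHS]Hv odd_bits_val.
Qed.

Lemma eq_iteri_lt n (f g : nat -> nat -> nat) a :
  (forall i v, i < n -> f i v = g i v) -> iteri n f a = iteri n g a.
Proof.
elim: n => //= n IH H; rewrite IH; last by move=> i v /ltnW; apply: H.
by rewrite H.
Qed.

(** Horner's scheme from the most significant bit. Cutting at [cap] in every round agrees with
    cutting once at the end, because a value that has reached [cap] stays at least [cap] after
    doubling. *)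
Lemma iteri_double_cap cap s :
  iteri (size s) (fun j v => minn cap (v + v + nth false s (size s - j.+1))) 0
  = minn cap (bits_val s).
Proof.
suff H j : j <= size s ->
    iteri j (fun j v => minn cap (v + v + nth false s (size s - j.+1))) 0
    = minn cap (bits_val (drop (size s - j) s)).
  by rewrite H // subnn drop0.
elim: j => [|j IH] js /=; first by rewrite subn0 drop_size minn0.
rewrite IH; last by lia.
have E : size s - j = (size s - j.+1).+1 by lia.
by rewrite (drop_nth false (n := size s - j.+1)) /= -?E; [case: nth => /=; lia | lia].
Qed.

Definition adjn (G : sgraph) (u v : nat) : bool :=
  nth false [seq sedge u v | u <- enum G, v <- enum G] (u * #|G| + v).

Lemma nth_allpairs (T : Type) (f : T -> T -> bool) (s t : seq T) x0 u v :
  u < size s -> v < size t ->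
  nth false [seq f x y | x <- s, y <- t] (u * size t + v) = f (nth x0 s u) (nth x0 t v).
Proof.
elim: s u => //= x s IH [|u] us vt; rewrite nth_cat size_map.
  by rewrite mul0n add0n vt (nth_map x0).
rewrite ifF; last by rewrite mulSn; lia.
by rewrite -IH //; congr nth; rewrite mulSn; lia.
Qed.

Lemma adjnE (G : sgraph) (u v : 'I_#|G|) : adjn G u v = sedge (enum_val u) (enum_val v).
Proof.
have x0 := enum_default u.
have Hlt (w : 'I_#|G|) : w < size (enum G) by rewrite -cardE.
by have := nth_allpairs (@sedge G) x0 (Hlt u) (Hlt v); rewrite -cardE /adjn !(enum_val_nth x0) => ->.
Qed.

Section Decode.
Variables (G : sgraph) (k : int).
Local Notation n := #|G|.
Let x := encode_graph_int (G, k).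

Lemma size_adj : size [seq sedge u v | u <- enum G, v <- enum G] = n * n.
Proof. by rewrite size_allpairs -cardE. Qed.

Lemma size_encode : size x = n + n * n + size (nat_bits `|k|%N) + 2.
Proof. by rewrite /x /= size_cat size_nseq /= size_cat size_adj /=; lia. Qed.

Lemma encode_prefix : findf (size x) (fun i => ~~ nth false x i) = n.
Proof.
have E : nth false x n = false by rewrite /x /= nth_cat size_nseq ltnn subnn.
apply: findf_eq; rewrite ?E // ?size_encode; first by lia.
by move=> i ni; rewrite /x /= nth_cat size_nseq ni nth_nseq ni.
Qed.

Lemma encode_adj i : i < n * n -> nth false x (n + 1 + i) =
  nth false [seq sedge u v | u <- enum G, v <- enum G] i.
Proof.
move=> H; rewrite /x /= nth_cat size_nseq ifF; last by lia.
by rewrite (_ : n + 1 + i - #|G| = i.+1) /= ?nth_cat ?size_adj ?H //; lia.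
Qed.

Lemma encode_sign : nth false x (n + 1 + n * n) = (k < 0)%R.
Proof.
rewrite /x /= nth_cat size_nseq ifF; last by lia.
rewrite (_ : n + 1 + n * n - #|G| = (n * n).+1) /=; last by lia.
by rewrite nth_cat size_adj ltnn subnn.
Qed.

Lemma encode_bits j : nth false x (n + 2 + n * n + j) = nth false (nat_bits `|k|%N) j.
Proof.
rewrite /x /= nth_cat size_nseq ifF; last by lia.
rewrite (_ : n + 2 + n * n + j - #|G| = (n * n + j.+1).+1) /=; last by lia.
by rewrite nth_cat size_adj ltnNge leq_addr /= addKn.
Qed.

End Decode.

Definition dec_order (x : nat -> bool) (len : nat) : nat := findf len (fun i => ~~ x i).

Definition dec_edge (x : nat -> bool) (len u v : nat) : bool :=
  x (dec_order x len + 1 + (u * dec_order x len + v)).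

Definition dec_cap (x : nat -> bool) (len cap : nat) : nat :=
  let n := dec_order x len in
  iteri (len - (n + 2 + n * n)) (fun j v => minn cap (v + v + x (len - j.+1))) 0.

(** The threshold is written in binary and may be exponential in the length of the input, while term
    values are polynomially bounded. It is cut at the very number [s] it is compared with, which
    does not affect the comparison. *)
Definition dec_leq (x : nat -> bool) (len s : nat) : bool :=
  let n := dec_order x len in ~~ x (n + 1 + n * n) && (s <= dec_cap x len s).

Section DecodeSpec.
Variables (G : sgraph) (k : int).
Let x := nth false (encode_graph_int (G, k)).
Let len := size (encode_graph_int (G, k)).

Lemma dec_orderE : dec_order x len = #|G|.
Proof. exact: encode_prefix. Qed.

Lemma dec_edgeE u v : u < #|G| -> v < #|G| -> dec_edge x len u v = adjn G u v.
Proof.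
move=> Hu Hv; rewrite /dec_edge dec_orderE /x encode_adj //.
exact: pair_index_lt.
Qed.

Lemma dec_leqE s : dec_leq x len s = (s%:Z <= k)%R.
Proof.
rewrite /dec_leq /dec_cap dec_orderE {1}/x encode_sign.
have El : len - (#|G| + 2 + #|G| * #|G|) = size (nat_bits `|k|%N).
  by rewrite /len size_encode; lia.
have -> : iteri (len - (#|G| + 2 + #|G| * #|G|))
    (fun j v => minn s (v + v + x (len - j.+1))) 0 = minn s `|k|%N.
  rewrite El -{2}(bits_val_nat `|k|%N) -iteri_double_cap.
  apply: eq_iteri_lt => j v js; congr (minn s (_ + nat_of_bool _)); rewrite -(encode_bits G k).
  by congr nth; rewrite /len size_encode; lia.
by case: k => m /=; lia.
Qed.

End DecodeSpec.

(** * Machines from terms *)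

Lemma PT_dec_order a : PT a -> PT (fun o e => dec_order (o 0) (a o e)).
Proof. by move=> Ha; rewrite /dec_order; pt. Qed.

Ltac pt_user ::= apply PT_dec_order.

Lemma PT_dec_edge a u v : PT a -> PT u -> PT v ->
  PT (fun o e => dec_edge (o 0) (a o e) (u o e) (v o e)).
Proof. by move=> Ha Hu Hv; rewrite /dec_edge; pt. Qed.

Lemma PT_dec_cap a c : PT a -> PT c -> PT (fun o e => dec_cap (o 0) (a o e) (c o e)).
Proof. by move=> Ha Hc; rewrite /dec_cap; apply: PT_iteri; pt. Qed.

Ltac pt_user ::= first [apply PT_dec_order | apply PT_dec_edge | apply PT_dec_cap].

Lemma PT_dec_leq a s : PT a -> PT s -> PT (fun o e => dec_leq (o 0) (a o e) (s o e)).
Proof. by move=> Ha Hs; rewrite /dec_leq; pt. Qed.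

Ltac pt_user ::= first [apply PT_dec_order | apply PT_dec_edge | apply PT_dec_leq].

Lemma PT_machine (fL foff : oracle -> seq nat -> nat) (f : oracle -> seq nat -> bool) :
  PT fL -> PT foff -> PT (fun o e => nat_of_bool (f o e)) ->
  exists (M : tm) (P : {poly nat}), forall x y b,
  let L := fL (array_oracle x y 0 b) [:: size x] in
  let off := foff (array_oracle x y 0 b) [:: size x] in
  (forall p, p < L -> b p = f (array_oracle x y p b) [:: p; size x]) ->
  exists C, [/\ run P.[size x]%R (tm_init M [:: x; y]) = Some C,
    output C = mkseq (fun i => b (off + i)) (L - off) &
    accepting C = (off < L) && b off].
Proof.
case=> tL HL [toff Hoff] [t Ht].
have [M [P HM]] := fill_machine tL t toff.
exists M, P => x y b L off Hb; rewrite /L /off -HL -Hoff; apply: HM.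
by rewrite HL => p pL; rewrite Ht eqb0 negbK Hb.
Qed.

Lemma tm_init_blank (M : tm) x : tm_init M [:: x] = tm_init M [:: x; [::]].
Proof.
congr Config; apply/ffunP => i; rewrite !ffunE.
by case: (val i) => [|[|j]] //=; rewrite ?nth_nil.
Qed.

(** A certificate is a bit matrix with one row per vertex. Reading a colour as a count of ones makes
    every bit string denote positive colours. *)
Definition cert_colour (y : nat -> bool) (n v : nat) : nat := 1 + sumf n (fun j => y (v * n + j)).

Definition check_colouring (x y : nat -> bool) (len : nat) : bool :=
  let n := dec_order x len in
  allf n (fun u => allf n (fun v =>
     dec_edge x len u v ==> (cert_colour y n u != cert_colour y n v)))
  && dec_leq x len (sumf n (cert_colour y n)).

Lemma PT_check_colouring a : PT a ->
  PT (fun o e => nat_of_bool (check_colouring (o 0) (o 1) (a o e))).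
Proof. by move=> Ha; rewrite /check_colouring /cert_colour; pt. Qed.

Lemma sum_enum_rank (T : finType) (f : nat -> nat) :
  \sum_(v : T) f (enum_rank v) = sumf #|T| f.
Proof.
rewrite sumfE (reindex (@enum_rank T)) //=.
by exists enum_val => i _; rewrite ?enum_rankK ?enum_valK.
Qed.

(** Colours are replaced by their ranks: one more than the number of distinct colours below. Ranks
    keep the strict order, do not exceed the positive originals, and fit into the rows of a
    certificate. *)
Lemma colouring_compress (G : sgraph) (c : G -> nat) : colouring c ->
  exists2 c' : G -> nat, colouring c' & forall v, (c' v <= c v) && ((c' v).-1 <= #|G|).
Proof.
case=> c0 cE; pose below v := undup [seq c u | u <- enum G & c u < c v].
have below_mem v i : (i \in below v) = [exists u, (c u == i)] && (i < c v).
  rewrite mem_undup; apply/mapP/andP => [[u]|[/existsP[u /eqP Eu] iv]].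
    by rewrite mem_filter => /andP[uv _] ->; split => //; apply/existsP; exists u.
  by exists u => //; rewrite mem_filter Eu iv mem_enum.
have below_lt u v : c u < c v -> size (below u) < size (below v).
  move=> uv; have : uniq (c u :: below u) by rewrite /= undup_uniq below_mem ltnn andbF.
  move/uniq_leq_size; apply => i; rewrite inE => /predU1P[->|].
    by rewrite below_mem uv andbT; apply/existsP; exists u.
  by rewrite !below_mem => /andP[-> iu]; apply: leq_trans iu _; apply: ltnW.
exists (fun v => (size (below v)).+1).
  split=> // u v /cE ne [] E; case: (ltngtP (c u) (c v)) => H; last by [].
    by have := below_lt _ _ H; rewrite E ltnn.
  by have := below_lt _ _ H; rewrite E ltnn.
move=> v; apply/andP; split; last first.
  rewrite /= (leq_trans (size_undup _)) // size_map size_filter.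
  by rewrite (leq_trans (count_size _ _)) // -cardE.
have : size (below v) <= size (iota 1 (c v).-1).
  apply: uniq_leq_size; first exact: undup_uniq.
  move=> i; rewrite below_mem mem_iota => /andP[/existsP[u /eqP <-] uv].
  by have := c0 u; lia.
by rewrite size_iota; have := c0 v; lia.
Qed.

Lemma chromatic_sum_in_NP graph_class : in_NP (chromatic_sum graph_class).
Proof.
have [M [P HM]] := PT_machine (PT_cst 1) (PT_cst 0)
  (PT_check_colouring (a := fun _ e => head 0 (behead e)) (ltac:(pt))).
(* The input contains an adjacency matrix, so its length bounds the size of a certificate. *)
exists M, P, ('X)%R => -[G k] /= _.
set x := nseq _ _ ++ _; have -> : x = encode_graph_int (G, k) by [].
have {}HM y : exists2 C, run P.[size (encode_graph_int (G, k))]%R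
      (tm_init M [:: encode_graph_int (G, k); y]) = Some C &
    accepting C = check_colouring (nth false (encode_graph_int (G, k))) (nth false y)
       (size (encode_graph_int (G, k))).
  have [//|C [HC _ Ha]] := HM (encode_graph_int (G, k)) y
    (fun=> check_colouring (nth false (encode_graph_int (G, k))) (nth false y)
       (size (encode_graph_int (G, k)))).
  by exists C.
split=> [y _|]; first by have [C HC _] := HM y; exists C.
rewrite hornerX; split.
  case=> c Hc ck; have [c' Hc' Hle] := colouring_compress Hc.
  pose w u := if u < #|G| =P true is ReflectT H then (c' (enum_val (Ordinal H))).-1 else 0.
  have wE (v : G) : w (enum_rank v) = (c' v).-1.
    rewrite /w; case: eqP => [H|[]]; last by rewrite ltn_ord.
    by rewrite (_ : Ordinal H = enum_rank v) ?enum_rankK //; apply: val_inj.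
  pose y := mkseq (fun i => i %% #|G| < w (i %/ #|G|)) (#|G| * #|G|).
  have colE (v : G) : cert_colour (nth false y) #|G| (enum_rank v) = c' v.
    have Hv := ltn_ord (enum_rank v); have n0 := leq_ltn_trans (leq0n _) Hv.
    rewrite /cert_colour (_ : sumf _ _ = sumf #|G| (fun j => j < (c' v).-1)); last first.
      rewrite !sumfE; apply: eq_bigr => j _; rewrite nth_mkseq; last first.
        exact: pair_index_lt.
      by rewrite modnMDl modn_small // divnMDl // divn_small // addn0 wE.
    rewrite sumf_ltn (minn_idPr _); last by case/andP: (Hle v).
    by case: Hc' => /(_ v); lia.
  exists y; first by rewrite size_mkseq size_encode; lia.
  have [C HC Ha] := HM y; exists C => //; rewrite Ha /check_colouring dec_orderE dec_leqE.
  apply/andP; split.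
    apply/allfP => u un; apply/allfP => v vn; apply/implyP.
    have -> : u = enum_rank (enum_val (Ordinal un)) by rewrite enum_valK.
    have -> : v = enum_rank (enum_val (Ordinal vn)) by rewrite enum_valK.
    rewrite dec_edgeE // adjnE !enum_rankK !colE => /(Hc'.2 _ _).
    by move=> ne; apply/eqP.
  rewrite -sum_enum_rank (eq_bigr c') => [|v _]; last exact: colE.
  apply: Order.POrderTheory.le_trans ck; rewrite lez_nat.
  by apply: leq_sum => v _; case/andP: (Hle v).
case=> y _ [C HC]; have [C' HC' E] := HM y.
move: HC; rewrite HC' => -[<-]; rewrite E.
rewrite /check_colouring dec_orderE dec_leqE => /andP[/allfP Hp Hs].
exists (fun v => cert_colour (nth false y) #|G| (enum_rank v)); last by rewrite sum_enum_rank.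
split=> [v|u v uv]; first by rewrite /cert_colour.
have /allfP/(_ _ (ltn_ord (enum_rank v)))/implyP := Hp _ (ltn_ord (enum_rank u)).
by rewrite dec_edgeE // adjnE !enum_rankK => /(_ uv)/eqP.
Qed.

(** * Chromatic sum of cographs *)

(** [P] holds on an initial segment inside [[0, N)], and its count is the length of that segment.
    Counts of this kind produce conjugate partitions below. *)
Lemma sumf_initial N (P : pred nat) j :
  (forall i, P i.+1 -> P i) -> (forall i, P i -> i < N) -> (j < sumf N P) = P j.
Proof.
move=> Pdec PN; pose m := findf N (fun i => ~~ P i).
have le_dec i i' : i <= i' -> P i' -> P i.
  by move=> /subnKC <-; elim: (i' - i) => [|d IH]; rewrite ?addn0 // addnS => /Pdec.
have mE i : P i = (i < m).
  have mN : m <= N by rewrite -[leqRHS](size_iota 0 N); apply: find_size.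
  apply/idP/idP => [Pi|im].
    rewrite ltnNge; apply/negP => mi; have Pm := le_dec _ _ mi Pi.
    have H : has (fun i => ~~ P i) (iota 0 N) by rewrite has_find size_iota; apply: PN.
    have := nth_find 0 H; rewrite -/(findf _ _) -/m nth_iota ?add0n ?Pm //; exact: PN.
  have := before_find 0 im; rewrite nth_iota ?add0n; last by apply: leq_trans im _.
  by move/negbT; rewrite negbK.
have -> : sumf N P = sumf N (fun i => i < m) by rewrite !sumfE; apply: eq_bigr => i _; rewrite mE.
rewrite sumf_ltn mE; case E : (j < m); last by lia.
by rewrite ltn_min E andbT; apply: PN; rewrite mE.
Qed.

(** Rows and columns of one Young diagram. The equivalence alone makes both sequences weakly
    decreasing and lets each determine the other. *)
Definition conjugate (s t : nat -> nat) : Prop := forall i j, (i < t j) = (j < s i).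

Lemma conjugate_sym s t : conjugate s t -> conjugate t s.
Proof. by move=> H i j; rewrite H. Qed.

Lemma conjugate_anti s t i i' : conjugate s t -> i <= i' -> s i' <= s i.
Proof.
move=> H ii; rewrite leqNgt; apply/negP; rewrite -H => h.
by have := H i (s i); rewrite (leq_ltn_trans ii h); lia.
Qed.

(** The cells of the first [k] rows, counted by columns. *)
Lemma conjugate_sum s t N k : conjugate s t -> (forall i, s i <= N) ->
  sumf k s = sumf N (fun j => minn (t j) k).
Proof.
move=> H sN; elim: k => [|k IH].
  rewrite [LHS]/sumf big_nil sumfE big1 // => i _; exact: minn0.
rewrite sumfS IH; have -> : s k = sumf N (fun j => k < t j).
  by rewrite -[LHS](minn_idPr (sN k)) -sumf_ltn !sumfE; apply: eq_bigr => j _; rewrite H.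
by rewrite !sumfE -big_split /=; apply: eq_bigr => j _; case: ltnP; lia.
Qed.

Section Optimal.
Variables (T : finType) (E : rel T).
Hypothesis E_sym : symmetric E.

Definition independent (A : {set T}) : bool := [forall x in A, forall y in A, ~~ E x y].

Lemma independentP (A : {set T}) : reflect (forall x y, x \in A -> y \in A -> ~~ E x y) (independent A).
Proof.
apply: (iffP forall_inP) => [H x y xA yA|H x xA]; first by have /forall_inP := H x xA; apply.
by apply/forall_inP => y yA; apply: H.
Qed.

Definition proper_on (M : {set T}) (c : T -> nat) : Prop :=
  forall x y, x \in M -> y \in M -> E x y -> c x <> c y.

(* [s] lists, in decreasing order, the sizes of the classes of a colouring of the subgraph induced
   by [M] whose first [k] classes cover as many vertices as any [k] independent sets, for all [k];
   [t] is the conjugate partition. *)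
Record optimal (M : {set T}) (s t : nat -> nat) : Prop := Optimal {
  opt_conj : conjugate s t;
  opt_s : forall i, s i <= #|M|;
  opt_t : forall j, t j <= #|M|;
  opt_col : exists2 c, proper_on M c & forall i, #|[set x in M | c x == i]| = s i;
  opt_max : forall F : seq {set T}, all (fun A : {set T} => independent A && (A \subset M)) F ->
     #|\bigcup_(A <- F) A| <= sumf (size F) s }.

Lemma bigcup_seq_subset (F : seq {set T}) (M : {set T}) :
  all (fun A : {set T} => A \subset M) F -> \bigcup_(A <- F) A \subset M.
Proof.
elim: F => [|A F IH] /=; first by rewrite big_nil sub0set.
by move=> /andP[AM /IH FM]; rewrite big_cons subUset AM.
Qed.

Lemma optimal_set1 x : ~~ E x x -> optimal [set x] (fun i => i == 0) (fun j => j == 0).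
Proof.
move=> xx; split; rewrite ?cards1.
- by case=> [|i] [|j].
- by case.
- by case.
- exists (fun=> 0) => [y z|i]; first by rewrite !inE => /eqP-> /eqP->; rewrite (negbTE xx).
  case: i => [|i].
    by rewrite (_ : [set y in _ | _] = [set x]) ?cards1 //; apply/setP => y; rewrite !inE eqxx andbT.
  by rewrite (_ : [set y in _ | _] = set0) ?cards0 //; apply/setP => y; rewrite !inE andbF.
- case=> [|A F] H; first by rewrite big_nil cards0.
  have HF : \bigcup_(B <- A :: F) B \subset [set x].
    by apply: bigcup_seq_subset; apply: sub_all H => B /andP[].
  apply: leq_trans (subset_leq_card HF) _; rewrite cards1 sumfE /=.
  by rewrite big_ord_recl.
Qed.

Section Merge.
Variables (M1 M2 : {set T}) (s1 t1 s2 t2 : nat -> nat).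
Hypothesis disj : [disjoint M1 & M2].
Hypothesis opt1 : optimal M1 s1 t1.
Hypothesis opt2 : optimal M2 s2 t2.

Let cardM : #|M1 :|: M2| = #|M1| + #|M2|.
Proof. by apply/eqP; rewrite (leq_card_setU M1 M2).2. Qed.

Let inM1 x : x \in M2 -> (x \in M1) = false.
Proof. by move=> xM; apply/negbTE; apply: contraL xM => ?; rewrite (disjointFr disj). Qed.

Lemma card_split (P : pred T) :
  #|[set x in M1 :|: M2 | P x]| = #|[set x in M1 | P x]| + #|[set x in M2 | P x]|.
Proof.
rewrite -(cardsID M1 [set x in M1 :|: M2 | P x]); congr (_ + _); apply: eq_card => x; rewrite !inE.
  by case: (x \in M1); rewrite ?andbT ?andbF.
by case: (boolP (x \in M2)) => [/inM1 -> | _]; [rewrite orbT | case: (x \in M1)].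
Qed.

Definition glue (c1 c2 : T -> nat) (x : T) : nat := if x \in M1 then c1 x else c2 x.

Lemma card_glue c1 c2 i : #|[set x in M1 :|: M2 | glue c1 c2 x == i]| =
  #|[set x in M1 | c1 x == i]| + #|[set x in M2 | c2 x == i]|.
Proof.
rewrite card_split; congr (_ + _); apply: eq_card => x; rewrite !inE /glue.
  by case: (x \in M1).
by case: (boolP (x \in M2)) => [/inM1 -> | ].
Qed.

(** Without edges in between, the [i]-th classes of both parts are merged, so row lengths add. Any
    independent set splits into one of each part, so the two covering bounds add as well. *)
Lemma optimal_union : (forall x y, x \in M1 -> y \in M2 -> ~~ E x y) ->
  exists t, optimal (M1 :|: M2) (fun i => s1 i + s2 i) t.
Proof.
move=> noE; case: opt1 opt2 => H1 sn1 tn1 [c1 p1 k1] m1 [H2 sn2 tn2 [c2 p2 k2] m2].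
pose N := #|M1| + #|M2|.
pose t j := sumf N (fun i => j < s1 i + s2 i).
have conj : conjugate (fun i => s1 i + s2 i) t.
  move=> i j; rewrite sumf_initial // => i'.
    by have := conjugate_anti H1 (leqnSn i'); have := conjugate_anti H2 (leqnSn i'); lia.
  move=> h; have := tn1 0; have := tn2 0; have := H1 i' 0; have := H2 i' 0; rewrite /N; lia.
exists t; split => //.
- by move=> i; rewrite cardM leq_add.
- by move=> j; rewrite cardM leqNgt -/N conj -conj; apply/negP; rewrite conj => h;
    have := tn1 0; have := tn2 0; have := H1 N 0; have := H2 N 0; rewrite /N in h *; lia.
- exists (glue c1 c2) => [x y|i]; last by rewrite card_glue k1 k2.
  rewrite !inE /glue => /orP[xM|xM] /orP[yM|yM]; rewrite ?xM ?yM ?(inM1 xM) ?(inM1 yM).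
  + exact: p1.
  + by rewrite (negbTE (noE _ _ xM yM)).
  + by rewrite E_sym (negbTE (noE _ _ yM xM)).
  + exact: p2.
- move=> F HF.
  pose F1 := [seq A :&: M1 | A <- F]; pose F2 := [seq A :&: M2 | A <- F].
  have sub (M : {set T}) : all (fun A : {set T} => independent A && (A \subset M)) [seq A :&: M | A <- F].
    rewrite all_map; apply: sub_all HF => A /= /andP[/independentP iA _]; rewrite subsetIr andbT.
    by apply/independentP => x y; rewrite !inE => /andP[xA _] /andP[yA _]; apply: iA.
  have E0 : \bigcup_(A <- F) A = \bigcup_(A <- F1) A :|: \bigcup_(A <- F2) A.
    rewrite /F1 /F2 !big_map -big_split /=; apply: eq_big_seq => A AF.
    rewrite -setIUr; apply/esym/setIidPl.
    by have /andP[] := allP HF _ AF.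
  rewrite E0 (leq_trans (leq_card_setU _ _).1) //.
  have := m1 _ (sub M1); have := m2 _ (sub M2); rewrite !size_map -/F1 -/F2.
  by rewrite /sumf big_split /= => h2 h1; apply: leq_add.
Qed.

(** With all edges in between, the classes of both parts are kept and the two lists of sizes are
    merged in decreasing order, which adds the columns. *)
Lemma optimal_join : (forall x y, x \in M1 -> y \in M2 -> E x y) ->
  exists s, optimal (M1 :|: M2) s (fun j => t1 j + t2 j).
Proof.
move=> allE; case: opt1 opt2 => H1 sn1 tn1 [c1 p1 k1] m1 [H2 sn2 tn2 [c2 p2 k2] m2].
pose N := #|M1| + #|M2|.
pose s i := sumf N (fun j => i < t1 j + t2 j).
have H1' := conjugate_sym H1; have H2' := conjugate_sym H2.
have conj : conjugate s (fun j => t1 j + t2 j).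
  move=> i j; rewrite sumf_initial // => j'.
    by have := conjugate_anti H1' (leqnSn j'); have := conjugate_anti H2' (leqnSn j'); lia.
  move=> h; have := sn1 0; have := sn2 0; have := H1 0 j'; have := H2 0 j'; rewrite /N; lia.
have sN i : s i <= N.
  rewrite leqNgt -conj; apply/negP => h.
  by have := sn1 0; have := sn2 0; have := H1 0 N; have := H2 0 N; rewrite /N in h *; lia.
exists s; split => //.
- by move=> i; rewrite cardM.
- by move=> j; rewrite cardM leq_add.
(* Ranks in the merged list. Before class [i] of the first part come the strictly larger classes of
   the second; before class [i] of the second come the classes of the first that are at least as
   large. The values of [t2] and [t1] count them. *)
- pose r1 i := i + t2 (s1 i); pose r2 i := i + t1 (s2 i).-1.
  have r1_inj i i' : i < i' -> r1 i < r1 i'.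
    move=> ii; rewrite /r1; have := conjugate_anti H1 (ltnW ii) => h.
    by have := conjugate_anti H2' h; lia.
  have r2_inj i i' : i < i' -> r2 i < r2 i'.
    move=> ii; rewrite /r2; have := conjugate_anti H2 (ltnW ii) => h.
    by have := @conjugate_anti _ _ (s2 i').-1 (s2 i).-1 H1' (ltac:(lia)); lia.
  have r12 i i' : 0 < s2 i' -> r1 i <> r2 i'.
    move=> s0; rewrite /r1 /r2; have := H2 i' (s1 i); have := H1 i (s2 i').-1; lia.
  have sr1 i : 0 < s1 i -> s (r1 i) = s1 i.
    move=> si; have := conj (r1 i) (s1 i); have := conj (r1 i) (s1 i).-1.
    have := H1 i (s1 i); have := H1 i (s1 i).-1; rewrite /r1.
    by have := conjugate_anti H2' (leq_pred (s1 i)); lia.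
  have sr2 i : 0 < s2 i -> s (r2 i) = s2 i.
    move=> si; have := conj (r2 i) (s2 i); have := conj (r2 i) (s2 i).-1.
    have := H2 i (s2 i); have := H2 i (s2 i).-1; rewrite /r2.
    by have := conjugate_anti H1' (leq_pred (s2 i)); lia.
  have surj r : 0 < s r -> (exists2 i, 0 < s1 i & r = r1 i) \/ (exists2 i, 0 < s2 i & r = r2 i).
    (* The classes of size [j.+1] occupy the ranks from [t1 j.+1 + t2 j.+1] to below [t1 j + t2 j];
       those below [t1 j + t2 j.+1] come from the first part. *)
    move=> sr; set j := (s r).-1.
    have h1 := conj r j; have h2 := conj r j.+1.
    have hj : j < s r /\ (j.+1 < s r) = false by rewrite /j; lia.
    case: (ltnP r (t1 j + t2 j.+1)) => h.
      left; pose i := r - t2 j.+1.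
      have := H1 i j; have := H1 i j.+1 => e1 e2.
      have E1 : s1 i = j.+1 by rewrite /i in e1 e2 *; lia.
      by exists i; rewrite ?/r1 E1 // /i; lia.
    right; pose i := r - t1 j.
    have := H2 i j; have := H2 i j.+1 => e1 e2.
    have E1 : s2 i = j.+1 by rewrite /i in e1 e2 *; lia.
    by exists i; rewrite ?/r2 E1 //= /i; lia.
  have c1s x : x \in M1 -> 0 < s1 (c1 x).
    by move=> xM; rewrite -k1 card_gt0; apply/set0Pn; exists x; rewrite inE xM eqxx.
  have c2s x : x \in M2 -> 0 < s2 (c2 x).
    by move=> xM; rewrite -k2 card_gt0; apply/set0Pn; exists x; rewrite inE xM eqxx.
  have inj1 i i' : r1 i = r1 i' -> i = i'.
    by case: (ltngtP i i') => // /r1_inj h e; move: h; rewrite e ltnn.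
  have inj2 i i' : r2 i = r2 i' -> i = i'.
    by case: (ltngtP i i') => // /r2_inj h e; move: h; rewrite e ltnn.
  exists (glue (fun x => r1 (c1 x)) (fun x => r2 (c2 x))) => [x y|r].
    rewrite !inE /glue => /orP[xM|xM] /orP[yM|yM]; rewrite ?xM ?yM ?(inM1 xM) ?(inM1 yM) => e.
    + by move/inj1; apply: p1.
    + by apply: r12; apply: c2s.
    + by move/esym; apply: r12; apply: c2s.
    + by move/inj2; apply: p2.
  rewrite card_glue.
  have E1 i : 0 < s1 i -> #|[set x in M1 | r1 (c1 x) == r1 i]| = s1 i.
    by move=> si; rewrite -k1; apply: eq_card => x; rewrite !inE; congr andb;
      apply/eqP/eqP => [/inj1|->].
  have E2 i : 0 < s2 i -> #|[set x in M2 | r2 (c2 x) == r2 i]| = s2 i.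
    by move=> si; rewrite -k2; apply: eq_card => x; rewrite !inE; congr andb;
      apply/eqP/eqP => [/inj2|->].
  have Z1 q : (forall i, 0 < s1 i -> r1 i <> q) -> #|[set x in M1 | r1 (c1 x) == q]| = 0.
    move=> h; apply/eqP; rewrite cards_eq0; apply/eqP/setP => x; rewrite !inE.
    by apply/andP => -[/c1s/h h' /eqP].
  have Z2 q : (forall i, 0 < s2 i -> r2 i <> q) -> #|[set x in M2 | r2 (c2 x) == q]| = 0.
    move=> h; apply/eqP; rewrite cards_eq0; apply/eqP/setP => x; rewrite !inE.
    by apply/andP => -[/c2s/h h' /eqP].
  case: (posnP (s r)) => [s0|/surj[[i si ->]|[i si ->]]].
  + by rewrite Z1 ?Z2 // => i si e; move: s0; rewrite -e ?sr1 ?sr2 //; lia.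
  + by rewrite E1 // Z2 ?addn0 ?sr1 // => i' si' e; apply: (r12 i i').
  + by rewrite E2 // Z1 ?add0n ?sr2 // => i' si' e; apply: (r12 i' i).
- move=> F HF.
  (* An independent set that leaves [M1] has a vertex in [M2], which is adjacent to all of [M1]; so
     every member of the family lies in one part. The bound then holds column by column: truncating
     two columns at two heights gives at most their sum truncated at the total height. *)
  pose P (A : {set T}) := A \subset M1.
  pose F1 := filter P F; pose F2 := filter (predC P) F.
  have HF1 : all (fun A : {set T} => independent A && (A \subset M1)) F1.
    apply/allP => A; rewrite mem_filter => /andP[AM /(allP HF)/andP[-> _]]; exact: AM.
  have HF2 : all (fun A : {set T} => independent A && (A \subset M2)) F2.
    apply/allP => A; rewrite mem_filter => /andP[/subsetPn[x xA xM] /(allP HF)/andP[iA AM]].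
    rewrite iA; apply/subsetP => y yA.
    have xM2 : x \in M2 by have := subsetP AM _ xA; rewrite !inE (negbTE xM).
    have := subsetP AM _ yA; rewrite !inE => /orP[yM|//].
    by have /independentP/(_ y x yA xA) := iA; rewrite allE.
  have E0 : \bigcup_(A <- F) A = \bigcup_(A <- F1) A :|: \bigcup_(A <- F2) A.
    by rewrite /F1 /F2 !big_filter [LHS](bigID P).
  have Esz : size F = size F1 + size F2 by rewrite !size_filter count_predC.
  rewrite E0 (leq_trans (leq_card_setU _ _).1) //.
  apply: leq_trans (leq_add (m1 _ HF1) (m2 _ HF2)) _.
  have hN1 i : s1 i <= N by rewrite (leq_trans (sn1 i)) ?leq_addr.
  have hN2 i : s2 i <= N by rewrite (leq_trans (sn2 i)) ?leq_addl.
  rewrite Esz (conjugate_sum _ conj sN) (conjugate_sum _ H1 hN1) (conjugate_sum _ H2 hN2).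
  by rewrite !sumfE -big_split /=; apply: leq_sum => j _; lia.
Qed.

End Merge.
End Optimal.

Lemma sum_min_layers (T : finType) (c : T -> nat) K :
  \sum_(x : T) minn K (c x) = sumf K (fun k => #|[set x | k < c x]|).
Proof.
rewrite (eq_bigr (fun x => sumf K (fun k => k < c x))) => [|x _]; last by rewrite sumf_ltn.
rewrite sumfE (eq_bigr (fun x => \sum_(k < K) (k < c x))) => [|x _]; last by rewrite sumfE.
rewrite exchange_big /=; apply: eq_bigr => k _.
by rewrite -sum1dep_card [RHS]big_mkcond.
Qed.

(** A sum of colours is the sum over [k] of the number of vertices coloured above [k]. *)
Lemma sum_layers_le (T : finType) (c d : T -> nat) :
  (forall k, #|[set x | k < d x]| <= #|[set x | k < c x]|) -> \sum_x d x <= \sum_x c x.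
Proof.
move=> H; pose K := \sum_x d x + \sum_x c x.
have E (f : T -> nat) : \sum_x f x <= K -> \sum_x f x = \sum_x minn K (f x).
  move=> fK; apply: eq_bigr => x _; apply/esym/minn_idPr.
  by apply: leq_trans fK; rewrite (bigD1 x) //= leq_addr.
rewrite (E d) ?leq_addr // (E c) ?leq_addl // !sum_min_layers !sumfE.
by apply: leq_sum => k _.
Qed.

Lemma card_lt_classes (T : finType) (c : T -> nat) k :
  #|[set x | c x < k]| = sumf k (fun i => #|[set x | c x == i]|).
Proof.
elim: k => [|k IH].
  rewrite /sumf big_nil; apply/eqP; rewrite cards_eq0; apply/eqP/setP => x.
  by rewrite !inE.
rewrite sumfS -IH -(cardsID [set x | c x < k] [set x | c x < k.+1]); congr (_ + _).
  by apply: eq_card => x; rewrite !inE ltnS andb_idl // => /ltnW.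
by apply: eq_card => x; rewrite !inE -leqNgt ltnS eqn_leq andbC.
Qed.

(** The first [j] classes of any colouring are [j] independent sets and cover no more than the first
    [j] classes of the optimal one. Hence at least as many vertices are coloured above [j], for
    every [j], and the layers can be compared. *)
Lemma chromatic_sum_optimal (G : sgraph) (k : int) s t :
  optimal (@sedge G) [set: G] s t ->
  (exists2 c : G -> nat, colouring c & ((\sum_(v : G) c v)%N%:Z <= k)%R) <->
  ((sumf #|G| (fun i => i.+1 * s i))%:Z <= k)%R.
Proof.
case=> H sn tn [c0 p0 k0] mx.
have c0n x : c0 x < #|G|.
  have : 0 < s (c0 x) by rewrite -k0 card_gt0; apply/set0Pn; exists x; rewrite !inE eqxx.
  by rewrite -H => /leq_trans; apply; rewrite -cardsT.
have E0 : \sum_x (c0 x).+1 = sumf #|G| (fun i => i.+1 * s i).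
  rewrite sumfE (partition_big (fun x => Ordinal (c0n x)) xpredT) //=.
  apply: eq_bigr => i _; rewrite -k0 mulnC -sum_nat_const big_mkcond [RHS]big_mkcond /=.
  by apply: eq_bigr => x _; rewrite !inE /= -val_eqE /=; case: eqP => // ->.
split=> [[c [c1 cE] ck]|ck]; last first.
  exists (fun x => (c0 x).+1); last by rewrite E0.
  by split=> // u v uv [] /p0; apply; rewrite ?inE.
apply: Order.POrderTheory.le_trans ck; rewrite -E0 lez_nat.
apply: sum_layers_le => j.
have card_compl (d : G -> nat) : #|[set x | j < d x]| = #|G| - #|[set x | d x < j.+1]|.
  rewrite cardsCs; congr (_ - _); apply: eq_card => x; rewrite !inE ltnS.
  by rewrite -leqNgt.
rewrite !card_compl leq_sub2l //.
have -> : #|[set x | (c0 x).+1 < j.+1]| = sumf j s.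
  rewrite -[LHS]/#|[set x | c0 x < j]| card_lt_classes !sumfE; apply: eq_bigr => i _; rewrite -k0.
  by apply: eq_card => x; rewrite !inE.
pose F := [seq [set x | c x == i.+1] | i <- iota 0 j].
have HF : all (fun A : {set G} => independent (@sedge G) A && (A \subset [set: G])) F.
  apply/allP => A /mapP[i _ ->]; rewrite subsetT andbT; apply/independentP => x y.
  by rewrite !inE => /eqP cx /eqP cy; apply/negP => /cE; rewrite cx cy.
have := mx _ HF; rewrite size_map size_iota; apply: leq_trans; apply: subset_leq_card.
apply/subsetP => x; rewrite inE ltnS => cj.
have cx := c1 x; have xF : [set y | c y == c x] \in F.
  by apply/mapP; exists (c x).-1; rewrite ?mem_iota ?prednK //; lia.
by rewrite (big_rem _ xF) /= !inE eqxx.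
Qed.

(** * Contraction of twins *)

Definition diagrams := nat -> nat -> nat -> bool.

Section Contraction.
Variables (adj : nat -> nat -> bool) (n : nat).

(** A Young diagram is non-empty exactly when it has its corner cell, so [D v 0 0] is the flag for a
    live vertex. *)
Definition twins (D : diagrams) (u v : nat) : bool :=
  [&& u < v, D u 0 0, D v 0 0 &
      allf n (fun w => [|| w == u, w == v, ~~ D w 0 0 | adj u w == adj v w])].

Definition first_twins (D : diagrams) : nat :=
  findf (n * n) (fun p => twins D (p %/ n) (p %% n)).

Definition column_sum (D : diagrams) v j := sumf n (fun i => D v i j).
Definition row_sum (D : diagrams) v i := sumf n (fun j => D v i j).

(* A live vertex [v] stands for a module whose sorted class sizes are the rows of the Young diagram
   [D v]; dead vertices have the empty diagram. *)
Definition contract (D : diagrams) : diagrams := fun v i j =>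
  if first_twins D == n * n then D v i j
  else if v == first_twins D %% n then false
  else if v == first_twins D %/ n then
    if adj (first_twins D %/ n) (first_twins D %% n)
    then i < column_sum D (first_twins D %/ n) j + column_sum D (first_twins D %% n) j
    else j < row_sum D (first_twins D %/ n) i + row_sum D (first_twins D %% n) i
  else D v i j.

Definition start : diagrams := fun _ i j => (i == 0) && (j == 0).

Lemma first_twinsP D : 0 < n ->
  (first_twins D == n * n /\ (forall u v, u < n -> v < n -> ~~ twins D u v)) \/
  [/\ first_twins D != n * n, first_twins D %/ n < n, first_twins D %% n < n &
      twins D (first_twins D %/ n) (first_twins D %% n)].
Proof.
move=> n0; set P := fun p => twins D (p %/ n) (p %% n).
case: (boolP (has P (iota 0 (n * n)))) => H; [right|left].
  have lt : first_twins D < n * n by rewrite -[n * n](size_iota 0) -has_find.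
  split; [by rewrite neq_ltn lt | by rewrite ltn_divLR | by rewrite ltn_mod |].
  by have := nth_find 0 H; rewrite nth_iota.
split; first by rewrite /first_twins /findf hasNfind // size_iota.
move=> u v un vn; apply: contra H => tw; apply/hasP; exists (u * n + v).
  by rewrite mem_iota pair_index_lt.
by rewrite /P divnMDl // divn_small // addn0 modnMDl modn_small.
Qed.

End Contraction.

(** The bit array represents diagrams only inside the cube of side [n], and the decoded adjacency
    agrees with the graph only below [n]; contraction looks no further. *)
Lemma contract_ext adj adj' n D D' v i j :
  (forall u v, u < n -> v < n -> adj u v = adj' u v) ->
  (forall v i j, v < n -> i < n -> j < n -> D v i j = D' v i j) ->
  v < n -> i < n -> j < n -> contract adj n D v i j = contract adj' n D' v i j.
Proof.
move=> Ha H vn ni jn; have n0 := leq_ltn_trans (leq0n _) vn.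
have Etw u w : u < n -> w < n -> twins adj n D u w = twins adj' n D' u w.
  move=> un wn; rewrite /twins !H //; do 3!congr andb.
  by apply: eq_in_all => z; rewrite mem_iota => /= zn; rewrite H // !Ha.
have Ef : first_twins adj n D = first_twins adj' n D'.
  apply: eq_in_find => p; rewrite mem_iota /= add0n => pn.
  by rewrite Etw ?ltn_divLR ?ltn_mod.
rewrite /contract Ef.
case: (first_twinsP adj' D' n0) => [[-> _]|[/negbTE -> h1 h2 _]]; first exact: H.
have Er u : u < n -> row_sum n D u i = row_sum n D' u i.
  by move=> un; rewrite /row_sum !sumfE; apply: eq_bigr => w _; rewrite H.
have Ec u : u < n -> column_sum n D u j = column_sum n D' u j.
  by move=> un; rewrite /column_sum !sumfE; apply: eq_bigr => w _; rewrite H.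
by rewrite !Er // !Ec // H // Ha.
Qed.

(** Hereditary existence of twins, the characterisation of cographs that drives the contraction: [W]
    will be the set of live vertices. *)
Definition cograph (G : sgraph) : Prop :=
  forall W : {set G}, 1 < #|W| -> exists x y, [/\ x \in W, y \in W, x != y &
    forall w, w \in W -> w != x -> w != y -> sedge x w = sedge y w].

Lemma card_le1_eq (T : finType) (A : {set T}) : #|A| <= 1 ->
  forall x y, x \in A -> y \in A -> x = y.
Proof. by move=> /card_le1_eqP H x y xA yA; apply: H. Qed.

Lemma ord2_eq k (a i j : 'I_k) : k <= 2 -> i != j -> (a == j) = (a != i).
Proof. by move=> k2; case: a i j => [a ?] [i ?] [j ?]; rewrite -!val_eqE /=; lia. Qed.

Lemma ord2_pair k (l a i j : 'I_k) : k <= 2 -> i != j -> l != a ->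
  (l == i) && (a == j) || (l == j) && (a == i).
Proof.
by move=> k2; case: l a i j => [l ?] [a ?] [i ?] [j ?]; rewrite -!val_eqE /=; lia.
Qed.

(** A join does not separate twins of equal label: the vertices of the other label become adjacent
    to both, and with two labels there is no third kind. So twins are sought inside one label class
    of [W]. When no class (or, for a union, no side) has two vertices in [W], then [W] is a pair,
    and its two elements are twins vacuously. *)
Lemma cograph_cweval k (e : cwexpr k) : k <= 2 -> cograph (cweval e).
Proof.
move=> k2; elim: e => [i|e1 IH1 e2 IH2|i j ij e IH|i j e IH] /=.
- by move=> W; have := max_card (mem W); rewrite card_unit; case: #|_| => [|[]].
- move=> W W1.
  pose W1' := [set x | inl x \in W]; pose W2' := [set x | inr x \in W].
  case: (ltnP 1 #|W1'|) => h1.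
    have [x [y [xW yW xy H]]] := IH1 _ h1; rewrite !inE in xW yW.
    exists (inl x), (inl y); split=> // -[w|w] //= wW wx wy.
    by apply: H; rewrite ?inE.
  case: (ltnP 1 #|W2'|) => h2.
    have [x [y [xW yW xy H]]] := IH2 _ h2; rewrite !inE in xW yW.
    exists (inr x), (inr y); split=> // -[w|w] //= wW wx wy.
    by apply: H; rewrite ?inE.
  have eq1 x y : inl x \in W -> inl y \in W -> x = y.
    by move=> xW yW; apply: (card_le1_eq h1); rewrite inE.
  have eq2 x y : inr x \in W -> inr y \in W -> x = y.
    by move=> xW yW; apply: (card_le1_eq h2); rewrite inE.
  have /card_gt1P[x [y [xW yW xy]]] := W1; exists x, y; split=> // w wW wx wy.
  case: x xW xy wx => x xW; case: y yW wy => y yW; case: w wW => w wW wy xy wx;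
    first [by rewrite (eq1 _ _ xW yW) eqxx in xy | by rewrite (eq2 _ _ xW yW) eqxx in xy
      | by rewrite (eq1 _ _ wW yW) eqxx in wy | by rewrite (eq2 _ _ wW yW) eqxx in wy
      | by rewrite (eq1 _ _ wW xW) eqxx in wx | by rewrite (eq2 _ _ wW xW) eqxx in wx].
- move=> W W1; pose A := cweval e.
  pose L a : {set A} := [set x in W | label (x : A) == a].
  have lab (x : A) : (label x == j) = (label x != i) by apply: ord2_eq.
  have twin a : 1 < #|L a| -> exists x y, [/\ x \in W, y \in W, x != y &
      forall w, w \in W -> w != x -> w != y -> join_edge i j (A := A) x w = join_edge i j (A := A) y w].
    move=> h; have [x [y [+ + xy H]]] := IH _ h.
    rewrite !inE => /andP[xW /eqP lx] /andP[yW /eqP ly].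
    exists x, y; split=> // w wW wx wy; rewrite /join_edge lx ly.
    case: (eqVneq (label w) a) => lw; first by rewrite H // inE wW lw /=.
    by case/orP: (ord2_pair k2 ij lw) => /andP[/eqP -> /eqP ->]; rewrite !eqxx /= ?orbT.
  case: (ltnP 1 #|L i|) => hi; first exact: twin hi.
  case: (ltnP 1 #|L j|) => hj; first exact: twin hj.
  have same a x y : #|L a| <= 1 -> x \in W -> y \in W -> label (x : A) = a -> label (y : A) = a -> x = y.
    by move=> h xW yW lx ly; apply: (card_le1_eq h); rewrite !inE ?xW ?yW ?lx ?ly eqxx.
  have /card_gt1P[x [y [xW yW xy]]] := W1; exists x, y; split=> // w wW wx wy.
  have si u v : u \in W -> v \in W -> u != v -> (label (u : A) == i) != (label (v : A) == i).
    move=> uW vW; apply: contraNneq => /esym e1.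
    case: (boolP (label (u : A) == i)) e1 => [/eqP e0 /eqP e1|e0].
      by rewrite (same i u v).
    by move=> /negbT; rewrite -lab => /eqP e1; rewrite -lab in e0; rewrite (same j u v) //; apply/eqP.
  have := si _ _ xW yW xy; have := si _ _ wW xW wx; have := si _ _ wW yW wy.
  by do 3!case: (label _ == i).
- exact: IH.
Qed.

Lemma cograph_isomorphic (G H : sgraph) : isomorphic G H -> cograph G -> cograph H.
Proof.
case=> f [g fK gK] fE cG W W1.
have [|x [y [xW yW xy h]]] := cG [set x | f x \in W].
  rewrite (_ : [set x | _] = g @: W) ?card_imset //; first exact: can_inj gK.
  apply/setP => x; rewrite inE; apply/idP/imsetP => [xW|[y yW ->]]; last by rewrite gK.
  by exists (f x).
rewrite !inE in xW yW; exists (f x), (f y); split=> //.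
  by rewrite (inj_eq (can_inj fK)).
move=> w wW wx wy; rewrite -(gK w) !fE; apply: h.
- by rewrite inE gK.
- by rewrite -(inj_eq (can_inj fK)) gK.
- by rewrite -(inj_eq (can_inj fK)) gK.
Qed.

Lemma cograph_cliquewidth (c : int) (G : sgraph) :
  (c <= 2)%R -> cliquewidth_at_most c G -> cograph G.
Proof.
move=> c2 [w [[G0|[e iso]] _] wc] W.
  by rewrite ltnNge (leq_trans (max_card _)) // G0.
by apply: cograph_isomorphic iso _ _; apply: cograph_cweval; lia.
Qed.

Lemma optimal_set0 (T : finType) (E : rel T) : optimal E set0 (fun=> 0) (fun=> 0).
Proof.
split=> //.
  by exists (fun=> 0) => [x y|i]; rewrite ?inE // -[RHS](@cards0 T); apply: eq_card => x; rewrite !inE.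
move=> F HF; rewrite (_ : \bigcup_(A <- F) A = set0) ?cards0 //.
apply/eqP; rewrite -subset0; apply: bigcup_seq_subset.
by apply: sub_all HF => A /andP[].
Qed.

Lemma optimal_live (T : finType) (E : rel T) (M : {set T}) s t :
  optimal E M s t -> (0 < s 0) = (M != set0).
Proof.
case=> H sn tn [c _ k] _; apply/idP/set0Pn => [s0|[x xM]].
  by apply/set0Pn; rewrite -card_gt0; apply: leq_trans s0 (sn 0).
have : 0 < s (c x) by rewrite -k card_gt0; apply/set0Pn; exists x; rewrite inE xM eqxx.
by move=> h; apply: leq_trans h (conjugate_anti H (leq0n _)).
Qed.

Section Algorithm.
Variable G : sgraph.
Notation n := #|G|.
Let adj := adjn G.

Definition module (rep : G -> nat) (u : nat) : {set G} := [set x | rep x == u].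

(** [rep x] is the index of the vertex standing for the module of [x]. Contraction keeps one of two
    twins as representative, so adjacency between modules can always be read from the original
    matrix. *)
Record invariant (D : diagrams) (rep : G -> nat) : Prop := Invariant {
  inv_lt : forall x, rep x < n;
  inv_adj : forall x y, rep x <> rep y -> sedge x y = adj (rep x) (rep y);
  inv_opt : forall u, u < n -> exists s t, optimal (@sedge G) (module rep u) s t /\
     forall i j, i < n -> j < n -> D u i j = (j < s i) }.

Lemma invariant_live D rep u : invariant D rep -> u < n -> D u 0 0 = (module rep u != set0).
Proof.
move=> I un; have [s [t [o ->]]] := inv_opt I un; first exact: optimal_live o.
- exact: leq_ltn_trans un.
- exact: leq_ltn_trans un.
Qed.

Lemma invariant_start : invariant start (fun x => enum_rank x).
Proof.
split=> [x|x y _|u un]; first exact: ltn_ord.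
  by rewrite /adj adjnE !enum_rankK.
exists (fun i => i == 0), (fun j => j == 0); split; last first.
  by move=> i j _ _; rewrite /start; case: i; case: j.
rewrite (_ : module _ u = [set enum_val (Ordinal un)]); first by apply: optimal_set1; rewrite sedge_irr.
apply/setP => x; rewrite !inE.
apply/eqP/eqP => [xu|->]; last by rewrite enum_valK.
by rewrite (_ : Ordinal un = enum_rank x) ?enum_rankK //; apply: val_inj.
Qed.

Lemma optimal_row_sum D M s t u i : optimal (@sedge G) M s t -> 
  (forall i j, i < n -> j < n -> D u i j = (j < s i)) -> i < n -> row_sum n D u i = s i.
Proof.
move=> o h ni; have sn : s i <= n by apply: leq_trans (opt_s o i) (max_card _).
rewrite /row_sum -[RHS](minn_idPr sn) -sumf_ltn !sumfE.
by apply: eq_bigr => j _; rewrite h.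
Qed.

Lemma optimal_column_sum D M s t u j : optimal (@sedge G) M s t -> 
  (forall i j, i < n -> j < n -> D u i j = (j < s i)) -> j < n -> column_sum n D u j = t j.
Proof.
move=> o h nj; have tn : t j <= n by apply: leq_trans (opt_t o j) (max_card _).
rewrite /column_sum -[RHS](minn_idPr tn) -sumf_ltn !sumfE.
by apply: eq_bigr => i _; rewrite h // (opt_conj o).
Qed.

Lemma invariant_contract D rep : 0 < n -> invariant D rep ->
  exists rep', invariant (contract adj n D) rep'.
Proof.
move=> n0 I; have [Ilt Iadj Iopt] := I.
case: (first_twinsP adj D n0) => [[e _]|[/negbTE e an bn]].
  exists rep; split=> // u un; have [s [t [o h]]] := Iopt u un.
  by exists s, t; split=> // i j ni nj; rewrite /contract e h.
set a := _ %/ n in an *; set b := _ %% n in bn *.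
case/and4P=> ab la lb /allfP tw.
exists (fun x => if rep x == b then a else rep x).
set rep' := fun x => _.
have tw' x y : rep x = a -> rep x <> rep y -> rep y <> b -> adj a (rep y) = adj b (rep y).
  move=> xa xy yb; have := tw _ (Ilt y).
  have /negbTE -> : rep y != a by apply/eqP => h; apply: xy; rewrite xa h.
  have /negbTE -> : rep y != b by apply/eqP.
  rewrite (invariant_live I (Ilt y)) /=.
  have -> : module rep (rep y) != set0 by apply/set0Pn; exists y; rewrite inE.
  by move/eqP.
have adjC u v : u < n -> v < n -> adj u v = adj v u.
  move=> un vn; rewrite -[u]/(val (Ordinal un)) -[v]/(val (Ordinal vn)) /adj !adjnE.
  exact: sedge_sym.
have Mb u : u < n -> u != a -> u != b -> module rep' u = module rep u.
  move=> un ua ub; apply/setP => x; rewrite !inE /rep'; case: (eqVneq (rep x) b) => [->|//].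
  by rewrite eq_sym (negbTE ua) eq_sym (negbTE ub).
have Ma : module rep' a = module rep a :|: module rep b.
  apply/setP => x; rewrite !inE /rep'; case: (eqVneq (rep x) b) => [->|//].
    by rewrite eqxx orbT.
  by rewrite orbF.
have M0 : module rep' b = set0.
  apply/setP => x; rewrite !inE /rep'; case: (eqVneq (rep x) b) => [_|/negbTE //].
  by apply/negbTE; rewrite neq_ltn ab.
have disj : [disjoint module rep a & module rep b].
  rewrite -setI_eq0; apply/eqP/setP => x; rewrite !inE.
  by apply/andP => -[/eqP -> /eqP h]; move: ab; rewrite h ltnn.
have Eab x y : x \in module rep a -> y \in module rep b -> sedge x y = adj a b.
  rewrite !inE => /eqP xa /eqP yb; rewrite Iadj ?xa ?yb // => h.
  by move: ab; rewrite h ltnn.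
have [xa xaP] : exists x, rep x = a.
  by move: la; rewrite (invariant_live I an) => /set0Pn[x]; rewrite inE => /eqP; exists x.
split.
- by move=> x; rewrite /rep'; case: ifP.
- move=> x y; rewrite /rep'; case: eqP => xb; case: eqP => yb // ne.
  + rewrite Iadj ?xb; last by move=> h; apply: yb.
    by rewrite (tw' xa y) // xaP.
  + rewrite Iadj ?yb; last by move=> h; apply: xb.
    by rewrite adjC // -(tw' xa x) 1?adjC // xaP; apply/nesym.
  + exact: Iadj.
- move=> u un; case: (eqVneq u b) => [->|ub].
    exists (fun=> 0), (fun=> 0); rewrite M0; split; first exact: optimal_set0.
    by move=> i j _ _; rewrite /contract e -/a -/b eqxx.
  case: (eqVneq u a) => [->|ua]; last first.
    have [s [t [o h]]] := Iopt u un; exists s, t; rewrite Mb //; split=> // i j ni nj.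
    by rewrite /contract e -/a -/b (negbTE ub) (negbTE ua) h.
  have [s1 [t1 [o1 h1]]] := Iopt a an; have [s2 [t2 [o2 h2]]] := Iopt b bn.
  have ab' : (a == b) = false by apply/negbTE; rewrite neq_ltn ab.
  rewrite Ma; case Ej : (adj a b).
    have [|s o] := optimal_join disj o1 o2; first by move=> x y xA yB; rewrite Eab.
    exists s, (fun j => t1 j + t2 j); split=> // i j ni nj.
    rewrite /contract e -/a -/b ab' eqxx Ej -(opt_conj o).
    by rewrite (optimal_column_sum o1 h1) // (optimal_column_sum o2 h2).
  have [|t o] := optimal_union (@sedge_sym G) disj o1 o2; first by move=> x y xA yB; rewrite Eab ?Ej.
  exists (fun i => s1 i + s2 i), t; split=> // i j ni nj.
  rewrite /contract e -/a -/b ab' eqxx Ej.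
  by rewrite (optimal_row_sum o1 h1) // (optimal_row_sum o2 h2).
Qed.

Definition live (D : diagrams) : {set 'I_n} := [set u : 'I_n | D u 0 0].

(** The cograph property, applied to the live vertices, yields a pair that [first_twins] must
    find. *)
Lemma live_contract D rep : 0 < n -> cograph G -> invariant D rep ->
  1 < #|live D| -> #|live (contract adj n D)| < #|live D|.
Proof.
move=> n0 cG I l1.
case: (first_twinsP adj D n0) => [[_ no]|[/negbTE e an bn]].
  have [|x [y [xW yW xy h]]] := cG [set x | D (enum_rank x) 0 0].
    rewrite (_ : [set x | _] = enum_val @: live D) ?card_imset //; first exact: enum_val_inj.
    apply/setP => x; rewrite inE; apply/idP/imsetP => [xW|[u]].
      by exists (enum_rank x); rewrite ?inE ?enum_rankK.
    by rewrite inE => uW ->; rewrite enum_valK.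
  rewrite !inE in xW yW.
  have tw (x' y' : G) : D (enum_rank x') 0 0 -> D (enum_rank y') 0 0 -> enum_rank x' < enum_rank y' ->
    (forall w, w \in [set x | D (enum_rank x) 0 0] -> w != x' -> w != y' -> sedge x' w = sedge y' w) ->
    twins adj n D (enum_rank x') (enum_rank y').
    move=> lx ly lt hw; rewrite /twins lt lx ly; apply/allfP => w wn.
    have -> : w = enum_rank (enum_val (Ordinal wn)) by rewrite enum_valK.
    set z := enum_val _.
    case: (eqVneq z x') => [->|zx]; first by rewrite eqxx.
    case: (eqVneq z y') => [->|zy]; first by rewrite eqxx orbT.
    case: (boolP (D (enum_rank z) 0 0)) => zl; last by rewrite !orbT.
    by rewrite /adj !adjnE !enum_rankK hw ?inE // eqxx !orbT.
  case: (ltngtP (enum_rank x) (enum_rank y)) => lt.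
  - by have := no _ _ (ltn_ord (enum_rank x)) (ltn_ord (enum_rank y)); rewrite tw.
  - have := no _ _ (ltn_ord (enum_rank y)) (ltn_ord (enum_rank x)); rewrite tw // => w wW wy wx.
    by rewrite h.
  - by move: xy; rewrite (enum_rank_inj (val_inj lt)) eqxx.
set a := _ %/ n in an *; set b := _ %% n in bn *.
case/and4P=> ab la lb _; apply: proper_card; apply/properP; split.
  apply/subsetP => u; rewrite !inE /contract e -/a -/b.
  case: (eqVneq (u : nat) b) => // ub; case: (eqVneq (u : nat) a) => [->|//] _.
  exact: la.
by exists (Ordinal bn); rewrite !inE //= /contract e -/b eqxx.
Qed.

(** Dead vertices contribute 0, so the sum over all vertices is the cost of the surviving one,
    wherever it is. *)
Definition diagram_cost (D : diagrams) : nat :=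
  sumf n (fun v => sumf n (fun i => i.+1 * row_sum n D v i)).

Lemma contract_run k : 0 < n -> cograph G ->
  exists2 rep, invariant (iter k (contract adj n) start) rep &
    #|live (iter k (contract adj n) start)| <= maxn 1 (n - k).
Proof.
move=> n0 cG; elim: k => [|k [rep I IH]].
  exists (fun x => nat_of_ord (enum_rank x)); first exact: invariant_start.
  by rewrite subn0 leq_max; apply/orP; right; rewrite -[leqRHS](card_ord n) max_card.
have [rep' I'] := invariant_contract n0 I; exists rep' => //.
rewrite iterS; set D := iter k _ _ in I IH *.
case: (ltnP 1 #|live D|) => l1; first by have := live_contract n0 cG I l1; lia.
suff : #|live (contract adj n D)| <= #|live D| by lia.
case: (first_twinsP adj D n0) => [[e _]|[e an bn]].
  by apply: subset_leq_card; apply/subsetP => u; rewrite !inE /contract e.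
case/and4P=> ab la lb _; move: l1; rewrite leqNgt => /negP[].
apply/card_gt1P; exists (Ordinal an), (Ordinal bn); split; rewrite ?inE //.
by rewrite -val_eqE neq_ltn /= ab.
Qed.

Lemma diagram_cost_correct (k : int) : cograph G ->
  (exists2 c : G -> nat, colouring c & ((\sum_(v : G) c v)%N%:Z <= k)%R) <->
  ((diagram_cost (iter n (contract adj n) start))%:Z <= k)%R.
Proof.
move=> cG; case: (posnP n) => [G0|n0].
  have E0 : [set: G] = set0 by apply/eqP; rewrite -cards_eq0 cardsT G0.
  have o := optimal_set0 (@sedge G); rewrite -E0 in o.
  by rewrite (chromatic_sum_optimal k o) /diagram_cost G0 /sumf !big_nil.
have [rep I] := contract_run n n0 cG; rewrite subnn.
set D := iter _ _ _ in I * => l1.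
have [x0 _] : exists x0 : G, x0 \in G by apply/card_gt0P.
have repE x : rep x = rep x0.
  have Hl y : Ordinal (inv_lt I y) \in live D.
    by rewrite inE (invariant_live I (inv_lt I y)); apply/set0Pn; exists y; rewrite inE /=.
  have : #|live D| <= 1 by lia.
  by move/card_le1_eq => /(_ _ _ (Hl x) (Hl x0)) [].
have MT : module rep (rep x0) = [set: G] by apply/setP => x; rewrite !inE repE eqxx.
have [s [t []]] := inv_opt I (inv_lt I x0); rewrite MT => o h.
rewrite (chromatic_sum_optimal k o) (_ : diagram_cost D = sumf n (fun i => i.+1 * s i)) //.
rewrite /diagram_cost sumfE (bigD1 (Ordinal (inv_lt I x0))) //= big1 ?addn0.
  by rewrite !sumfE; apply: eq_bigr => i _; rewrite (optimal_row_sum o h).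
move=> v vx0; rewrite sumfE big1 // => i _.
have [s' [t' [o' h']]] := inv_opt I (ltn_ord v).
rewrite (optimal_row_sum o' h') // (_ : s' i = 0) ?muln0 //.
apply/eqP; rewrite -leqn0; apply: leq_trans (opt_s o' i) _.
rewrite leqn0 cards_eq0; apply/eqP/setP => x; rewrite !inE repE.
by apply/negbTE; move: vx0; rewrite -val_eqE /= eq_sym.
Qed.

End Algorithm.

Definition read_diagrams (S : nat -> bool) (n base : nat) : diagrams :=
  fun v i j => S (base + ((v * n + i) * n + j)).

Definition total_cost (n : nat) (D : diagrams) : nat :=
  sumf n (fun v => sumf n (fun i => i.+1 * row_sum n D v i)).

(* Position [p] belongs to generation [p %/ n ^ 3] of the iteration of [contract]; the last bit is
   the answer. *)
Definition solver (x S : nat -> bool) (p len : nat) : bool :=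
  let n := dec_order x len in
  if p == n.+1 * n ^ 3 then dec_leq x len (total_cost n (read_diagrams S n (n * n ^ 3)))
  else if p %/ n ^ 3 == 0 then start 0 (p %/ n %% n) (p %% n)
  else contract (dec_edge x len) n (read_diagrams S n ((p %/ n ^ 3).-1 * n ^ 3))
         (p %/ n ^ 2 %% n) (p %/ n %% n) (p %% n).

Lemma PT_pred a : PT a -> PT (fun o e => (a o e).-1).
Proof. by move=> Ha; apply: PT_ext (PT_sub Ha (PT_cst 1)) => o e; rewrite subn1. Qed.

Lemma PT_twins l n b u v : PT l -> PT n -> PT b -> PT u -> PT v ->
  PT (fun o e => nat_of_bool (twins (dec_edge (o 0) (l o e)) (n o e)
    (read_diagrams (o 2) (n o e) (b o e)) (u o e) (v o e))).
Proof. by move=> Hl Hn Hb Hu Hv; rewrite /twins /read_diagrams; pt. Qed.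

Ltac pt_user ::= first [apply PT_dec_order | apply PT_dec_edge | apply PT_dec_leq | apply PT_pred
  | apply PT_twins].

Lemma PT_first_twins l n b : PT l -> PT n -> PT b ->
  PT (fun o e => first_twins (dec_edge (o 0) (l o e)) (n o e)
    (read_diagrams (o 2) (n o e) (b o e))).
Proof. by move=> Hl Hn Hb; rewrite /first_twins; pt. Qed.

Ltac pt_user ::= first [apply PT_dec_order | apply PT_dec_edge | apply PT_dec_leq | apply PT_pred
  | apply PT_first_twins].

Lemma PT_contract l n b v i j : PT l -> PT n -> PT b -> PT v -> PT i -> PT j ->
  PT (fun o e => nat_of_bool (contract (dec_edge (o 0) (l o e)) (n o e)
    (read_diagrams (o 2) (n o e) (b o e)) (v o e) (i o e) (j o e))).
Proof.
move=> Hl Hn Hb Hv Hi Hj; rewrite /contract /column_sum /row_sum.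
have Hf := PT_first_twins Hl Hn Hb; rewrite /read_diagrams in Hf *.
by pt.
Qed.

Ltac pt_user ::= first [apply PT_dec_order | apply PT_dec_edge | apply PT_dec_leq | apply PT_pred
  | apply PT_contract].

Lemma PT_solver p l : PT p -> PT l ->
  PT (fun o e => nat_of_bool (solver (o 0) (o 2) (p o e) (l o e))).
Proof.
move=> Hp Hl; rewrite /solver /total_cost /row_sum /start.
apply: PT_ifb; first by pt.
  by rewrite /read_diagrams; pt.
by pt.
Qed.

Section Solve.
Variables (G : sgraph) (k : int).
Notation n := #|G|.
Let x := encode_graph_int (G, k).
Let D m := iter m (contract (adjn G) n) start.

Definition solver_bit (p : nat) : bool :=
  if p == n.+1 * n ^ 3 then ((total_cost n (D n))%:Z <= k)%R
  else D (p %/ n ^ 3) (p %/ n ^ 2 %% n) (p %/ n %% n) (p %% n).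

(** The recursion equation required by [PT_machine]: a bit of one generation depends on the previous
    generation only, whose block of [n ^ 3] bits ends before it, and the answer reads generation
    [n]. *)
Lemma solver_bitE p : p < (n.+1 * n ^ 3).+1 ->
  solver_bit p = solver (nth false x) (fun j => (j < p) && solver_bit j) p (size x).
Proof.
rewrite ltnS => pn; rewrite /solver dec_orderE.
have gen m v i j : m <= n -> v < n -> i < n -> j < n -> 
    m.+1 * n ^ 3 <= p ->
    read_diagrams (fun j => (j < p) && solver_bit j) n (m * n ^ 3) v i j = D m v i j.
  move=> mn vn ni jn mp; rewrite /read_diagrams.
  have n0 := leq_ltn_trans (leq0n _) vn.
  have lt1 : v * n + i < n ^ 2 by rewrite expnS expn1; apply: pair_index_lt.
  have lt2 : (v * n + i) * n + j < n ^ 3 by rewrite expnSr; apply: pair_index_lt.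
  have ltp : m * n ^ 3 + ((v * n + i) * n + j) < p.
    by apply: leq_trans mp; rewrite mulSn addnC ltn_add2r.
  rewrite ltp /solver_bit (_ : (_ == _) = false) /=; last first.
    by apply/negbTE; rewrite neq_ltn (leq_trans ltp).
  have -> : (m * n ^ 3 + ((v * n + i) * n + j)) %/ n ^ 3 = m.
    by rewrite divnMDl ?expn_gt0 ?n0 // divn_small ?addn0.
  have -> : (m * n ^ 3 + ((v * n + i) * n + j)) %% n = j.
    by rewrite expnSr mulnA addnA -mulnDl modnMDl modn_small.
  have E1 : (m * n ^ 3 + ((v * n + i) * n + j)) %/ n = (m * n ^ 2) + (v * n + i).
    by rewrite expnSr mulnA addnA -mulnDl divnMDl // divn_small ?addn0.
  have -> : (m * n ^ 3 + ((v * n + i) * n + j)) %/ n %% n = i.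
    by rewrite E1 expnS expn1 mulnA addnA -mulnDl modnMDl modn_small.
  have -> // : (m * n ^ 3 + ((v * n + i) * n + j)) %/ n ^ 2 %% n = v.
  rewrite (_ : n ^ 2 = n * n) // divnMA E1 (_ : n ^ 2 = n * n) // mulnA addnA -mulnDl divnMDl //.
  by rewrite (divn_small ni) addn0 modnMDl modn_small.
rewrite {1}/solver_bit; case: eqP => [pE|ne].
  rewrite dec_leqE; congr (Posz _ <= _)%R; rewrite /total_cost /row_sum !sumfE.
  apply: eq_bigr => v _; rewrite !sumfE; apply: eq_bigr => i _; congr muln.
  by rewrite !sumfE; apply: eq_bigr => j _; rewrite gen // pE.
have plt : p < n.+1 * n ^ 3 by rewrite ltn_neqAle pn andbT; apply/eqP.
have n0 : 0 < n by case: (posnP n) plt => // ->; rewrite exp0n ?muln0.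
have n30 : 0 < n ^ 3 by rewrite expn_gt0 n0.
case: eqP => [->|/eqP m0]; first by [].
set m := p %/ n ^ 3 in m0 *; have mE : m = m.-1.+1 by rewrite prednK // lt0n.
rewrite {1}mE /D iterS; apply: contract_ext; rewrite ?ltn_mod //.
  by move=> u v un vn; rewrite dec_edgeE.
move=> v i j vn ni jn; rewrite gen //; last by rewrite -mE leq_divM.
by apply: leq_trans (leq_pred m) _; rewrite -ltnS /m ltn_divLR.
Qed.

End Solve.

Lemma chromatic_sum_polytime (c : int) : (c <= 2)%R ->
  polytime_solvable (chromatic_sum (cliquewidth_at_most c)).
Proof.
move=> c2.
have HL : PT (fun o e => ((dec_order (o 0) (head 0 e)).+1 * dec_order (o 0) (head 0 e) ^ 3).+1).
  by pt.
have Hoff : PT (fun o e => (dec_order (o 0) (head 0 e)).+1 * dec_order (o 0) (head 0 e) ^ 3).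
  by pt.
have Hs := PT_solver (p := fun _ e => head 0 e) (l := fun _ e => head 0 (behead e))
  (ltac:(pt)) (ltac:(pt)).
have [M [P HM]] := PT_machine HL Hoff Hs.
exists M, P => -[G k] /= valid.
set x := nseq _ _ ++ _; have -> : x = encode_graph_int (G, k) by [].
have [p pn|C [HC _ Ha]] := HM (encode_graph_int (G, k)) [::] (solver_bit G k).
  by rewrite /= dec_orderE in pn; rewrite /= (solver_bitE k pn).
rewrite tm_init_blank; exists C => //; rewrite Ha /= dec_orderE ltnSn /=.
rewrite /solver_bit eqxx -(diagram_cost_correct k (cograph_cliquewidth c2 valid)).
by [].
Qed.

(** * From independent sets to chromatic sum *)

(** Among [m.+1] distinct positive numbers one exceeds [m], by the pigeonhole principle; remove
    it. *)
Lemma sumn_uniq_ge (s : seq nat) : uniq s -> all (leq 1) s ->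
  size s * (size s).+1 <= 2 * sumn s.
Proof.
move: {2}(size s) (erefl (size s)) => m; elim: m s => [|m IH] s sm us ps; first by rewrite sm.
have [x xs xm] : exists2 x, x \in s & m < x.
  apply/hasP; apply/negPn/negP => /hasPn h.
  have : size s <= size (iota 1 m).
    apply: uniq_leq_size => // y ys; rewrite mem_iota.
    by have := h y ys; have := allP ps y ys => /=; lia.
  by rewrite size_iota sm ltnn.
have := IH (rem x s); rewrite size_rem // sm /= => /(_ erefl (rem_uniq _ us)).
have pr : all (leq 1) (rem x s) by apply/allP => y /mem_rem /(allP ps).
have -> : sumn s = x + sumn (rem x s).
  by rewrite (perm_sumn (perm_to_rem xs)).
move=> /(_ pr); nia.
Qed.

(** An element above the size, added to the least possible sum of the others, would break the upper
    bound. *)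
Lemma sumn_uniq_eq (s : seq nat) : uniq s -> all (leq 1) s ->
  2 * sumn s <= size s * (size s).+1 -> all (fun x => x <= size s) s.
Proof.
move=> us ps H; apply/allP => x xs; rewrite leqNgt; apply/negP => xm.
have pr : all (leq 1) (rem x s) by apply/allP => y /mem_rem /(allP ps).
have := sumn_uniq_ge (rem_uniq x us) pr; rewrite size_rem //.
have E : sumn s = x + sumn (rem x s) by rewrite (perm_sumn (perm_to_rem xs)).
by case: (size s) H xm => [|m] /=; rewrite E; nia.
Qed.

(** Summation by parts: the weight [N - a] counts the prefixes that contain [a]. *)
Lemma sumf_weighted N (z : nat -> nat) :
  sumf N (fun a => (N - a) * z a) = sumf N (fun b => sumf b.+1 z).
Proof.
elim: N => [|N IH]; first by rewrite /sumf !big_nil.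
rewrite [RHS]sumfS -IH sumfS subSnn mul1n sumfS addnA; congr addn.
rewrite !sumfE -big_split /=; apply: eq_bigr => a _.
by rewrite (subSn (ltnW (ltn_ord a))) mulSn addnC.
Qed.

Section Rearrangement.
Variables (N : nat) (f g : nat -> nat).
Let prefix b := [seq f a | a <- iota 0 b] ++ [seq g a | a <- iota 0 b].
Hypothesis uniq_fg : uniq (prefix N).
Hypothesis pos_fg : all (leq 1) (prefix N).

Let size_prefix b : size (prefix b) = 2 * b.
Proof. by rewrite size_cat !size_map size_iota; lia. Qed.

Let sumn_prefix b : sumn (prefix b) = sumf b (fun a => f a + g a).
Proof.
by rewrite sumn_cat !sumnE !big_map /sumf big_split /= /index_iota subn0.
Qed.

Let prefix_sub b : b <= N -> uniq (prefix b) /\ all (leq 1) (prefix b).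
Proof.
move=> bN; have sub h : {subset [seq h a | a <- iota 0 b] <= [seq (h a : nat) | a <- iota 0 N]}.
  move=> x /mapP[a]; rewrite mem_iota => ab ->; apply: map_f; rewrite mem_iota; lia.
have tk h : [seq h a | a <- iota 0 b] = take b [seq (h a : nat) | a <- iota 0 N].
  by rewrite -map_take take_iota (minn_idPl bN).
split.
  move: uniq_fg; rewrite /prefix !cat_uniq => /and3P[u1 h u2].
  rewrite !tk !take_uniq //= andbT; apply: contra h => /hasP[x /mem_take xg /mem_take xf].
  by apply/hasP; exists x.
apply/allP => x; rewrite mem_cat => /orP[] /sub xs; apply: (allP pos_fg); rewrite mem_cat xs ?orbT //.
Qed.

Let base b : sumf b (fun a => 4 * a + 3) = b * (2 * b).+1.
Proof. by elim: b => [|b IH]; rewrite ?sumfS ?IH /sumf ?big_nil //; lia. Qed.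

Let prefix_ge b : b <= N -> sumf b (fun a => 4 * a + 3) <= sumf b (fun a => f a + g a).
Proof.
move=> /prefix_sub[u p]; have := sumn_uniq_ge u p.
by rewrite size_prefix sumn_prefix base; lia.
Qed.

(** For [f] the core colours of a component and [g] the ruler colours: the first [b] levels use
    [2 * b] distinct positive colours, whose sum is at least [1 + ... + 2b], the sum of the numbers
    [4 * a + 3]. The weighted sum adds up these prefix bounds. *)
Lemma rearrangement_ge :
  sumf N (fun a => (N - a) * (4 * a + 3)) <= sumf N (fun a => (N - a) * (f a + g a)).
Proof.
rewrite !(sumf_weighted N) !sumfE; apply: leq_sum => b _; exact: prefix_ge (ltn_ord b).
Qed.

(** Equality in the total makes every prefix tight, so the first [b] levels use exactly the colours
    1 to [2 * b]; level [a] is left with [2 * a + 1] and [2 * a + 2] in some order. *)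
Lemma rearrangement_eq a :
  sumf N (fun a => (N - a) * (f a + g a)) <= sumf N (fun a => (N - a) * (4 * a + 3)) -> a < N ->
  f a + g a = 4 * a + 3 /\ 2 * a + 1 <= g a <= 2 * a + 2.
Proof.
rewrite !(sumf_weighted N) => H.
have pe b : b <= N -> sumf b (fun a => f a + g a) = sumf b (fun a => 4 * a + 3).
  case: b => [|b] bN; first by rewrite /sumf !big_nil.
  apply/eqP; rewrite eqn_leq prefix_ge // andbT leqNgt; apply/negP => lt.
  move: H; rewrite leqNgt => /negP[]; rewrite !sumfE.
  rewrite (bigD1 (Ordinal bN)) //= [ltnRHS](bigD1 (Ordinal bN)) //=.
  by rewrite -addSn leq_add //; apply: leq_sum => i _; apply: prefix_ge; exact: ltn_ord.
move=> aN; have Ea : f a + g a = 4 * a + 3.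
  by have := pe _ aN; rewrite !sumfS pe ?(ltnW aN) //; lia.
have [u p] := prefix_sub aN.
have := sumn_uniq_eq u p; rewrite size_prefix sumn_prefix pe // base => /(_ (ltac:(lia))) /allP h.
have := h (f a); have := h (g a).
rewrite !mem_cat !map_f ?mem_iota ?orbT //= => /(_ isT) ? /(_ isT) ?; split=> //; lia.
Qed.

End Rearrangement.

Lemma sumf_mul a b F : sumf (a * b) F = sumf a (fun i => sumf b (fun j => F (i * b + j))).
Proof.
elim: a => [|a IH]; first by rewrite /sumf mul0n !big_nil.
rewrite sumfS -IH mulSn addnC /sumf (big_cat_nat (n := a * b)) ?leq_addr //=; congr addn.
rewrite -{1}[a * b]add0n big_addn addKn; apply: eq_bigr => j _; congr F; lia.
Qed.

(** * Weighted vertices as independent copies *)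

Section BlowUp.
Variables (B W : nat) (w : nat -> nat) (adj : rel nat).
Hypothesis adj_sym : symmetric adj.
Hypothesis adj_irr : irreflexive adj.
Hypothesis wW : forall b, b < B -> w b <= W.

(** Every block has [W] slots, of which the first [w b] are copies and the others isolated vertices.
    Equal slot numbers let quotient and remainder recover block and copy. *)
Definition live_copy (p : nat) : bool := p %% W < w (p %/ W).

Definition blow_edge (p q : nat) : bool :=
  [&& live_copy p, live_copy q & adj (p %/ W) (q %/ W)].

Lemma blow_edge_sym : symmetric (fun p q : 'I_(B * W) => blow_edge p q).
Proof. by move=> p q; rewrite /blow_edge adj_sym andbCA. Qed.

Lemma blow_edge_irr : irreflexive (fun p q : 'I_(B * W) => blow_edge p q).
Proof. by move=> p; rewrite /blow_edge adj_irr !andbF. Qed.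

Definition blow_up : sgraph := SGraph blow_edge_sym blow_edge_irr.

Definition block_colouring (c : nat -> nat) : Prop :=
  (forall b, 0 < c b) /\
  (forall b b', b < B -> b' < B -> 0 < w b -> 0 < w b' -> adj b b' -> c b <> c b').

Lemma sumf_split_ltn a b x y : a <= b ->
  sumf b (fun j => if j < a then x else y) = a * x + (b - a) * y.
Proof.
move=> ab; rewrite -{1}(subnKC ab) /sumf (big_cat_nat (n := a)) ?leq_addr //=; congr addn.
  rewrite (eq_big_nat _ _ (F2 := fun=> x)); first by rewrite sum_nat_const_nat subn0.
  by move=> i /andP[_ ->].
rewrite (eq_big_nat _ _ (F2 := fun=> y)); first by rewrite sum_nat_const_nat addKn.
by move=> i /andP[ai _]; rewrite ltnNge ai.
Qed.

(** The isolated slots take colour 1 and account for the additive constant. Conversely, each block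
    adopts the least colour among its copies; this is proper because the copies of adjacent blocks
    are completely joined. *)
Lemma blow_up_chromatic_sum k :
  (exists2 c : blow_up -> nat, colouring c &
     \sum_(v : blow_up) c v <= k + (B * W - sumf B w)) <->
  (exists2 c, block_colouring c & sumf B (fun b => w b * c b) <= k).
Proof.
have tot : sumf B (fun b => W - w b) = B * W - sumf B w.
  rewrite -[in RHS](addnK (sumf B w) (B * W)).
  have : sumf B (fun b => W - w b) + sumf B w = B * W.
    rewrite !sumfE -big_split /= (eq_bigr (fun=> W)); first by rewrite sum_nat_const card_ord.
    by move=> b _; rewrite subnK // wW.
  by lia.
have bW p : p < B * W -> (p %/ W < B) * (0 < W).
  move=> pB; have W0 : 0 < W by case: (W) pB; rewrite ?muln0.
  by rewrite ltn_divLR.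
split=> [[c [c0 cE] ck]|[c [c0 cE] ck]]; last first.
  exists (fun p : 'I_(B * W) => if live_copy p then c (p %/ W) else 1).
    split=> [p|p q /and3P[lp lq a]]; first by case: ifP.
    rewrite lp lq; apply: cE => //; try by have [] := bW _ (ltn_ord p); have [] := bW _ (ltn_ord q).
      exact: leq_ltn_trans lp.
    exact: leq_ltn_trans lq.
  rewrite -(sumfE (B * W) (fun p => if live_copy p then c (p %/ W) else 1)) sumf_mul.
  have -> : sumf B (fun i => sumf W (fun j => if live_copy (i * W + j) then c ((i * W + j) %/ W) else 1))
     = sumf B (fun b => w b * c b + (W - w b)).
    rewrite !sumfE; apply: eq_bigr => b _.
    rewrite -[W - w b]muln1 -(sumf_split_ltn _ _ (wW (ltn_ord b))) !sumfE.
    apply: eq_bigr => j _; have W0 := leq_ltn_trans (leq0n _) (ltn_ord j).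
    by rewrite /live_copy modnMDl modn_small // divnMDl // divn_small // addn0.
  have -> : sumf B (fun b => w b * c b + (W - w b)) = sumf B (fun b => w b * c b) + sumf B (fun b => W - w b).
    by rewrite !sumfE big_split.
  by rewrite tot leq_add2r.
pose c' p := if p < B * W =P true is ReflectT h then c (Ordinal h) else 1.
have c'E (p : 'I_(B * W)) : c' p = c p.
  rewrite /c'; case: eqP => [h|[]]; last exact: ltn_ord.
  by congr c; apply: val_inj.
have c'0 p : 0 < c' p by rewrite /c'; case: eqP.
(* The index type is written with a successor so that it is inhabited even for a block without
   copies. *)
pose best b := [arg min_(j < (ord0 : 'I_(w b).-1.+1) | true) c' (b * W + j)].
pose col b := c' (b * W + best b).
have best_lt b : 0 < w b -> best b < w b by move=> w0; apply: leq_trans (ltn_ord (best b)) _; rewrite prednK.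
have best_le b j : j < w b -> col b <= c' (b * W + j).
  move=> jw; rewrite /col /best; case: arg_minnP => // i _ /(_ (inord j) isT).
  by rewrite inordK // prednK //; apply: leq_ltn_trans jw.
have idx b j : b < B -> j < w b -> b * W + j < B * W.
  by move=> bB jw; apply: pair_index_lt => //; apply: leq_trans jw (wW bB).
exists col.
  split=> [b|b b' bB b'B w0 w0' a]; first exact: c'0.
  have h := idx _ _ bB (best_lt _ w0); have h' := idx _ _ b'B (best_lt _ w0').
  have [_ W0] := bW _ h.
  have jW : best b < W by apply: leq_trans (best_lt _ w0) (wW bB).
  have jW' : best b' < W by apply: leq_trans (best_lt _ w0') (wW b'B).
  rewrite /col -[b * W + _]/(val (Ordinal h)) -[b' * W + _]/(val (Ordinal h')) !c'E; apply: cE.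
  rewrite /= /blow_edge /live_copy /= !modnMDl !divnMDl // !(modn_small, divn_small) // !addn0.
  by rewrite !best_lt.
rewrite -(leq_add2r (B * W - sumf B w)); apply: leq_trans ck.
rewrite (eq_bigr (fun p : 'I_(B * W) => c' p)) => [|p _]; last by rewrite c'E.
rewrite -(sumfE (B * W) c') sumf_mul -tot !sumfE -big_split /=; apply: leq_sum => b _.
rewrite -[W - w b]muln1 -(sumf_split_ltn _ _ (wW (ltn_ord b))) !sumfE.
by apply: leq_sum => j _; case: ltnP => // jw; apply: best_le.
Qed.

End BlowUp.

Lemma sumfD n f g : sumf n (fun i => f i + g i) = sumf n f + sumf n g.
Proof. by rewrite !sumfE big_split. Qed.

Lemma sumf_mull n c f : sumf n (fun i => c * f i) = c * sumf n f.
Proof. by rewrite !sumfE big_distrr. Qed.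

Lemma sumf_const n c : sumf n (fun=> c) = n * c.
Proof. by rewrite sumfE sum_nat_const card_ord. Qed.

Lemma eq_sumf n f g : (forall i, i < n -> f i = g i) -> sumf n f = sumf n g.
Proof. by move=> H; rewrite !sumfE; apply: eq_bigr => i _; apply: H. Qed.

Lemma leq_sumf n f g : (forall i, i < n -> f i <= g i) -> sumf n f <= sumf n g.
Proof. by move=> H; rewrite !sumfE; apply: leq_sum => i _; apply: H. Qed.

Lemma sumf_exchange n m f :
  sumf n (fun i => sumf m (f i)) = sumf m (fun j => sumf n (fun i => f i j)).
Proof.
rewrite !sumfE (eq_bigr (fun i : 'I_n => \sum_(j < m) f i j)) => [|i _]; last by rewrite sumfE.
by rewrite exchange_big; apply: eq_bigr => j _; rewrite sumfE.
Qed.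

(* The graph has [n ^ 2] components and one row of rulers. Component [e], that is, the pair
   [(i, j) = (e %/ n, e %% n)], consists of a clique of [levels] cores and, when [i < j] are in
   conflict, of two satellites inducing the path [core i - core j - c - d] with [core i] and
   [core j] and adjacent to all other cores. Rulers are adjacent to everything. *)
Section Construction.
Variables (n m : nat) (conf : rel nat).

(** The first [n] levels are the vertices of the conflict graph. The [n ^ 3] further ones lift
    [weight_d] of an active pair to at least [ruler_excess]. *)
Definition levels : nat := n ^ 3 + n.
(** The sum of all [weight_c] is at most [n ^ 3], so one colour step of one ruler outweighs that
    whole slack. *)
Definition ruler_excess : nat := (n ^ 3).+1.

Definition active (e : nat) : bool := (e %/ n < e %% n) && conf (e %/ n) (e %% n).
Definition weight_c (e : nat) : nat := if active e then e %% n - e %/ n else 0.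
Definition weight_d (e : nat) : nat := if active e then levels - e %/ n else 0.

Definition pair_cost (e : nat) : nat :=
  weight_d e * (2 * (e %/ n) + 1) + weight_c e * (2 * levels + 1).

(* [unit_weight] exceeds all lower order costs, so that the cores and rulers of level [a] must take
   the colours [2 * a + 1] and [2 * a + 2]. *)
Definition small_bound : nat :=
  ruler_excess * (sumf levels (fun a => 2 * a + 2) - (m + n ^ 3)) +
  sumf (n ^ 2) pair_cost + sumf (n ^ 2) weight_c.

Definition unit_weight : nat := small_bound.+1.

(** A ruler carries the factor [n ^ 2] because it is paired with a core in each of the [n ^ 2]
    components. *)
Definition weight (e a : nat) : nat :=
  if e < n ^ 2 then
    if a < levels then unit_weight * (levels - a)
    else if a == levels then weight_c e else weight_d e
  else if a < levels then unit_weight * (n ^ 2 * (levels - a)) + ruler_excess else 0.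

Definition max_weight : nat := unit_weight * (n ^ 2 * levels) + ruler_excess.

Definition threshold : nat :=
  unit_weight * (n ^ 2 * sumf levels (fun a => (levels - a) * (4 * a + 3))) + small_bound.

Definition separated (e a a' : nat) : bool :=
  (a == levels) && (a' == e %/ n) ||
  (a == levels.+1) && ((a' == e %/ n) || (a' == e %% n)).

Definition block_adj (b b' : nat) : bool :=
  let e := b %/ levels.+2 in let a := b %% levels.+2 in
  let e' := b' %/ levels.+2 in let a' := b' %% levels.+2 in
  if (e == n ^ 2) || (e' == n ^ 2) then (e != e') || (a != a')
  else [&& e == e', a != a', ~~ separated e a a' & ~~ separated e a' a].

Definition block_weight (b : nat) : nat := weight (b %/ levels.+2) (b %% levels.+2).

Definition block_count : nat := (n ^ 2).+1 * levels.+2.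

Lemma block_adj_sym : symmetric block_adj.
Proof.
move=> b b'; rewrite /block_adj.
move: (b %/ _) (b %% _) (b' %/ _) (b' %% _) => e a e' a'.
rewrite orbC (eq_sym e e') (eq_sym a a'); case: ifP => // _.
by case: (eqVneq e' e) => [->|] //=; congr andb; apply: andbC.
Qed.

Lemma block_adj_irr : irreflexive block_adj.
Proof. by move=> b; rewrite /block_adj !eqxx /= orbb; case: ifP. Qed.

Hypothesis n0 : 0 < n.
Hypothesis mn : m <= n.

Lemma block_weight_le b : b < block_count -> block_weight b <= max_weight.
Proof.
move=> _; rewrite /block_weight /weight /max_weight.
have K0 : 0 < n ^ 2 by rewrite expn_gt0 n0.
set e := b %/ _; set a := b %% _.
have U : forall x, x <= levels -> x <= unit_weight * (n ^ 2 * levels) + ruler_excess.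
  by move=> x xl; rewrite /unit_weight; nia.
case: ifP => _; case: ifP => al //.
- have : levels - a <= n ^ 2 * levels by nia.
  by move=> h; apply: leq_trans (leq_addr _ _); rewrite leq_mul2l h orbT.
- case: ifP => _; apply: U; rewrite /weight_c /weight_d; case: ifP => // _.
    by rewrite (leq_trans (leq_subr _ _)) // (leq_trans (ltnW (ltn_pmod _ n0))) ?leq_addl.
  by rewrite leq_subr.
- by rewrite leq_add2r leq_mul2l leq_mul2l leq_subr !orbT.
Qed.

Lemma divblock e a : a < levels.+2 -> (e * levels.+2 + a) %/ levels.+2 = e.
Proof. by move=> al; rewrite divnMDl // divn_small ?addn0. Qed.

Lemma modblock e a : a < levels.+2 -> (e * levels.+2 + a) %% levels.+2 = a.
Proof. by move=> al; rewrite modnMDl modn_small. Qed.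

Definition small_cost (col : nat -> nat -> nat) : nat :=
  sumf (n ^ 2) (fun e => weight_c e * col e levels + weight_d e * col e levels.+1) +
  ruler_excess * sumf levels (col (n ^ 2)).

(** Distributing the weight of each ruler over the components turns the leading part into a sum of
    terms of the shape treated by [rearrangement_ge]. *)
Lemma block_cost (c : nat -> nat) (col := fun e a => c (e * levels.+2 + a)) :
  sumf block_count (fun b => block_weight b * c b) =
  unit_weight * sumf (n ^ 2) (fun e =>
     sumf levels (fun a => (levels - a) * (col e a + col (n ^ 2) a))) + small_cost col.
Proof.
rewrite /block_count sumf_mul sumfS.
rewrite (eq_sumf (g := fun e => unit_weight * sumf levels (fun a => (levels - a) * col e a) +
    (weight_c e * col e levels + weight_d e * col e levels.+1))); last first.
  move=> e eK; rewrite !sumfS -addnA /block_weight !(divblock, modblock) //.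
  rewrite /weight eK !ltnn eqxx ltnNge leqnSn /= (_ : (levels.+1 == levels) = false); last first.
    by rewrite eqn_leq ltnn.
  congr (_ + _); rewrite -sumf_mull; apply: eq_sumf => a al.
  have al2 : a < levels.+2 by rewrite ltnW // ltnW.
  by rewrite divblock // modblock // eK al mulnA.
rewrite (eq_sumf (n := levels.+2)
   (g := fun a => if a < levels then (unit_weight * (n ^ 2 * (levels - a)) + ruler_excess) * col (n ^ 2) a else 0));
   last first.
  move=> a al; rewrite /block_weight divblock // modblock // /weight ltnn.
  by case: ifP; rewrite ?mul0n.
rewrite !sumfS !ltnn [levels.+1 < _]ltnNge leqnSn /= !addn0.
rewrite (eq_sumf (n := levels) (g := fun a => unit_weight * (n ^ 2 * ((levels - a) * col (n ^ 2) a)) +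
   ruler_excess * col (n ^ 2) a)); last first.
  by move=> a ->; rewrite mulnDl !mulnA.
rewrite /small_cost; move: unit_weight ruler_excess => u r.
rewrite !sumfD !sumf_mull.
rewrite (eq_sumf (n := n ^ 2)
   (f := fun e => sumf levels (fun a => (levels - a) * (col e a + col (n ^ 2) a)))
   (g := fun e => sumf levels (fun a => (levels - a) * col e a) +
   sumf levels (fun a => (levels - a) * col (n ^ 2) a))); last first.
  by move=> e _; rewrite -sumfD; apply: eq_sumf => a _; rewrite mulnDr.
rewrite sumfD sumf_const mulnDr.
set x1 := sumf (n ^ 2) (fun _ => sumf _ _); set x2 := sumf levels (fun _ => _ * _); lia.
Qed.

Lemma block_colouring_rulers c (col := fun e a => c (e * levels.+2 + a)) :
  block_colouring block_count block_weight block_adj c ->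
  [/\ forall e a, 0 < col e a,
      forall e a a', a < levels -> e <= n ^ 2 -> a' < levels.+2 -> (e, a') != (n ^ 2, a) ->
        0 < weight e a' -> col e a' <> col (n ^ 2) a &
      forall e a a', e < n ^ 2 -> a < levels.+2 -> a' < levels.+2 -> a != a' ->
        ~~ separated e a a' -> ~~ separated e a' a -> 0 < weight e a -> 0 < weight e a' ->
        col e a <> col e a'].
Proof.
case=> c0 cE.
have idx e a : e <= n ^ 2 -> a < levels.+2 -> e * levels.+2 + a < block_count.
  by move=> eK al; apply: pair_index_lt.
have wr a : a < levels -> 0 < weight (n ^ 2) a.
  by move=> al; rewrite /weight ltnn al addn_gt0 orbT.
split=> [e a|e a a' al eK al' ne w0|e a a' eK al al' ne s1 s2 w1 w2]; first exact: c0.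
  have al2 : a < levels.+2 by rewrite ltnW // ltnW.
  apply: cE; rewrite ?idx // /block_weight /block_adj ?divblock ?modblock ?wr //.
  by rewrite eqxx orbT; move: ne; rewrite xpair_eqE negb_and.
have eK' := ltnW eK.
apply: cE; rewrite ?idx // /block_weight /block_adj ?divblock ?modblock //.
by rewrite (_ : (e == n ^ 2) = false) ?eqxx ?ne ?s1 ?s2 //; apply/negbTE; rewrite neq_ltn eK.
Qed.

End Construction.

(** The origin of the weights [j - i] of the satellite [c] and [l - i] of [d]. If cores [i] and [j]
    have colours [2 * i + 1] and [2 * j + 1], then colouring [c] like core [i] and [d] like core [j]
    costs the same as giving [c] the fresh colour [2 * l + 1] and [d] the colour of core [i]; this
    is [pair_cost]. Raising only core [j] leaves the second option at that cost; raising only core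
    [i] adds [j - i] to the first. Raising both adds at least [l - i] to either. *)
Lemma balance i j l : i <= j -> i <= l ->
  (l - i) * (2 * j + 1) + (j - i) * (2 * i + 1) = (l - i) * (2 * i + 1) + (j - i) * (2 * l + 1).
Proof. by move=> /subnKC <- /subnKC <-; rewrite !addKn; lia. Qed.

Section Core.
Variables (n m : nat) (conf : rel nat).
Hypothesis n0 : 0 < n.
Hypothesis mn : m <= n.
Notation L := (levels n).
Notation K := (n ^ 2).

Definition independent_choice (I : pred nat) : Prop :=
  (forall i j, i < j -> j < n -> I i -> I j -> ~~ conf i j) /\ m <= sumf n I.

Let nL : n <= L. Proof. exact: leq_addl. Qed.

Let sum_weight_c : sumf K (weight_c n conf) <= n ^ 3.
Proof.
rewrite (_ : n ^ 3 = sumf K (fun=> n)); last by rewrite sumf_const expnSr.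
apply: leq_sumf => e _; rewrite /weight_c; case: ifP => // _.
by rewrite (leq_trans (leq_subr _ _)) // ltnW // ltn_mod.
Qed.

Let levels_le : L <= sumf L (fun a => 2 * a + 2).
Proof.
have := @leq_sumf L (fun=> 1) (fun a => 2 * a + 2); rewrite sumf_const muln1; apply=> a _; lia.
Qed.

(** Once the leading part of the cost is tight, the rest shows that the levels whose ruler takes the
    lower colour number at least [m + n ^ 3] plus the violated conflicts; repairing the violations
    leaves a choice of size [m]. *)
Lemma choice_of_colouring (c : nat -> nat) :
  block_colouring (block_count n) (block_weight n m conf) (block_adj n) c ->
  sumf (block_count n) (fun b => block_weight n m conf b * c b) <= threshold n m conf ->
  exists I, independent_choice I.
Proof.
move=> Hc; rewrite block_cost //.
have := block_colouring_rulers Hc; set col := (fun e a => c (e * L.+2 + a)).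
case=> p0 pr pc.
have w_core e a : e < K -> a < L -> 0 < weight n m conf e a.
  by move=> eK al; rewrite /weight eK al muln_gt0 subn_gt0 al.
have w_ruler a : a < L -> 0 < weight n m conf K a.
  by move=> al; rewrite /weight ltnn al addn_gt0 orbT.
have lt2 a : a < L -> a < L.+2 by move=> al; rewrite ltnW // ltnW.
have nsep e a a' : a < L -> separated n e a a' = false.
  by move=> al; rewrite /separated (ltn_eqF al) (@ltn_eqF a L.+1) // ltnW.
have core_core e a a' : e < K -> a < L -> a' < L -> a <> a' -> col e a <> col e a'.
  move=> eK al al' /eqP ne; apply: pc; rewrite ?nsep ?lt2 ?w_core //.
have core_ruler e a a' : e < K -> a < L -> a' < L -> col e a' <> col K a.
  move=> eK al al'; apply: pr; rewrite ?lt2 ?w_core ?(ltnW eK) //.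
  by rewrite xpair_eqE ltn_eqF.
have ruler_ruler a a' : a < L -> a' < L -> a <> a' -> col K a' <> col K a.
  move=> al al' ne; apply: pr; rewrite ?lt2 ?w_ruler //.
  by rewrite xpair_eqE eqxx /=; apply/eqP => h; apply: ne.
have uq e : e < K -> uniq ([seq col e a | a <- iota 0 L] ++ [seq col K a | a <- iota 0 L]).
  move=> eK; rewrite cat_uniq !map_inj_in_uniq ?iota_uniq /= ?andbT.
  - apply/hasP => -[x /mapP[a + ->] /mapP[a' + E]]; rewrite !mem_iota => al al'.
    exact: (core_ruler e a a').
  - move=> a a'; rewrite !mem_iota => al al' E; apply/eqP/negPn/negP => /eqP ne.
    by apply: (ruler_ruler a' a) => //; apply/nesym.
  - move=> a a'; rewrite !mem_iota => al al' E; apply/eqP/negPn/negP => /eqP ne.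
    by apply: (core_core e a a').
have ps e : all (leq 1) ([seq col e a | a <- iota 0 L] ++ [seq col K a | a <- iota 0 L]).
  by apply/allP => x; rewrite mem_cat => /orP[] /mapP[a _ ->]; apply: p0.
pose X e := sumf L (fun a => (L - a) * (col e a + col K a)).
set X0 := sumf L (fun a => (L - a) * (4 * a + 3)).
have XX e : e < K -> X0 <= X e by move=> eK; apply: rearrangement_ge; auto.
rewrite -[sumf K _]/(sumf K X) /threshold -/X0 /unit_weight.
set A := small_bound n m conf; set S := small_cost n conf col => cost.
have SX : K * X0 <= sumf K X by rewrite -sumf_const; apply: leq_sumf.
(* One unit of excess in the leading part would cost [unit_weight], more than everything that the
   threshold leaves for the rest. *)
have SX' : sumf K X <= K * X0.
  rewrite leqNgt; apply/negP => h.
  by have := leq_mul (leqnn A.+1) h; rewrite mulnS; move: cost; clearbody A X0 S; lia.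
have EX : sumf K X = K * X0 by apply/eqP; rewrite eqn_leq SX' SX.
have SA : S <= A by move: cost; rewrite EX leq_add2l.
have XE e : e < K -> X e <= X0.
  move=> eK; rewrite leqNgt; apply/negP => h.
  move: SX'; rewrite leqNgt => /negP[]; rewrite -sumf_const !sumfE.
  rewrite (bigD1 (Ordinal eK)) //= [ltnRHS](bigD1 (Ordinal eK)) //=.
  by rewrite -addSn leq_add //; apply: leq_sum => i _; apply: XX.
have colE e a : e < K -> a < L -> col e a + col K a = 4 * a + 3 /\ 2 * a + 1 <= col K a <= 2 * a + 2.
  by move=> eK al; apply: (rearrangement_eq (uq e eK) (ps e)) al; apply: XE.
pose closed a := col K a == 2 * a + 1.
pose s a := 4 * a + 3 - col K a.
have K0 : 0 < K by rewrite expn_gt0 n0.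
(* The rulers are shared, so the order chosen at a level is the same in all components. *)
have coreE e a : e < K -> a < L -> col e a = s a.
  by move=> eK al; have [h _] := colE e a eK al; rewrite /s; lia.
have sE a : a < L -> s a = 2 * a + 1 + closed a.
  by move=> al; have [_ h] := colE 0 a K0 al; rewrite /s /closed; case: eqP; lia.
have colK a : a < L -> col K a + closed a = 2 * a + 2.
  by move=> al; have [_ h] := colE 0 a K0 al; rewrite /closed; case: eqP; lia.
(* In each component the cores and rulers use up the colours 1 to [2 * L]. A satellite must repeat
   the colour of a core it is separated from, or exceed [2 * L]. *)
have value v : 0 < v -> v <= 2 * L -> exists2 a, a < L & v = s a \/ v = col K a.
  move=> v0 vL; exists (v.-1 %/ 2); first by lia.
  have aL : v.-1 %/ 2 < L by lia.
  by have := sE _ aL; have := colK _ aL; case: (closed _) => /=; lia.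
have LS : (L.+1 < L) = false by rewrite ltnNge leqnSn.
have LE : (L.+1 == L) = false by rewrite eqn_leq ltnn.
have LE' : (L == L.+1) = false by rewrite eq_sym.
pose viol e := [&& active n conf e, closed (e %/ n) & closed (e %% n)].
have cost_e e : e < K -> pair_cost n conf e + viol e * ruler_excess n <=
    weight_c n conf e * col e L + weight_d n conf e * col e L.+1.
  move=> eK; rewrite /pair_cost /viol /weight_c /weight_d; case: (boolP (active n conf e)) => // act.
  have [ij _] := andP act; set i := e %/ n in ij *; set j := e %% n in ij *.
  have jn : j < n by rewrite ltn_mod.
  have jL : j < L by apply: leq_trans nL. have iL : i < L by apply: ltn_trans jL.
  have in_ : i < n by apply: ltn_trans jn.
  have wc0 : 0 < weight n m conf e L by rewrite /weight eK ltnn eqxx /weight_c act subn_gt0.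
  have wd0 : 0 < weight n m conf e L.+1.
    by rewrite /weight eK LS LE /weight_d act subn_gt0.
  have sat x : x < L.+2 -> L <= x -> 0 < weight n m conf e x ->
      col e x <= 2 * L -> exists a, [/\ a < L, col e x = s a & separated n e x a].
    move=> x2 xL wx xv; have [a aL [E|E]] := value _ (p0 e x) xv; last first.
      case: (pr e a x aL (ltnW eK) x2 _ wx E).
      by rewrite xpair_eqE ltn_eqF.
    exists a; split=> //; apply/negPn/negP => ns.
    apply: (pc e x a eK x2 (lt2 _ aL) _ ns _ wx (w_core _ _ eK aL)).
    - by rewrite eq_sym ltn_eqF //; apply: leq_trans xL.
    - by rewrite nsep.
    - exact: etrans E (esym (coreE _ _ eK aL)).
  have ci : col e L = s i \/ 2 * L < col e L.
    case: (leqP (col e L) (2 * L)) => h; [left|by right].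
    have [a [aL -> ]] := sat L (leqnSn _) (leqnn _) wc0 h.
    by rewrite /separated eqxx LE' /= orbF => /eqP ->.
  have dij : [\/ col e L.+1 = s i, col e L.+1 = s j | 2 * L < col e L.+1].
    case: (leqP (col e L.+1) (2 * L)) => h; last by constructor 3.
    have [a [aL -> ]] := sat L.+1 (leqnn _) (leqnSn _) wd0 h.
    rewrite /separated eqxx LE /= => /orP[] /eqP ->.
      by constructor 1.
    by constructor 2.
  have cd : col e L <> col e L.+1.
    apply: pc => //; rewrite ?LE' // /separated eqxx ?LE ?LE' /=.
      by rewrite orbF eq_sym ltn_eqF // ltnW.
    by rewrite ![L == _]eq_sym !ltn_eqF.
  have := sE _ iL; have := sE _ jL; move: (s i) (s j) ci dij cd (closed i) (closed j).
  move: (col e L) (col e L.+1) => x y si sj ci dij cd bi bj sjE siE.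
  have wdr : ruler_excess n <= L - i by rewrite /ruler_excess /levels; lia.
  have key := balance (ltnW ij) (ltnW iL).
  have wdr' : bi && bj -> ruler_excess n <= L - i by [].
  have vD : (bi && bj) * ruler_excess n <= (bi && bj) * (L - i) by rewrite leq_mul2l wdr orbT.
  have xsi : si <= x by case: ci; lia.
  apply: leq_trans (leq_add (leqnn _) vD) _.
  have mono p q r : p <= q -> r * p <= r * q by move=> h; rewrite leq_mul2l h orbT.
  (* By the colour of the satellite [d]: that of core [i], which pushes [c] above [2 * L]; that of
     core [j]; or one above [2 * L]. The first two are the options of [balance]. *)
  case: dij => [yE|yE|yL].
  - have xL : 2 * L < x by case: ci => // xE; case: cd; rewrite xE.
    have h1 := mono (2 * L + 1) x (j - i) (ltac:(lia)).
    have h2 : (bi && bj) * (L - i) <= bi * (L - i) by case: (bi); case: (bj).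
    have h3 : (L - i) * y = (L - i) * (2 * i + 1) + bi * (L - i) by rewrite yE siE; case: (bi); lia.
    lia.
  - have h1 := mono (2 * i + 1) x (j - i) (ltac:(lia)).
    have h2 : (bi && bj) * (L - i) <= bj * (L - i) by case: (bi); case: (bj).
    have h3 : (L - i) * y = (L - i) * (2 * j + 1) + bj * (L - i) by rewrite yE sjE; case: (bj); lia.
    lia.
  - have h1 := mono (2 * i + 1) x (j - i) (ltac:(lia)).
    have h2 := mono (2 * j + 2) y (L - i) (ltac:(lia)).
    have h3 : (bi && bj) * (L - i) <= L - i by case: (bi && bj); lia.
    lia.
pose C := sumf L closed; pose V := sumf K viol.
have [CL VK] : C <= L /\ m + n ^ 3 <= L.
  split; last by rewrite /levels; lia.
  have := @leq_sumf L closed (fun=> 1); rewrite sumf_const muln1; apply=> a _; exact: leq_b1.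
set S2 := sumf L (fun a => 2 * a + 2); have S2L : L <= S2 := levels_le.
have hK : sumf L (col K) + C = S2 by rewrite /C -sumfD; apply: eq_sumf => a /colK.
have hcost : sumf K (pair_cost n conf) + V * ruler_excess n <=
    sumf K (fun e => weight_c n conf e * col e L + weight_d n conf e * col e L.+1).
  rewrite mulnC /V -sumf_mull -sumfD; apply: leq_sumf => e eK.
  by rewrite mulnC; apply: cost_e.
(* Otherwise violations and rulers overrun their budget by a full [ruler_excess], which the slack of
   at most [n ^ 3] cannot absorb. *)
have VC : V + m + n ^ 3 <= C.
  move: SA; rewrite /S /A /small_cost /small_bound -/S2.
  move: hcost sum_weight_c; set Q := sumf K (fun e => _ * _ + _); set P := sumf K (pair_cost n conf).
  set R := sumf K (weight_c n conf); rewrite /ruler_excess.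
  have -> : sumf L (col K) = S2 - C by lia.
  clear hK; move: (n ^ 3) P Q R VK => r P Q R VK h1 h2 h3.
  rewrite leqNgt; apply/negP => h4.
  have h5 : V + (S2 - C) >= (S2 - (m + r)).+1 by lia.
  have h6 := leq_mul (leqnn r.+1) h5.
  by move: h6; rewrite mulnDr mulnS; lia.
(* The smaller end of every violated conflict is given up, at most one level per violation. *)
pose chosen a := closed a && ~~ hasf K (fun e => viol e && (e %/ n == a)).
exists chosen; split=> [i j ij jn|].
  move=> /andP[ci /hasfP no] /andP[cj _]; apply/negP => cij; case: no.
  have in_ := ltn_trans ij jn.
  exists (i * n + j); first by rewrite -mulnn; apply: pair_index_lt.
  have E1 : (i * n + j) %/ n = i by rewrite divnMDl // divn_small ?addn0.
  have E2 : (i * n + j) %% n = j by rewrite modnMDl modn_small.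
  by rewrite /viol /active E1 E2 ij cij ci cj eqxx.
have hC : C <= sumf n closed + n ^ 3.
  rewrite /C /sumf (big_cat_nat (n := n)) //= leq_add2l.
  apply: (@leq_trans (\sum_(n <= i < L) 1)); first by apply: leq_sum => i _; apply: leq_b1.
  by rewrite sum_nat_const_nat muln1 /levels addnK.
have hV : sumf n (fun a => hasf K (fun e => viol e && (e %/ n == a))) <= V.
  apply: (@leq_trans (sumf n (fun a => sumf K (fun e => viol e * (e %/ n == a))))).
    apply: leq_sumf => a _; case: hasfP => // -[e eK /andP[ve ea]].
    by rewrite sumfE (bigD1 (Ordinal eK)) //= ve ea.
  rewrite sumf_exchange; apply: leq_sumf => e _; rewrite sumf_mull -[leqRHS]muln1 leq_mul2l.
  apply/orP; right; rewrite (eq_sumf (g := fun a => (a < (e %/ n).+1) - (a < e %/ n))); last first.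
    by move=> a _; case: (ltngtP a (e %/ n)); lia.
  have : sumf n (fun a => (a < (e %/ n).+1) - (a < e %/ n)) + sumf n (fun a => a < e %/ n) = 
      sumf n (fun a => a < (e %/ n).+1).
    by rewrite -sumfD; apply: eq_sumf => a _; case: ltngtP; lia.
  by rewrite !sumf_ltn; lia.
have : sumf n closed <= sumf n chosen + sumf n (fun a => hasf K (fun e => viol e && (e %/ n == a))).
  by rewrite -sumfD; apply: leq_sumf => a _; rewrite /chosen; case: (closed a); case: (hasf _ _).
by lia.
Qed.

Lemma colouring_of_choice I : independent_choice I ->
  exists2 c, block_colouring (block_count n) (block_weight n m conf) (block_adj n) c &
    sumf (block_count n) (fun b => block_weight n m conf b * c b) <= threshold n m conf.
Proof.
case=> indI mI; pose closed a := (n <= a) || I a.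
pose s a := 2 * a + 1 + closed a; pose r a := 2 * a + 2 - closed a.
(* The satellites follow the cheaper option of [balance]: if level [i] is closed, [c] copies core
   [i] and [d] copies core [j]; otherwise [c] takes [2 * L + 1] and [d] copies core [i]. *)
pose col e a := if e == K then (if a < L then r a else 1) else
  if a < L then s a else
  if a == L then (if closed (e %/ n) then s (e %/ n) else 2 * L + 1)
  else (if closed (e %/ n) then s (e %% n) else s (e %/ n)).
have sE a : 2 * a + 1 <= s a <= 2 * a + 2 by rewrite /s; case: (closed _); lia.
have rsE a : r a + s a = 4 * a + 3 by rewrite /s /r; case: (closed a); lia.
have jL e : e %% n < L by apply: leq_trans nL; rewrite ltn_mod.
have iL e : e < K -> e %/ n < L by move=> eK; apply: leq_trans nL; rewrite ltn_divLR // mulnn.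
have s_inj a a' : a <> a' -> s a <> s a' by have := sE a; have := sE a'; lia.
have rs a a' : r a <> s a'.
  by have := sE a; have := sE a'; have := rsE a; case: (eqVneq a a') => [<-|/eqP ne]; lia.
have r_inj a a' : a <> a' -> r a <> r a'.
  by have := sE a; have := sE a'; have := rsE a; have := rsE a'; lia.
have w_ruler a : 0 < weight n m conf K a -> a < L by rewrite /weight ltnn; case: ifP.
have w_sat e a : e < K -> L <= a -> 0 < weight n m conf e a -> active n conf e.
  move=> eK La; rewrite /weight eK [a < L]ltnNge La /= /weight_c /weight_d.
  by case: ifP => _; case: (active n conf e).
have valC e a : e < K -> (exists2 x, x < L & col e a = s x) \/ col e a = 2 * L + 1.
  move=> eK; rewrite /col ltn_eqF //; case: ifP => al; first by left; exists a.
  case: ifP => _; case: ifP => _; try by right.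
  - by left; exists (e %/ n) => //; apply: iL.
  - by left; exists (e %% n).
  - by left; exists (e %/ n) => //; apply: iL.
have ruler e a a' : e < K -> a < L -> col K a <> col e a'.
  move=> eK al; rewrite {1}/col eqxx al.
  by case: (valC e a' eK) => [[x _ ->]|->]; [apply: rs | have := sE a; have := rsE a; lia].
have inside e a a' : e < K -> a < a' -> a' < L.+2 -> ~~ separated n e a' a ->
    0 < weight n m conf e a' -> col e a <> col e a'.
  move=> eK aa' a'l ns wa'; rewrite /col ltn_eqF //.
  case: (ltnP a' L) => a'L; first by rewrite (ltn_trans aa' a'L); apply: s_inj; lia.
  have [ij _] := andP (w_sat _ _ eK a'L wa').
  case: (ltnP a L) => aL.
    move: ns; rewrite /separated; case: (eqVneq a' L) => [->|ne].
      rewrite [L == L.+1]ltn_eqF //= orbF => ai.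
      by case: ifP => _; [apply: s_inj; apply/eqP | have := sE a; lia].
    have -> : a' = L.+1 by move/eqP: ne; lia.
    rewrite eqxx /= negb_or => /andP[/eqP ai /eqP aj].
    by case: ifP => _; apply: s_inj.
  have -> : a = L by lia. have -> : a' = L.+1 by lia.
  rewrite eqxx [L.+1 == L]eq_sym [L == L.+1]ltn_eqF //=.
  case: ifP => _; first by apply: s_inj; lia.
  by have := sE (e %/ n); have := iL _ eK; lia.
exists (fun b => col (b %/ L.+2) (b %% L.+2)).
  split=> [b|b b'].
    have s0 a : 0 < s a by rewrite /s addn1.
    have r0 a : 0 < r a by rewrite /r; case: (closed a); lia.
    rewrite /col; case: ifP => _; case: ifP => _ //.
    by case: ifP => _; case: ifP => _ //; rewrite addn1.
  rewrite /block_weight /block_adj => /= bB b'B.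
  have eK : b %/ L.+2 <= K by rewrite -ltnS ltn_divLR.
  have e'K : b' %/ L.+2 <= K by rewrite -ltnS ltn_divLR.
  have al : b %% L.+2 < L.+2 by rewrite ltn_mod.
  have a'l : b' %% L.+2 < L.+2 by rewrite ltn_mod.
  move: (b %/ _) (b %% _) (b' %/ _) (b' %% _) eK e'K al a'l => e a e' a' eK e'K al a'l w0 w0'.
  case: (eqVneq e K) => [E|ne] /=.
    subst e; have aL := w_ruler _ w0.
    case: (eqVneq e' K) => [E|ne'] h.
      subst e'; have a'L := w_ruler _ w0'; move: h; rewrite ?eqxx /= => /eqP h.
      by rewrite /col eqxx aL a'L; apply: r_inj.
    by apply: ruler => //; rewrite ltn_neqAle ne'.
  have eK' : e < K by rewrite ltn_neqAle ne.
  case: (eqVneq e' K) => [E|ne'] h /=.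
    by subst e'; have a'L := w_ruler _ w0'; apply/nesym/ruler.
  case/and4P: h => /eqP E aa ns1 ns2; subst e'.
  by case: (ltngtP a a') aa => // lt _; [|apply/nesym]; apply: inside.
rewrite block_cost //.
have colE e a : a < L.+2 -> col ((e * L.+2 + a) %/ L.+2) ((e * L.+2 + a) %% L.+2) = col e a.
  by move=> al; rewrite divblock // modblock.
have lt2 a : a < L -> a < L.+2 by move=> aL; rewrite ltnW // ltnW.
rewrite /threshold leq_add //.
  rewrite leq_mul2l; apply/orP; right; rewrite -[leqRHS]sumf_const.
  apply: leq_sumf => e eK; apply: eq_leq; apply: eq_sumf => a aL; rewrite !colE ?lt2 //.
  by rewrite /col eqxx aL ltn_eqF // addnC rsE.
rewrite /small_cost /small_bound addnC -addnA; apply: leq_add.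
  rewrite leq_mul2l; apply/orP; right.
  rewrite (eq_sumf (g := r)); last first.
    by move=> a aL; rewrite colE ?lt2 // /col eqxx aL.
  have hr : sumf L r + sumf L closed = sumf L (fun a => 2 * a + 2).
    by rewrite -sumfD; apply: eq_sumf => a _; rewrite /r; case: (closed a); lia.
  have hc : m + n ^ 3 <= sumf L closed.
    rewrite /sumf (big_cat_nat (n := n)) //=; apply: leq_add.
      by apply: leq_trans mI _; apply: leq_sumf => a _; rewrite /closed; case: (I a); rewrite ?orbT.
    rewrite -[n ^ 3](addnK n) -[_ - n]muln1 -sum_nat_const_nat.
    rewrite big_nat_cond [leqRHS]big_nat_cond.
    by apply: leq_sum => a /andP[/andP[na _] _]; rewrite /closed na.
  by rewrite -hr; lia.
rewrite -sumfD; apply: leq_sumf => e eK.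
rewrite !colE // /pair_cost /col [e == K]ltn_eqF // ltnn eqxx ltnNge leqnSn /= [L.+1 == L]eq_sym [L == L.+1]ltn_eqF //=.
rewrite /weight_c /weight_d; case: (boolP (active n conf e)) => // /andP[ij cij].
have key := balance (ltnW ij) (ltnW (iL _ eK)).
case: ifP => ci; last first.
  by rewrite /s ci addn0; lia.
have cj : closed (e %% n) = false.
  apply/negbTE/negP; rewrite /closed => cj.
  have jn : e %% n < n by rewrite ltn_mod.
  move: ci cj; rewrite /closed (leqNgt n (e %% n)) jn /= (leqNgt n (e %/ n)) (ltn_trans ij jn) /= => h1 h2.
  by have := indI _ _ ij jn h1 h2; rewrite cij.
by rewrite /s ci cj; move: key; lia.
Qed.

End Core.

(** * Clique-width of the construction *)

Section Built.
Variable T : finType.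

(** The relation is a parameter because intermediate stages have fewer edges than the target
    graph. *)
Definition built (R : rel T) (A : {set T}) (lab : T -> 'I_3) : Prop :=
  exists (e : cwexpr 3) (f : cweval e -> T),
    [/\ injective f, forall x, (x \in A) = [exists y, f y == x],
        forall x y, sedge x y = R (f x) (f y) & forall x, label x = lab (f x)].

Lemma built_ext (R R' : rel T) A lab lab' : built R A lab ->
  (forall x y, x \in A -> y \in A -> R x y = R' x y) ->
  (forall x, x \in A -> lab x = lab' x) -> built R' A lab'.
Proof.
case=> e [f [fi fA fE fl]] HR Hl; exists e, f.
have inA y : f y \in A by rewrite fA; apply/existsP; exists y.
by split=> // [x y|x]; rewrite ?fE ?fl; [apply: HR | apply: Hl].
Qed.

Lemma built_vertex (R : rel T) x lab : ~~ R x x -> built R [set x] lab.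
Proof.
move=> Rx; exists (CWVertex (lab x)), (fun=> x); split=> //.
- by case; case.
- move=> y; rewrite inE; apply/eqP/existsP => [->|[z /eqP]]; [by exists tt | by move=> ->].
- by move=> x1 x2; rewrite (negbTE Rx).
Qed.

Lemma built_union (R : rel T) (A B : {set T}) lab : [disjoint A & B] ->
  (forall x y, x \in A -> y \in B -> ~~ R x y && ~~ R y x) ->
  built R A lab -> built R B lab -> built R (A :|: B) lab.
Proof.
move=> dAB noR [e1 [f1 [fi1 fA1 fE1 fl1]]] [e2 [f2 [fi2 fA2 fE2 fl2]]].
have in1 y : f1 y \in A by rewrite fA1; apply/existsP; exists y.
have in2 y : f2 y \in B by rewrite fA2; apply/existsP; exists y.
exists (CWUnion e1 e2), (fun z => match z with inl x => f1 x | inr x => f2 x end); split.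
- move=> [x|x] [y|y] => [/fi1->|E|E|/fi2->] //.
    by have := disjointFr dAB (in1 x); rewrite E in2.
  by have := disjointFr dAB (in1 y); rewrite -E in2.
- move=> x; rewrite inE fA1 fA2; apply/orP/existsP.
    by case=> /existsP[y fy]; [exists (inl y) | exists (inr y)].
  by case=> -[y|y] fy; [left|right]; apply/existsP; exists y.
- move=> [x|x] [y|y] /=; rewrite ?fE1 ?fE2 //.
    by have /andP[/negbTE ->] := noR _ _ (in1 x) (in2 y).
  by have /andP[_ /negbTE ->] := noR _ _ (in1 y) (in2 x).
- by move=> [x|x] /=.
Qed.

Lemma built_join (R : rel T) A lab (i j : 'I_3) : i != j -> built R A lab ->
  built (fun x y => [|| R x y, (lab x == i) && (lab y == j) | (lab x == j) && (lab y == i)]) A lab.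
Proof.
move=> ij [e [f [fi fA fE fl]]]; exists (CWJoin ij e), f; split=> // x y.
by rewrite /= /join_edge fE !fl.
Qed.

Lemma built_relabel R A lab (i j : 'I_3) : built R A lab ->
  built R A (fun x => if lab x == i then j else lab x).
Proof.
case=> e [f [fi fA fE fl]]; exists (CWRelabel i j e), f; split=> // x /=.
by rewrite !fl.
Qed.

Variable E : rel T.
Hypothesis E_sym : symmetric E.

Definition lab0 : 'I_3 := @Ordinal 3 0 isT.
Definition lab1 : 'I_3 := @Ordinal 3 1 isT.
Definition lab2 : 'I_3 := @Ordinal 3 2 isT.

Definition mono (A : {set T}) : Prop := A = set0 \/ built E A (fun=> lab0).

Lemma built_const R A (i j : 'I_3) : built R A (fun=> i) -> built R A (fun=> j).
Proof. by move=> /(built_relabel i j) H; apply: built_ext H _ _ => // x _; rewrite eqxx. Qed.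

(** [B] alone carries the label [j], so one join of [i] and [j] adds precisely the edges between the
    two sets. *)
Lemma built_attach (A B : {set T}) lab (i j : 'I_3) : i != j -> [disjoint A & B] ->
  (forall x, x \in A -> lab x != j) -> (forall x, x \in B -> lab x = j) ->
  (forall x y, x \in A -> y \in B -> E x y = (lab x == i)) ->
  built E A lab -> built E B lab -> built E (A :|: B) lab.
Proof.
move=> ij dAB lA lB EAB bA bB.
pose R x y := E x y && ((x \in A) == (y \in A)).
have notA y : y \in B -> y \in A = false by move=> yB; rewrite (disjointFl dAB).
have bA' : built R A lab by apply: built_ext bA _ _ => // x y xA yA; rewrite /R xA yA eqxx andbT.
have bB' : built R B lab.
  by apply: built_ext bB _ _ => // x y xB yB; rewrite /R !notA // eqxx andbT.
have bU : built R (A :|: B) lab.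
  by apply: built_union => // x y xA yB; rewrite /R xA (notA _ yB) /= !andbF.
apply: built_ext (built_join ij bU) _ _ => // x y; rewrite !inE => xAB yAB; rewrite /R.
have E_irr_lab u v : u \in A -> v \in B -> (lab u == j) = false by move=> uA _; apply/negbTE/lA.
case: (boolP (x \in A)) xAB => [xA _|xA /= xB]; case: (boolP (y \in A)) yAB => [yA _|yA /= yB].
- by rewrite eqxx andbT (negbTE (lA _ xA)) (negbTE (lA _ yA)) !andbF !orbF.
- by rewrite andbF /= (lB _ yB) eqxx andbT (negbTE (lA _ xA)) orbF EAB.
- by rewrite andbF /= (lB _ xB) eqxx (negbTE (lA _ yA)) andbF /= E_sym EAB.
- by rewrite eqxx andbT (lB _ xB) (lB _ yB) eqxx [j == i]eq_sym (negbTE ij) !orbF.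
Qed.

Lemma mono_union (A B : {set T}) : [disjoint A & B] -> (forall x y, x \in A -> y \in B -> ~~ E x y) ->
  mono A -> mono B -> mono (A :|: B).
Proof.
move=> dAB noE [->|bA]; first by rewrite set0U.
case=> [->|bB]; first by rewrite setU0; right.
by right; apply: built_union => // x y xA yB; rewrite [E y x]E_sym andbb noE.
Qed.

Lemma mono_join (A B : {set T}) : [disjoint A & B] -> (forall x y, x \in A -> y \in B -> E x y) ->
  mono A -> mono B -> mono (A :|: B).
Proof.
move=> dAB allE [->|bA]; first by rewrite set0U.
case=> [->|bB]; first by rewrite setU0; right.
right; pose lab x := if x \in A then lab0 else lab1.
have notA y : y \in B -> y \in A = false by move=> yB; rewrite (disjointFl dAB).
have bA' : built E A lab by apply: built_ext bA _ _ => // x xA; rewrite /lab xA.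
have bB' : built E B lab.
  by apply: built_ext (built_const lab1 bB) _ _ => // x xB; rewrite /lab notA.
have bU : built E (A :|: B) lab.
  apply: (@built_attach _ _ lab lab0 lab1) => //.
  - by move=> x xA; rewrite /lab xA.
  - by move=> x xB; rewrite /lab notA.
  - by move=> x y xA yB; rewrite /lab xA eqxx allE.
apply: built_ext (built_relabel lab1 lab0 bU) _ _ => // x _.
by rewrite /lab; case: (x \in A).
Qed.

Lemma mono_stable (A : {set T}) : (forall x y, x \in A -> y \in A -> ~~ E x y) -> mono A.
Proof.
move: {2}#|A| (erefl #|A|) => n; elim: n A => [|n IH] A cA stA.
  by left; apply/eqP; rewrite -cards_eq0 cA.
have /card_gt0P[x xA] : 0 < #|A| by rewrite cA.
rewrite -(setD1K xA); apply: mono_union.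
- by rewrite disjoints1 !inE eqxx.
- by move=> y z; rewrite !inE => /eqP -> /andP[_ zA]; apply: stA.
- by right; apply: built_vertex; apply: stA.
- apply: IH; first by move: cA; rewrite (cardsD1 x) xA => -[].
  by move=> y z; rewrite !inE => /andP[_ yA] /andP[_ zA]; apply: stA.
Qed.

(** [A], [B] and [C] get labels 0, 1 and 2. Once [C] is attached, [A] and [B] have all their
    neighbours, so label 1 is merged into 0 and becomes free for [D]. *)
Lemma mono_P4 (A B C D : {set T}) :
  [/\ [disjoint A & B], [disjoint A :|: B & C] & [disjoint A :|: B :|: C & D]] ->
  [/\ A != set0, B != set0, C != set0 & D != set0] ->
  [/\ mono A, mono B, mono C & mono D] ->
  [/\ forall x y, x \in A -> y \in B -> E x y, forall x y, x \in B -> y \in C -> E x y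
    & forall x y, x \in C -> y \in D -> E x y] ->
  [/\ forall x y, x \in A -> y \in C -> ~~ E x y, forall x y, x \in A -> y \in D -> ~~ E x y
    & forall x y, x \in B -> y \in D -> ~~ E x y] ->
  mono (A :|: B :|: C :|: D).
Proof.
move=> [dAB dC dD] [A0 B0 C0 D0] [mA mB mC mD] [eAB eBC eCD] [nAC nAD nBD].
have bld S : S != set0 -> mono S -> built E S (fun=> lab0).
  by move=> S0 [S0'|//]; rewrite S0' eqxx in S0.
have bA := bld _ A0 mA; have bB := bld _ B0 mB; have bC := bld _ C0 mC; have bD := bld _ D0 mD.
have nA y : y \in B -> y \in A = false by move=> yB; rewrite (disjointFl dAB).
have nC y : y \in C -> (y \in A = false) /\ (y \in B = false).
  by move=> yC; have := disjointFl dC yC; rewrite inE => /norP[/negbTE-> /negbTE->].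
have nD y : y \in D -> [/\ y \in A = false, y \in B = false & y \in C = false].
  by move=> yD; have := disjointFl dD yD; rewrite !inE => /norP[/norP[/negbTE-> /negbTE->] /negbTE->].
pose l1 x := if x \in A then lab0 else if x \in B then lab1 else lab2.
have b1 : built E (A :|: B) l1.
  apply: (@built_attach _ _ l1 lab0 lab1) => //.
  - by move=> x xA; rewrite /l1 xA.
  - by move=> x xB; rewrite /l1 nA // xB.
  - by move=> x y xA yB; rewrite /l1 xA eqxx eAB.
  - by apply: built_ext bA _ _ => // x xA; rewrite /l1 xA.
  - by apply: built_ext (built_const lab1 bB) _ _ => // x xB; rewrite /l1 nA // xB.
have b2 : built E (A :|: B :|: C) l1.
  apply: (@built_attach _ _ l1 lab1 lab2) => //.
  - by move=> x; rewrite !inE /l1; case: (x \in A) => //= ->.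
  - by move=> x /nC[h1 h2]; rewrite /l1 h1 h2.
  - move=> x y; rewrite !inE /l1; case: (boolP (x \in A)) => [xA _ yC|_ /= xB yC].
      by apply/negbTE/nAC.
    by rewrite xB eqxx eBC.
  - by apply: built_ext (built_const lab2 bC) _ _ => // x /nC[h1 h2]; rewrite /l1 h1 h2.
pose l2 x := if l1 x == lab1 then lab0 else l1 x.
have b3 : built E (A :|: B :|: C) l2 by apply: built_relabel.
pose l3 x := if x \in D then lab1 else l2 x.
have l3E x : x \in A :|: B :|: C -> l3 x = if x \in C then lab2 else lab0.
  move=> xABC; rewrite /l3 (disjointFr dD xABC) /l2 /l1.
  move: xABC; rewrite !inE; case: (boolP (x \in C)) => [/nC[-> ->]|_] //.
  by rewrite orbF => /orP[->|xB] //; rewrite nA // xB.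
have b4 : built E (A :|: B :|: C :|: D) l3.
  apply: (@built_attach _ _ l3 lab2 lab1) => //.
  - by move=> x /l3E ->; case: ifP.
  - by move=> x xD; rewrite /l3 xD.
  - move=> x y xABC yD; rewrite l3E //; move: xABC; rewrite !inE.
    case: (boolP (x \in C)) => [xC _|_]; first by rewrite eqxx eCD.
    by rewrite orbF => /orP[xA|xB]; [rewrite (negbTE (nAD _ _ xA yD)) | rewrite (negbTE (nBD _ _ xB yD))].
  - by apply: built_ext b3 _ _ => // x xABC; rewrite /l3 (disjointFr dD xABC).
  - by apply: built_ext (built_const lab1 bD) _ _ => // x xD; rewrite /l3 xD.
right; pose l4 x := if l3 x == lab1 then lab0 else l3 x.
have b5 : built E (A :|: B :|: C :|: D) l4 by apply: built_relabel.
apply: built_ext (built_relabel lab2 lab0 b5) _ _ => // x _; rewrite /l4.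
by apply: val_inj; case: (l3 x) => [[|[|[|k]]] ?].
Qed.

End Built.

Lemma mono_constructible (G : sgraph) : mono (@sedge G) [set: G] -> cw_constructible 3 G.
Proof.
case=> [h|[e [f [fi fA fE _]]]]; first by left; rewrite -cardsT h cards0.
right; exists e, f; last by move=> x y; rewrite fE.
have surj x : exists y, f y == x by apply/existsP; rewrite -fA inE.
exists (fun x => xchoose (surj x)) => x; last by apply/eqP/(xchooseP (surj x)).
by apply: fi; apply/eqP/(xchooseP (surj (f x))).
Qed.

(** The least number of labels is obtained from classical well-ordering; it is at most 3. *)
Lemma constructible_cliquewidth (G : sgraph) (c : int) :
  (3 <= c)%R -> cw_constructible 3 G -> cliquewidth_at_most c G.
Proof.
move=> c3 G3.
have [w [Gw wmin]] : exists w, cw_constructible w G /\ forall k, cw_constructible k G -> w <= k.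
  apply: NNPP => no.
  suff H k : forall j, j <= k -> ~ cw_constructible j G by apply: (H 3 3).
  elim: k => [|k IH] j jk Gj; apply: no; exists j; split=> // i Gi; rewrite leqNgt; apply/negP => ij.
    by move: ij jk; lia.
  by apply: (IH i) => //; lia.
by exists w; [split | have := wmin _ G3; lia].
Qed.

Section MonoBlocks.
Variables (B W : nat) (w : nat -> nat) (adj : rel nat).
Hypothesis adj_sym : symmetric adj.
Hypothesis adj_irr : irreflexive adj.
Hypothesis wW : forall b, b < B -> w b <= W.

Let E := fun p q : 'I_(B * W) => blow_edge W w adj p q.
Let E_sym : symmetric E := @blow_edge_sym B W w adj adj_sym.

Let W_gt0 (p : 'I_(B * W)) : 0 < W.
Proof. by have := leq_ltn_trans (leq0n p) (ltn_ord p); rewrite muln_gt0 => /andP[]. Qed.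

Definition copies (P : pred nat) : {set 'I_(B * W)} :=
  [set p : 'I_(B * W) | live_copy W w p && P (p %/ W)].

Definition mono_blocks (P : pred nat) : Prop := mono E (copies P).

(** Blocks of weight 0 have no copies. In this way the satellites of inactive pairs disappear. *)
Lemma mono_blocks_ext (P Q : pred nat) : (forall b, b < B -> 0 < w b -> P b = Q b) ->
  mono_blocks P -> mono_blocks Q.
Proof.
move=> H; rewrite /mono_blocks (_ : copies P = copies Q) //.
apply/setP => p; rewrite !inE; case: (boolP (live_copy W w p)) => //= lp; apply: H.
  by rewrite ltn_divLR // (W_gt0 p).
exact: leq_ltn_trans lp.
Qed.

Lemma mono_blocks0 : mono_blocks pred0.
Proof. by left; apply/setP => p; rewrite !inE andbF. Qed.

Lemma mono_block1 b : mono_blocks (pred1 b).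
Proof.
apply: mono_stable => // p q; rewrite !inE /E /blow_edge => /andP[-> /eqP ->] /andP[-> /eqP ->].
by rewrite adj_irr.
Qed.

Lemma copies_U (P Q : pred nat) : copies (predU P Q) = copies P :|: copies Q.
Proof. by apply/setP => p; rewrite !inE /= andb_orr. Qed.

Lemma copies_disjoint (P Q : pred nat) : (forall b, 0 < w b -> P b -> ~~ Q b) -> [disjoint copies P & copies Q].
Proof.
move=> H; rewrite -setI_eq0; apply/eqP/setP => p; rewrite !inE.
apply/andP => -[/andP[lp Pp] /andP[_ Qp]].
by have := H _ (leq_ltn_trans (leq0n _) lp) Pp; rewrite Qp.
Qed.

Lemma mono_blocks_union (P Q : pred nat) :
  (forall b b', 0 < w b -> 0 < w b' -> P b -> Q b' -> b != b' /\ ~~ adj b b') ->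
  mono_blocks P -> mono_blocks Q -> mono_blocks (predU P Q).
Proof.
move=> H mP mQ; rewrite /mono_blocks copies_U; apply: mono_union => //.
  by apply: copies_disjoint => b w0 Pb; apply/negP => /(H b b w0 w0 Pb)[]; rewrite eqxx.
move=> p q; rewrite !inE /E /blow_edge => /andP[lp Pp] /andP[lq Qq].
by have [_ /negbTE ->] := H _ _ (leq_ltn_trans (leq0n _) lp) (leq_ltn_trans (leq0n _) lq) Pp Qq;
  rewrite !andbF.
Qed.

Lemma mono_blocks_join (P Q : pred nat) :
  (forall b b', 0 < w b -> 0 < w b' -> P b -> Q b' -> adj b b') ->
  mono_blocks P -> mono_blocks Q -> mono_blocks (predU P Q).
Proof.
move=> H mP mQ; rewrite /mono_blocks copies_U; apply: mono_join => //.
  by apply: copies_disjoint => b w0 Pb; apply/negP => /(H b b w0 w0 Pb); rewrite adj_irr.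
move=> p q; rewrite !inE /E /blow_edge => /andP[lp Pp] /andP[lq Qq].
by rewrite lp lq (H _ _ (leq_ltn_trans (leq0n _) lp) (leq_ltn_trans (leq0n _) lq)).
Qed.

Lemma copies1_neq0 b : b < B -> 0 < w b -> copies (pred1 b) != set0.
Proof.
move=> bB w0; have W0 : 0 < W by apply: leq_trans w0 (wW bB).
have h : b * W + 0 < B * W by apply: pair_index_lt.
apply/set0Pn; exists (Ordinal h); rewrite !inE /live_copy /=.
by rewrite modnMDl mod0n divnMDl // div0n addn0 w0 eqxx.
Qed.

Lemma mono_blocks_path a b c d :
  all (fun x => (x < B) && (0 < w x)) [:: a; b; c; d] -> uniq [:: a; b; c; d] ->
  [/\ adj a b, adj b c & adj c d] -> [/\ ~~ adj a c, ~~ adj a d & ~~ adj b d] ->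
  mono_blocks (fun x => x \in [:: a; b; c; d]).
Proof.
rewrite /= !inE !negb_or.
move=> /and5P[/andP[aB wa] /andP[bB wb] /andP[cB wc] /andP[dB wd] _].
move=> /and4P[/and3P[ab ac ad] /andP[bc bd] cd _] [eab ebc ecd] [nac nad nbd].
have dis x y : x != y -> [disjoint copies (pred1 x) & copies (pred1 y)].
  by move=> xy; apply: copies_disjoint => z _ /= /eqP ->.
have dU (X Y Z : {set 'I_(B * W)}) : [disjoint X & Z] -> [disjoint Y & Z] -> [disjoint X :|: Y & Z].
  by rewrite -!setI_eq0 setIUl => /eqP -> /eqP ->; rewrite setU0.
have yes x y : adj x y -> forall p q, p \in copies (pred1 x) -> q \in copies (pred1 y) -> E p q.
  by move=> xy p q; rewrite !inE /E /blow_edge => /andP[-> /eqP->] /andP[-> /eqP->].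
have no x y : ~~ adj x y -> forall p q, p \in copies (pred1 x) -> q \in copies (pred1 y) -> ~~ E p q.
  by move=> xy p q; rewrite !inE /E /blow_edge => /andP[-> /eqP->] /andP[-> /eqP->].
rewrite /mono_blocks; have -> : copies (fun x => x \in [:: a; b; c; d]) =
    copies (pred1 a) :|: copies (pred1 b) :|: copies (pred1 c) :|: copies (pred1 d).
  by apply/setP => p; rewrite !inE; case: (live_copy W w p); rewrite //= !orbA.
apply: (mono_P4 E_sym); split; try exact: copies1_neq0; try exact: mono_block1;
  try exact: dis; try exact: yes; try exact: no.
- by apply: (dU _ _ _); apply: (dis _ _).
- by apply: (dU _ _ _); [apply: (dU _ _ _)|]; apply: (dis _ _).
Qed.

Lemma mono_blow_up : mono_blocks (fun b => b < B) -> mono (@sedge (blow_up B W w adj_sym adj_irr)) setT.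
Proof.
move=> mB; have -> : [set: 'I_(B * W)] = copies (fun b => b < B) :|: [set p : 'I_(B * W) | ~~ live_copy W w p].
  apply/setP => p; rewrite !inE; case: (live_copy W w p); rewrite ?orbT //= orbF.
  by rewrite ltn_divLR ?(W_gt0 p) ?ltn_ord.
apply: mono_union => //.
- by rewrite -setI_eq0; apply/eqP/setP => p; rewrite !inE; case: (live_copy W w p); rewrite ?andbF.
- by move=> p q; rewrite !inE => _ /= /negbTE lq; rewrite /= /blow_edge lq andbF.
- by apply: mono_stable => // p q; rewrite !inE => /negbTE lp _; rewrite /= /blow_edge lp.
Qed.

End MonoBlocks.

Section Width.
Variables (n m : nat) (conf : rel nat).
Hypothesis n0 : 0 < n.
Hypothesis mn : m <= n.
Notation L := (levels n).
Notation K := (n ^ 2).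

Definition reduction_graph : sgraph :=
  blow_up (block_count n) (max_weight n m conf) (block_weight n m conf)
    (block_adj_sym n) (block_adj_irr n).

Let adj := block_adj n.
Let w := block_weight n m conf.
Let B := block_count n.
Let wW b : b < B -> w b <= max_weight n m conf := @block_weight_le n m conf n0 mn b.
Notation mono_blocks := (mono_blocks B (max_weight n m conf) w adj).
Let co b := b %/ L.+2.
Let po b := b %% L.+2.

Let coE e a : a < L.+2 -> co (e * L.+2 + a) = e. Proof. exact: divblock. Qed.
Let poE e a : a < L.+2 -> po (e * L.+2 + a) = a. Proof. exact: modblock. Qed.

Let eq_block e a b : a < L.+2 -> (b == e * L.+2 + a) = (co b == e) && (po b == a).
Proof.
move=> al; apply/eqP/andP => [->|[/eqP <- /eqP <-]]; last exact: divn_eq.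
by rewrite coE // poE.
Qed.

(** For an active pair, [first] selects the cores [i], [j] and the satellites, which induce a path;
    otherwise it selects no block of positive weight. The remaining cores are adjacent to the whole
    component and are joined one by one. *)
Lemma mono_component e : e < K -> mono_blocks (fun b => co b == e).
Proof.
move=> eK; set i := e %/ n; set j := e %% n.
have eKf : (e == K) = false by rewrite ltn_eqF.
have jL : j < L by apply: leq_trans (leq_addl _ _); rewrite ltn_mod.
have iL : i < L by apply: leq_trans (leq_addl _ _); rewrite ltn_divLR // mulnn.
pose first a := (L <= a) || active n conf e && ((a == i) || (a == j)).
have wt b : 0 < w b -> co b = e -> L <= po b -> active n conf e.
  move=> + Eb Lb; rewrite /w /block_weight -[b %/ _]/(co b) -[b %% _]/(po b) Eb.
  by rewrite /weight eK [po b < L]ltnNge Lb /= /weight_c /weight_d; case: (active n conf e) => //; case: ifP.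
have start : mono_blocks (fun b => (co b == e) && first (po b)).
  case: (boolP (active n conf e)) => act; last first.
    apply: mono_blocks_ext (mono_blocks0 _ _ _ _) => b bB wb /=; apply/esym/negbTE/andP => -[/eqP Eb].
    by rewrite /first (negbTE act) orbF => /(wt _ wb Eb); rewrite (negbTE act).
  have [ij _] := andP act; rewrite -/i -/j in ij.
  have il2 : i < L.+2 by rewrite ltnW // ltnW.
  have jl2 : j < L.+2 by rewrite ltnW // ltnW.
  have Ll2 : L < L.+2 by rewrite ltnW.
  have Sl2 : L.+1 < L.+2 by [].
  have LS : (L.+1 < L) = false by rewrite ltnNge leqnSn.
  have LE : (L.+1 == L) = false by rewrite eqn_leq ltnn.
  have LE' : (L == L.+1) = false by rewrite eq_sym.
  have iL' := ltn_eqF iL; have jL' := ltn_eqF jL.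
  have iL'' : (i == L.+1) = false by rewrite ltn_eqF // ltnW.
  have jL'' : (j == L.+1) = false by rewrite ltn_eqF // ltnW.
  have ij' := ltn_eqF ij.
  have adjE a a' : a < L.+2 -> a' < L.+2 -> adj (e * L.+2 + a) (e * L.+2 + a') =
      [&& a != a', ~~ separated n e a a' & ~~ separated n e a' a].
    by move=> h h'; rewrite /adj /block_adj !divblock // !modblock // eKf eqxx.
  have := @mono_blocks_path B (max_weight n m conf) w adj (block_adj_sym n) (block_adj_irr n) wW
    (e * L.+2 + i) (e * L.+2 + j) (e * L.+2 + L) (e * L.+2 + L.+1).
  rewrite /= !inE !eqn_add2l !(adjE _ _ il2, adjE _ _ jl2, adjE _ _ Ll2) // /separated -/i -/j.
  have sym : ([|| i == L, i == L.+1 | j == L] = false) by rewrite iL' iL'' jL'.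
  rewrite !eqxx ij' iL' jL' iL'' jL'' LE LE' [j == i]eq_sym ij' [L == i]eq_sym [L == j]eq_sym
    [L.+1 == i]eq_sym [L.+1 == j]eq_sym iL' jL' iL'' jL'' /=.
  have idx a : a < L.+2 -> e * L.+2 + a < B by move=> h; apply: pair_index_lt => //; apply: ltnW.
  have w4 : [/\ 0 < w (e * L.+2 + i), 0 < w (e * L.+2 + j), 0 < w (e * L.+2 + L) &
      0 < w (e * L.+2 + L.+1)].
    rewrite /w /block_weight !(divblock _ il2, divblock _ jl2, divblock _ Ll2, divblock _ Sl2).
    rewrite !(modblock _ il2, modblock _ jl2, modblock _ Ll2, modblock _ Sl2).
    by rewrite /weight eK iL jL ltnn eqxx LS LE /weight_c /weight_d act !muln_gt0 !subn_gt0 iL jL ij.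
  case: w4 => -> -> -> ->; rewrite !(idx _ il2, idx _ jl2, idx _ Ll2, idx _ Sl2).
  move=> /(_ isT isT (And3 isT isT isT) (And3 isT isT isT)) H; apply: mono_blocks_ext H => b bB wb; rewrite !inE.
  have bE : b = co b * L.+2 + po b := divn_eq b L.+2.
  have pL : po b < L.+2 by rewrite ltn_mod.
  rewrite bE coE // poE //; case: (eqVneq (co b) e) => [->|ne] /=.
    rewrite !eqn_add2l /first act /=.
    by rewrite orbA orbC; congr orb; rewrite ?(leq_eqVlt L); move: pL; lia.
  have ne' a : a < L.+2 -> (co b * L.+2 + po b == e * L.+2 + a) = false.
    by move=> h; apply/eqP => /(congr1 co); rewrite !coE //; apply/eqP.
  by rewrite !ne'.
suff H k : k <= L -> mono_blocks (fun b => (co b == e) && (first (po b) || (po b < k))).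
  apply: mono_blocks_ext (H L (leqnn _)) => b _ _; rewrite /first.
  by case: (ltnP (po b) L); rewrite ?orbT ?andbT.
elim: k => [|k IH] kL; first by apply: mono_blocks_ext start => b _ _; rewrite orbF.
have k2 : k < L.+2 by rewrite ltnW // ltnW.
case: (boolP (first k)) => fk.
  apply: mono_blocks_ext (IH (ltnW kL)) => b _ _; congr andb; rewrite [po b < k.+1]ltnS [po b <= k]leq_eqVlt.
  by case: (eqVneq (po b) k) => [->|//]; rewrite fk.
move: fk; rewrite /first negb_or -ltnNge kL /= => fk.
apply: (mono_blocks_ext _ (mono_blocks_join (block_adj_sym n) (block_adj_irr n) _ (IH (ltnW kL))
  (mono_block1 B (max_weight n m conf) w (block_adj_sym n) (block_adj_irr n) (e * L.+2 + k)))).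
  move=> b _ _ /=; rewrite eq_block // -andb_orr -orbA; congr (_ && (_ || _)).
  by rewrite [po b < k.+1]ltnS [po b <= k]leq_eqVlt orbC.
move=> b b' wb _ /andP[/eqP Eb fb] /eqP ->.
rewrite /adj /block_adj -/(co b) -/(po b) divblock // modblock // Eb eKf eqxx /=.
have ne : po b != k.
  apply/eqP => h; move: fb fk; rewrite h ltnn orbF /first leqNgt kL /=.
  by move=> ->.
rewrite ne /separated (ltn_eqF kL) [k == L.+1]ltn_eqF ?andbF //=; last exact: ltnW.
rewrite andbT; case: (leqP L (po b)) => Lb; last first.
  by rewrite (ltn_eqF Lb) [po b == L.+1]ltn_eqF // ltnW.
have act := wt _ wb Eb Lb; move: fk; rewrite act /= -/i -/j => /norP[/negbTE -> /negbTE ->].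
by rewrite !andbF.
Qed.

Lemma reduction_graph_constructible : cw_constructible 3 reduction_graph.
Proof.
apply: mono_constructible; apply: mono_blow_up.
have asym := block_adj_sym n; have airr := block_adj_irr n.
have comps k : k <= K -> mono_blocks (fun b => co b < k).
  elim: k => [|k IH] kK; first exact: mono_blocks_ext (mono_blocks0 _ _ _ _).
  apply: (mono_blocks_ext _ (mono_blocks_union asym _ (IH (ltnW kK)) (mono_component kK))) => [b _ _|b b' _ _ bk /eqP b'k] /=.
    by rewrite [co b < k.+1]ltnS [co b <= k]leq_eqVlt orbC.
  split; first by apply: contraTneq bk => ->; rewrite b'k ltnn.
  by rewrite /block_adj -/(co b) -/(co b') b'k (ltn_eqF kK) (ltn_eqF (ltn_trans bk kK)) (ltn_eqF bk).
suff H k : k <= L -> mono_blocks (fun b => (co b < K) || (co b == K) && (po b < k)).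
  apply: mono_blocks_ext (H L (leqnn _)) => b bB wb; rewrite bB.
  have : co b <= K by rewrite -ltnS /co ltn_divLR.
  rewrite leq_eqVlt => /orP[/eqP E|->] //; rewrite E ltnn eqxx /=.
  move: wb; rewrite /w /block_weight -/(co b) -/(po b) E /weight ltnn.
  by case: ifP.
elim: k => [|k IH] kL.
  by apply: mono_blocks_ext (comps K (leqnn _)) => b _ _; rewrite andbF orbF.
have k2 : k < L.+2 by rewrite ltnW // ltnW.
apply: (mono_blocks_ext _ (mono_blocks_join asym airr _ (IH (ltnW kL))
  (mono_block1 B (max_weight n m conf) w asym airr (K * L.+2 + k)))).
  move=> b _ _ /=; rewrite eq_block // -orbA -andb_orr; congr (_ || (_ && _)).
  by rewrite [po b < k.+1]ltnS [po b <= k]leq_eqVlt orbC.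
move=> b b' _ _ h /eqP ->; rewrite /block_adj -/(co b) -/(po b) divblock // modblock // eqxx orbT.
case/orP: h => [h|/andP[/eqP -> h]]; first by rewrite ltn_eqF.
by rewrite [po b == k]ltn_eqF ?orbT.
Qed.

End Width.

(** * Binary constraint satisfaction as a choice of independent vertices *)

Lemma sumf_bool_le1 s (f : pred nat) : (forall v v', v < v' -> v' < s -> ~~ (f v && f v')) ->
  sumf s f <= 1.
Proof.
elim: s => [|s IH] H; first by rewrite /sumf big_nil.
rewrite sumfS; case: (boolP (f s)) => fs; last by rewrite addn0; apply: IH => v v' vv' v's; apply: H; lia.
rewrite (eq_sumf (g := fun=> 0)) ?sumf_const ?muln0 // => v vs.
by have := H v s vs (leqnn _); rewrite fs andbT => /negbTE ->.
Qed.

Lemma sumf_bool_gt0 s (f : pred nat) : 0 < sumf s f -> exists2 v, v < s & f v.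
Proof.
rewrite lt0n sumfE sum_nat_eq0 negb_forall => /existsP[v]; rewrite implyTb eqb0 negbK => fv.
by exists v.
Qed.

Lemma sumf_saturated m g : (forall t, t < m -> g t <= 1) -> m <= sumf m g ->
  forall t, t < m -> g t = 1.
Proof.
move=> g1 mg t tm.
have E : sumf m g + sumf m (fun t => 1 - g t) = m.
  by rewrite -sumfD (eq_sumf (g := fun=> 1)) ?sumf_const ?muln1 // => u um; rewrite subnKC ?g1.
have : sumf m (fun t => 1 - g t) == 0 by lia.
rewrite sumfE sum_nat_eq0 => /forallP/(_ (Ordinal tm)) /=.
by have := g1 t tm; case: (g t) => [|[|]].
Qed.

Section ConstraintSatisfaction.
Variables (m s : nat) (ok : nat -> nat -> bool) (comp : nat -> nat -> nat -> nat -> bool).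
Hypothesis m1 : 1 < m.

(** Vertex [t * s + v] means that variable [t] has value [v]. Unary constraints become binary by
    putting a bad value in conflict with everything. *)
Definition csp_conf (u u' : nat) : bool :=
  (u %/ s == u' %/ s) ||
  ~~ [&& ok (u %/ s) (u %% s), ok (u' %/ s) (u' %% s) & comp (u %/ s) (u %% s) (u' %/ s) (u' %% s)].

(** The values of one variable are pairwise in conflict, so [m] independent vertices in [m] groups
    are one per group. *)
Lemma csp_choice :
  (exists I, independent_choice (m * s) m csp_conf I) <->
  exists a, (forall t, t < m -> a t < s /\ ok t (a t)) /\
    (forall t t', t < t' -> t' < m -> comp t (a t) t' (a t')).
Proof.
split=> [[I [indI]]|[a [Ha Hc]]].
  rewrite sumf_mul => mI; pose g t := sumf s (fun v => I (t * s + v)).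
  have div t v : v < s -> (t * s + v) %/ s = t.
    by move=> vs; rewrite divnMDl ?divn_small ?addn0 //; apply: leq_ltn_trans vs.
  have mod t v : v < s -> (t * s + v) %% s = v by move=> vs; rewrite modnMDl modn_small.
  have g1 t : t < m -> g t <= 1.
    move=> tm; apply: (@sumf_bool_le1 s (fun v => I (t * s + v))) => v v' vv' v's; apply/negP => /andP[Iv Iv'].
    have vs := ltn_trans vv' v's.
    have := indI (t * s + v) (t * s + v'); rewrite ltn_add2l vv' pair_index_lt // => /(_ isT isT Iv Iv').
    by rewrite /csp_conf !div // eqxx.
  have gE := sumf_saturated g1 mI.
  have ex t : t < m -> exists2 v, v < s & I (t * s + v).
    by move=> /gE gt; apply: sumf_bool_gt0; rewrite -/(g t) gt.
  pose a t := findf s (fun v => I (t * s + v)).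
  have aP t : t < m -> a t < s /\ I (t * s + a t).
    move=> /ex[v vs Iv]; have h : has (fun v => I (t * s + v)) (iota 0 s).
      by apply/hasP; exists v; rewrite // mem_iota.
    have ats : a t < s by rewrite -[X in _ < X](size_iota 0 s) -has_find.
    by split=> //; have := nth_find 0 h; rewrite nth_iota.
  have pr t t' : t < t' -> t' < m -> [&& ok t (a t), ok t' (a t') & comp t (a t) t' (a t')].
    move=> tt' t'm; have [ats It] := aP _ (ltn_trans tt' t'm); have [at's It'] := aP _ t'm.
    have lt : t * s + a t < t' * s + a t'.
      apply: leq_trans (leq_addr _ _); apply: leq_trans (_ : t.+1 * s <= _).
        by rewrite mulSn addnC ltn_add2r.
      by rewrite leq_mul2r tt' orbT.
    have := indI _ _ lt; rewrite pair_index_lt // => /(_ isT It It').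
    by rewrite /csp_conf !div // !mod // (ltn_eqF tt') /= negbK.
  exists a; split=> [t tm|t t' tt' t'm]; last by have /and3P[] := pr _ _ tt' t'm.
  split; first by have [] := aP _ tm.
  (* A bad value shows only in a pair, so another variable is called in: 1 for [t = 0], and 0
     otherwise. *)
  case: (posnP t) => [->|t0]; first by have /and3P[] := pr 0 1 isT m1.
  by have /and3P[] := pr 0 t t0 tm.
exists (fun u => a (u %/ s) == u %% s); split=> [u u' uu' u'n /eqP au /eqP au'|].
  have s0 : 0 < s by rewrite lt0n; apply: contraTneq u'n => ->; rewrite muln0.
  have tm : u' %/ s < m by rewrite ltn_divLR.
  have le : u %/ s <= u' %/ s by apply: leq_div2r; apply: ltnW.
  have ne : u %/ s != u' %/ s.
    by apply: contraTneq uu' => E; rewrite (divn_eq u s) (divn_eq u' s) -au -au' E ltnn.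
  have lt : u %/ s < u' %/ s by rewrite ltn_neqAle ne.
  have [_ o1] := Ha _ (ltn_trans lt tm); have [_ o2] := Ha _ tm; have c12 := Hc _ _ lt tm.
  by rewrite /csp_conf -au -au' o1 o2 c12 (negbTE ne).
rewrite sumf_mul -[X in X <= _]muln1 -sumf_const; apply: leq_sumf => t tm.
have [ats _] := Ha _ tm.
rewrite sumfE (bigD1 (Ordinal ats)) //= divnMDl ?(leq_ltn_trans _ ats) // divn_small // addn0.
by rewrite modnMDl modn_small // eqxx leq_addr.
Qed.

End ConstraintSatisfaction.

Fixpoint digits (k R : nat) (d : nat -> nat) : nat :=
  if k is k'.+1 then digits k' R (fun i => d i.+1) * R + d 0 else 0.

Lemma digits_lt k R d : (forall i, i < k -> d i < R) -> digits k R d < R ^ k.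
Proof.
elim: k d => //= k IH d dR; rewrite expnSr; apply: pair_index_lt; last exact: dR.
by apply: IH => i ik; apply: dR.
Qed.

Lemma digitsE k R d i : (forall i, i < k -> d i < R) -> i < k -> (digits k R d %/ R ^ i) %% R = d i.
Proof.
elim: k d i => //= k IH d i dR ik; have d0 := dR 0 isT; have R0 := leq_ltn_trans (leq0n _) d0.
case: i ik => [|i] ik; first by rewrite divn1 modnMDl modn_small.
by rewrite expnS divnMA divnMDl // (divn_small d0) addn0 IH // => j jk; apply: dR.
Qed.

(** * Tape contents from the history of a head *)

Section LastVisit.
Variable pos : nat -> nat.

(* One more than the last time before [t] at which cell [j] is scanned, or 0. *)
Fixpoint last_visit (t j : nat) : nat :=
  if t is u.+1 then if pos u == j then u.+1 else last_visit u j else 0.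

Lemma last_visit_le t j : last_visit t j <= t.
Proof. by elim: t => //= t IH; case: ifP => // _; apply: leqW. Qed.

Lemma last_visit_pos t j u : last_visit t j = u.+1 -> pos u = j.
Proof. by elim: t => //= t IH; case: eqP => // + [] <-. Qed.

Lemma last_visit_max t j u : u < t -> last_visit t j <= u -> pos u != j.
Proof.
elim: t => //= t IH ut; case: (eqVneq (pos t) j) => [_ tu|ne].
  by have := leq_ltn_trans tu ut; rewrite ltnn.
by move: ut; rewrite ltnS leq_eqVlt => /orP[/eqP -> //|]; apply: IH.
Qed.

Lemma last_visit_uniq t j l : l <= t -> (forall u, u < t -> l = u.+1 -> pos u = j) ->
  (forall u, u < t -> l <= u -> pos u != j) -> last_visit t j = l.
Proof.
elim: t => [|t IH] /=; first by rewrite leqn0 => /eqP.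
rewrite leq_eqVlt => /orP[/eqP -> H _|lt H1 H2]; first by rewrite (H t) ?eqxx.
rewrite (negbTE (H2 t _ _)) //; apply: IH => // u ut; [exact: H1 (ltnW _)|exact: H2 (ltnW _)].
Qed.

Definition contents (A : Type) (ini wr : nat -> A) (t j : nat) : A :=
  if last_visit t j is u.+1 then wr u else ini j.

Lemma contentsS (A : Type) (ini wr : nat -> A) t :
  contents ini wr t.+1 = upd (contents ini wr t) (pos t) (wr t).
Proof.
by apply: functional_extensionality => j; rewrite /contents /upd /= eq_sym; case: (j == pos t).
Qed.

End LastVisit.

Lemma eq_contents (A : Type) (ini wr wr' : nat -> A) pos pos' t :
  (forall u, u < t -> pos u = pos' u /\ wr u = wr' u) ->
  contents pos ini wr t = contents pos' ini wr' t.
Proof.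
elim: t => // t IH H; rewrite !contentsS; have [-> ->] := H t (leqnn _); congr upd.
by apply: IH => u ut; apply/H/ltnW.
Qed.

Section History.
Variable M : tm.
Notation I := 'I_(tm_tapes M).+1.
Definition scan_type : finType := (tm_state M * {ffun I -> option (bool + tm_extra M)})%type.

Definition observe (C : config M) : scan_type := (cfg_state C, [ffun i => tape_read (cfg_tapes C i)]).
Definition scan_next (x : scan_type) : tm_state M := if tm_trans x.1 x.2 is Some (q, _) then q else x.1.
Definition scan_act (x : scan_type) (i : I) : symbol M * move :=
  if tm_trans x.1 x.2 is Some (_, a) then a i else (x.2 i, MoveStay).
Definition scan_halts (x : scan_type) : bool := ~~ isSome (tm_trans x.1 x.2).

Definition advance (C : config M) : config M := if tm_step C is Some C' then C' else C.

(** [advance] keeps a halted configuration, so halting within [t] steps is a property of the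
    configuration after exactly [t] steps. *)
Lemma run_iter t C C' : run t C = Some C' <-> scan_halts (observe (iter t advance C)) /\ C' = iter t advance C.
Proof.
have hE D : scan_halts (observe D) = ~~ isSome (tm_step D).
  by rewrite /scan_halts /tm_step /=; case: tm_trans => [[]|].
have stop D : tm_step D = None -> forall u, iter u advance D = D.
  by move=> E; elim=> //= u ->; rewrite /advance E.
elim: t C => [|t IH] C.
  rewrite hE /=; case: (tm_step C) => [D|] /=; split=> //; [by case|by case=> <-|by case=> _ ->].
rewrite iterSr /= {2 4}/advance; case E: (tm_step C) => [D|]; first exact: IH.
by rewrite stop // hE E; split=> [[<-]|[_ ->]].
Qed.

Lemma advanceE C : cfg_state (advance C) = scan_next (observe C) /\
  forall i, cfg_tapes (advance C) i =
    (if scan_halts (observe C) then cfg_tapes C i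
     else tape_write_move (scan_act (observe C) i).1 (scan_act (observe C) i).2 (cfg_tapes C i)).
Proof.
rewrite /advance /tm_step /scan_next /scan_act /scan_halts /=.
case: tm_trans => [[q a]|] //=.
by split=> // i; rewrite ffunE.
Qed.

Variables (C0 : config M) (T : nat) (ini : I -> nat -> symbol M).
Hypothesis rep0 : forall i, tape_rep (cfg_tapes C0 i) (ini i) T.

Let C t := iter t advance C0.

(** Starting at [T], no head can pass the origin within [T] steps, so the truncated predecessor in
    [displace] is exact. *)
Fixpoint head_pos (i : I) (t : nat) : nat :=
  if t is u.+1 then displace (scan_act (observe (C u)) i).2 (head_pos i u) else T.

Lemma head_pos_bound i t : T - t <= head_pos i t <= T + t.
Proof. by elim: t => [|t] /=; [lia | case: (scan_act _ i).2 => /=; lia]. Qed.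

Lemma history t i : t <= T ->
  tape_rep (cfg_tapes (C t) i)
    (contents (head_pos i) (ini i) (fun u => (scan_act (observe (C u)) i).1) t) (head_pos i t).
Proof.
elim: t => [|t IH] tT; first exact: rep0.
have R := IH (ltnW tT); rewrite contentsS /=.
have [_ ->] := advanceE (C t); case: ifP => h; last first.
  apply: tape_rep_write_move => // _; have := head_pos_bound i t; lia.
move: h; rewrite /scan_halts /scan_act; case: tm_trans => //= _.
by rewrite ffunE (tape_rep_read R) upd_id.
Qed.

Lemma scan_read t i : t <= T -> (observe (C t)).2 i =
  contents (head_pos i) (ini i) (fun u => (scan_act (observe (C u)) i).1) t (head_pos i t).
Proof. by move=> tT; rewrite ffunE (tape_rep_read (history i tT)). Qed.

(** Determinism: [contents] at time [t] refers to earlier times only, so agreement up to [t] fixes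
    the next state, the head positions and then the scanned symbols. *)
Lemma history_uniq (xs : nat -> scan_type) (ps : I -> nat -> nat) :
  (xs 0).1 = cfg_state C0 -> (forall i, ps i 0 = T) ->
  (forall t, t < T -> (xs t.+1).1 = scan_next (xs t)) ->
  (forall t i, t < T -> ps i t.+1 = displace (scan_act (xs t) i).2 (ps i t)) ->
  (forall t i, t <= T -> (xs t).2 i =
     contents (ps i) (ini i) (fun u => (scan_act (xs u) i).1) t (ps i t)) ->
  forall t, t <= T -> xs t = observe (C t) /\ forall i, ps i t = head_pos i t.
Proof.
move=> x0 p0 xS pS xr; suff H t : t <= T -> forall u, u <= t -> xs u = observe (C u) /\ forall i, ps i u = head_pos i u.
  by move=> t tT; apply: (H t tT).
elim: t => [|t IH] tT u.
  rewrite leqn0 => /eqP ->; split=> //; rewrite [LHS]surjective_pairing x0; congr pair.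
  by apply/ffunP => i; rewrite (xr _ _ tT) (scan_read _ tT) p0.
rewrite leq_eqVlt => /orP[/eqP ->|/(IH (ltnW tT)) //].
have [xE pE] := IH (ltnW tT) t (leqnn _).
have pE' i : ps i t.+1 = head_pos i t.+1 by rewrite pS // xE pE.
split=> //; rewrite [LHS]surjective_pairing xS // xE.
have [<- _] := advanceE (C t); congr pair; apply/ffunP => i.
rewrite xr // -[RHS]/((observe (C t.+1)).2 i) scan_read // pE'; congr (_ _).
have e : forall u, u < t.+1 -> ps i u = head_pos i u /\ (scan_act (xs u) i).1 = (scan_act (observe (C u)) i).1.
  by move=> v vt; have [-> ->] := IH (ltnW tT) v vt.
by rewrite (eq_contents _ e).
Qed.

End History.

(** * Computations as solutions of binary constraints *)

Section Tableau.
Variable M : tm.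
Notation k := (tm_tapes M).+1.
Notation X := (scan_type M).

Definition scan_count : nat := #|X|.
Definition scan_of (z : nat) : X := nth (tm_start M, [ffun=> None]) (enum X) z.

(** Codes are compared only for initial contents, which are blanks and bits; the auxiliary symbols
    can share a code. *)
Definition symbol_code (a : symbol M) : nat :=
  match a with None => 0 | Some (inl b) => b.+1 | Some (inr _) => 3 end.

Lemma symbol_code_inj a b : symbol_code a <= 2 -> symbol_code a = symbol_code b -> a = b.
Proof. by case: a b => [[[]|?]|] [[[]|?]|]. Qed.

Definition is_start (z : nat) : bool := (scan_of z).1 == tm_start M.
Definition is_final (z : nat) : bool := scan_halts (scan_of z) && tm_accept (scan_of z).1.
Definition follows (z z' : nat) : bool := (scan_of z').1 == scan_next (scan_of z).
Definition read_code (i z : nat) : nat := symbol_code ((scan_of z).2 (inord i)).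
Definition carries (i z z' : nat) : bool := (scan_of z').2 (inord i) == (scan_act (scan_of z) (inord i)).1.
(** 0, 1 and 2 for left, stay and right: an offset of one avoids negative differences. *)
Definition shift (i z : nat) : nat := displace (scan_act (scan_of z) (inord i)).2 1.

Variables (x : nat -> bool) (len T qb : nat).

(* The value of time [t] encodes the state and the scanned symbols at time [t] and, for each tape,
   the position of the head and one more than the time of the previous visit of the scanned cell
   (0 if there is none): whether the scanned symbol is the one written last then only depends on
   pairs of values. The input starts at position [T], which the heads cannot leave on the left. *)
Definition radix : nat := (2 * T + 1) * T.+2.
Definition digit (v i : nat) : nat := v %/ scan_count %/ radix ^ i %% radix.
Definition val_scan (v : nat) : nat := v %% scan_count.
Definition val_pos (i v : nat) : nat := digit v i %% (2 * T + 1).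
Definition val_last (i v : nat) : nat := digit v i %/ (2 * T + 1).
Definition value_count : nat := scan_count * radix ^ k.

(** The certificate on tape 1 is guessed; a blank is allowed inside the first [qb] cells because it
    may be shorter. *)
Definition init_ok (i c p : nat) : bool :=
  if i == 0 then c == (if (T <= p) && (p - T < len) then (x (p - T)).+1 else 0)
  else if i == 1 then (if (T <= p) && (p - T < qb) then c <= 2 else c == 0)
  else c == 0.

Definition tableau_ok (t v : nat) : bool :=
  let z := val_scan v in
  [&& (t == 0) ==> is_start z, (t == T) ==> is_final z &
   all (fun i => let p := val_pos i v in let l := val_last i v in
     [&& (t == 0) ==> (p == T), l <= t & (l == 0) ==> init_ok i (read_code i z) p]) (iota 0 k)].

(** The clauses on [l'] certify the guess: the cell was scanned at time [l' - 1] and not since. The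
    last clause makes the unknown certificate a string followed by blanks: among first visits on
    tape 1, whatever lies to the right of a blank is blank. *)
Definition tableau_comp (t v t' v' : nat) : bool :=
  let z := val_scan v in let z' := val_scan v' in
  ((t' == t.+1) ==> follows z z') &&
  all (fun i => let p := val_pos i v in let l := val_last i v in
     let p' := val_pos i v' in let l' := val_last i v' in
     [&& (t' == t.+1) ==> (p'.+1 == p + shift i z),
      (l' == t.+1) ==> ((p == p') && carries i z z'),
      (l' <= t) ==> (p != p') &
      [&& i == 1, l == 0, l' == 0, T <= p & T <= p'] ==>
        (((p < p') && (read_code i z == 0)) ==> (read_code i z' == 0)) &&
        (((p' < p) && (read_code i z' == 0)) ==> (read_code i z == 0))]) (iota 0 k).

End Tableau.

Section TableauCorrect.
Variable M : tm.
Notation k := (tm_tapes M).+1.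
Notation X := (scan_type M).
Variables (xs : seq bool) (T qb : nat).
Notation x := (nth false xs).
Notation len := (size xs).

Lemma scan_of_index (c : X) : scan_of M (index c (enum X)) = c.
Proof. by rewrite /scan_of nth_index // mem_enum. Qed.

Lemma index_scan_lt (c : X) : index c (enum X) < scan_count M.
Proof. by rewrite /scan_count cardE index_mem mem_enum. Qed.

Definition ini_tape (y : seq bool) (i j : nat) : symbol M :=
  if T <= j then nth None [seq Some (inl b) | b <- nth [::] [:: xs; y] i] (j - T) else None.

Lemma ini_tape_rep y (i : 'I_k) : tape_rep (cfg_tapes (tm_init M [:: xs; y]) i) (ini_tape y i) T.
Proof.
split=> [j|j jT]; rewrite ffunE /ini_tape /=; first by rewrite leq_addr addKn.
by rewrite nth_nil leqNgt (_ : T.-1 - j < T) //; lia.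
Qed.

Lemma symbol_code_ini y i j : symbol_code (ini_tape y i j) =
  if (T <= j) && (j - T < size (nth [::] [:: xs; y] i)) then (nth false (nth [::] [:: xs; y] i) (j - T)).+1 else 0.
Proof.
rewrite /ini_tape; case: (leqP T j) => //= _; case: ltnP => h.
  by rewrite (nth_map false).
by rewrite nth_default // size_map.
Qed.

Lemma accepting_tableau y : size y <= qb ->
  let C t := iter t (@advance M) (tm_init M [:: xs; y]) in
  scan_halts (observe (C T)) -> accepting (C T) ->
  exists a, (forall t, t < T.+1 -> a t < value_count M T /\ tableau_ok M x len T qb t (a t)) /\
    (forall t t', t < t' -> t' < T.+1 -> tableau_comp M T t (a t) t' (a t')).
Proof.
move=> yq C halt acc; pose z t := index (observe (C t)) (enum X).
pose hp i := head_pos (tm_init M [:: xs; y]) T (inord i : 'I_k).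
pose lv i t := last_visit (hp i) t (hp i t).
pose d t i := lv i t * (2 * T + 1) + hp i t.
have P0 : 0 < 2 * T + 1 by rewrite addn1.
have hpT i t : t <= T -> hp i t < 2 * T + 1.
  by move=> tT; have := head_pos_bound (tm_init M [:: xs; y]) T (inord i : 'I_k) t; rewrite -/(hp i t); lia.
have dR t i : t <= T -> d t i < radix T.
  move=> tT; rewrite /radix mulnC; apply: pair_index_lt; last exact: hpT.
  by have := last_visit_le (hp i) t (hp i t); rewrite -/(lv i t); lia.
pose a t := digits k (radix T) (d t) * scan_count M + z t.
have zlt t : z t < scan_count M := index_scan_lt _.
have Z0 : 0 < scan_count M := leq_ltn_trans (leq0n _) (zlt 0).
have aR t : t <= T -> a t < value_count M T.
  move=> tT; rewrite /value_count mulnC; apply: pair_index_lt => //.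
  by apply: digits_lt => i _; apply: dR.
have scE t : val_scan M (a t) = z t by rewrite /val_scan modnMDl modn_small.
have digE t i : t <= T -> i < k -> digit M T (a t) i = d t i.
  move=> tT ik; rewrite /digit divnMDl // (divn_small (zlt t)) addn0.
  by apply: digitsE => // j _; apply: dR.
have posE t i : t <= T -> i < k -> val_pos M T i (a t) = hp i t.
  by move=> tT ik; rewrite /val_pos digE // modnMDl modn_small ?hpT.
have lastE t i : t <= T -> i < k -> val_last M T i (a t) = lv i t.
  by move=> tT ik; rewrite /val_last digE // divnMDl // divn_small ?addn0 ?hpT.
have zE t : scan_of M (z t) = observe (C t) := scan_of_index _.
have readE t i : t <= T -> i < k -> (observe (C t)).2 (inord i : 'I_k) =
    if lv i t is u.+1 then (scan_act (observe (C u)) (inord i)).1 else ini_tape y i (hp i t).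
  move=> tT ik; rewrite (scan_read (ini_tape_rep y) _ tT).
  by rewrite /contents inordK.
exists a; split=> [t tT|t t' tt' t'T].
  split; first exact: aR.
  rewrite /tableau_ok scE /is_start /is_final zE; apply/and3P; split.
  - by apply/implyP => /eqP ->.
  - by apply/implyP => /eqP ->; rewrite halt.
  apply/allP => i; rewrite mem_iota add0n => /andP[_ ik]; rewrite posE // lastE //=.
  rewrite last_visit_le /=; apply/andP; split; first by apply/implyP => /eqP ->.
  apply/implyP => /eqP l0; rewrite /init_ok /read_code zE readE // l0 symbol_code_ini.
  case: i {l0 ik} => [|[|i]] //=; last by rewrite nth_nil /= ltn0 andbF.
  case: (leqP T _) => //= _; case: ltnP => h1; case: ltnP => // h2; first by case: (nth _ _ _).
  by have := leq_trans h2 (leq_trans yq h1); rewrite ltnn.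
have tT : t < T.+1 := ltn_trans tt' t'T.
rewrite /tableau_comp !scE /follows !zE; apply/andP; split.
  by apply/implyP => /eqP ->; apply/eqP; exact: (advanceE (C t)).1.
apply/allP => i; rewrite mem_iota add0n => /andP[_ ik]; rewrite !posE // !lastE //=.
apply/and4P; split.
- apply/implyP => /eqP E; rewrite E /shift zE.
  rewrite (_ : hp i t.+1 = displace (scan_act (observe (C t)) (inord i)).2 (hp i t)) //.
  have h : 0 < hp i t.
    by have := head_pos_bound (tm_init M [:: xs; y]) T (inord i : 'I_k) t; rewrite -/(hp i t); lia.
  by case: (scan_act _ _).2 => /=; rewrite ?prednK ?addn0 ?addn1 ?addn2.
- apply/implyP => /eqP l; rewrite (last_visit_pos l) eqxx /carries !zE readE // l.
  by rewrite eqxx.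
- by apply/implyP => l; apply: last_visit_max l.
apply/implyP => /and5P[/eqP i1 /eqP l0 /eqP l0' Tp Tp']; rewrite /read_code !zE !readE // l0 l0' !symbol_code_ini.
rewrite i1 /= -i1 Tp Tp' /=.
by apply/andP; split; apply/implyP => /andP[lt]; case: ltnP => // h _; rewrite ltnNge (leq_trans h) // leq_sub2r // ltnW.
Qed.

Lemma tableau_accepting a :
  (forall t, t < T.+1 -> a t < value_count M T /\ tableau_ok M x len T qb t (a t)) ->
  (forall t t', t < t' -> t' < T.+1 -> tableau_comp M T t (a t) t' (a t')) ->
  exists2 y, size y <= qb & let C := iter T (@advance M) (tm_init M [:: xs; y]) in
    scan_halts (observe C) && accepting C.
Proof.
move=> Ha Hc; pose z t := val_scan M (a t); pose ps i t := val_pos M T i (a t).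
pose ls i t := val_last M T i (a t).
pose first_read c d t := [&& ls 1 t == 0, ps 1 t == T + d & read_code M 1 (z t) == c].
(* The certificate is rebuilt from the cells that are visited: it ends at the first cell whose first
   reading is blank, or at the bound [qb]; unvisited cells before its end become false. *)
pose l := findf qb (fun d => hasf T.+1 (first_read 0 d)).
pose y := mkseq (fun d => hasf T.+1 (first_read 2 d)) l.
have lq : l <= qb by rewrite /l /findf -[X in _ <= X](size_iota 0 qb) find_size.
exists y; first by rewrite size_mkseq.
have ok t : t <= T -> [/\ t = 0 -> is_start M (z t), t = T -> is_final M (z t) &
    forall i, i < k -> [/\ t = 0 -> ps i t = T, ls i t <= t &
      ls i t = 0 -> init_ok x len T qb i (read_code M i (z t)) (ps i t)]].
  move=> tT; have [_ /and3P[/implyP h1 /implyP h2 /allP h3]] := Ha t tT.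
  split=> [t0|t0|i ik]; [exact: h1 (introT eqP t0)|exact: h2 (introT eqP t0)|].
  have := h3 i; rewrite mem_iota add0n => /(_ ik) /and3P[/implyP g1 g2 /implyP g3].
  by split=> // [t0|t0]; [apply/eqP/g1/eqP|apply/g3/eqP].
have cp t t' : t < t' -> t' <= T -> (t' = t.+1 -> follows M (z t) (z t')) /\
    forall i, i < k -> [/\ t' = t.+1 -> (ps i t').+1 = ps i t + shift M i (z t),
      ls i t' = t.+1 -> ps i t = ps i t' /\ carries M i (z t) (z t'),
      ls i t' <= t -> ps i t != ps i t' &
      [&& i == 1, ls i t == 0, ls i t' == 0, T <= ps i t & T <= ps i t'] ->
        (ps i t < ps i t' -> read_code M i (z t) = 0 -> read_code M i (z t') = 0) /\
        (ps i t' < ps i t -> read_code M i (z t') = 0 -> read_code M i (z t) = 0)].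
  move=> tt' t'T; have /andP[/implyP h1 /allP h2] := Hc t t' tt' t'T.
  split=> [t0|i ik]; first exact: h1 (introT eqP t0).
  have := h2 i; rewrite mem_iota add0n => /(_ ik) /and4P[/implyP g1 /implyP g2 /implyP g3 /implyP g4].
  split=> // [t0|t0|/g4 /andP[/implyP f1 /implyP f2]]; first exact/eqP/g1/eqP.
    by have /andP[/eqP] := g2 (introT eqP t0).
  by split=> p0 c0; apply/eqP; [apply: f1|apply: f2]; rewrite p0 c0.
(* A cell has only one first visit, so no two time steps can guess different initial symbols for
   it. *)
have first_uniq i t t' : i < k -> t <= T -> t' <= T -> ls i t = 0 -> ls i t' = 0 ->
    ps i t = ps i t' -> t = t'.
  move=> ik tT t'T l0 l0' pE; case: (ltngtP t t') => // lt.
    by have [_ /(_ i ik)[_ _ + _]] := cp _ _ lt t'T; rewrite l0' pE eqxx => /(_ isT).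
  by have [_ /(_ i ik)[_ _ + _]] := cp _ _ lt tT; rewrite l0 pE eqxx => /(_ isT).
have blank_after t t' : 1 < k -> t <= T -> t' <= T -> ls 1 t = 0 -> ls 1 t' = 0 -> T <= ps 1 t ->
    ps 1 t <= ps 1 t' -> read_code M 1 (z t) = 0 -> read_code M 1 (z t') = 0.
  move=> k1 tT t'T l0 l0' Tp pp'.
  have Tp' := leq_trans Tp pp'; move: pp'; rewrite leq_eqVlt => /orP[/eqP pE|lt].
    by rewrite (first_uniq 1 t t').
  case: (ltngtP t t') => [tt'|tt'|-> //].
    by have [_ /(_ 1 k1)[_ _ _]] := cp _ _ tt' t'T; rewrite l0 l0' Tp Tp' => /(_ isT)[h _]; apply: h.
  by have [_ /(_ 1 k1)[_ _ _]] := cp _ _ tt' tT; rewrite l0 l0' Tp Tp' => /(_ isT)[_ h]; apply: h.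
pose h t := scan_of M (z t); pose p (i : 'I_k) := ps i.
have lsE (i : 'I_k) t : t <= T -> last_visit (p i) t (p i t) = ls i t.
  move=> tT; have [_ _ /(_ i (ltn_ord i))[_ le _]] := ok t tT.
  apply: last_visit_uniq => // u ut H; have [_ /(_ i (ltn_ord i))[_ c1 c2 _]] := cp _ _ ut tT.
    by have [] := c1 H.
  exact: c2.
have ini_read (i : 'I_k) t : t <= T -> ls i t = 0 -> (h t).2 i = ini_tape y i (p i t).
  move=> tT l0; have [_ _ /(_ i (ltn_ord i))[_ _ /(_ l0)]] := ok t tT.
  have rE : read_code M i (z t) = symbol_code ((h t).2 i) by rewrite /read_code inord_val.
  (* It suffices to compare codes: initial symbols have codes at most 2, where [symbol_code] is
     injective. *)
  suff H : init_ok x len T qb i (read_code M i (z t)) (p i t) ->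
      symbol_code (ini_tape y i (p i t)) = read_code M i (z t).
    move=> /H e; symmetry; apply: symbol_code_inj; rewrite ?e ?rE //.
    by rewrite -rE -e symbol_code_ini; case: ifP => // _; case: (nth _ _ _).
  rewrite /init_ok symbol_code_ini; move: (ltn_ord i) l0; rewrite /p; move: (val i) => j jk l0 {rE i}.
  case: j l0 jk => [|[|j]] l0 jk /=; [by move/eqP| |by rewrite nth_nil ltn0 andbF => /eqP].
  rewrite size_mkseq; case: (leqP T (ps 1 t)) => //= [Tp|_ /eqP //].
  have pE : ps 1 t = T + (ps 1 t - T) by rewrite subnKC.
  set d := ps 1 t - T in pE *; case: (ltnP d l) => dl.
    rewrite (leq_trans dl lq) nth_mkseq // => c2.
    have c0 : read_code M 1 (z t) != 0.
      apply/negP => c0; have := before_find 0 dl; rewrite nth_iota ?(leq_trans dl lq) // add0n.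
      by move/hasP; apply; exists t; rewrite ?mem_iota // /first_read l0 -pE c0 !eqxx.
    case: hasfP => [[t' t'T /and3P[/eqP l0' /eqP pE' /eqP c2']]|no].
      by rewrite (first_uniq 1 t t') // pE.
    have : read_code M 1 (z t) != 2.
      by apply/negP => c2'; case: no; exists t; rewrite // /first_read l0 -pE c2' !eqxx.
    by move: c0 c2; case: (read_code _ _ _) => [|[|[|]]].
  case: ifP => [dq _|_ /eqP //].
  have hl : has (fun d => hasf T.+1 (first_read 0 d)) (iota 0 qb).
    by rewrite has_find size_iota; apply: leq_ltn_trans dl dq.
  have := nth_find 0 hl; rewrite -/(findf _ _) -/l nth_iota ?(leq_ltn_trans dl dq) // add0n.
  case/hasfP => t' t'T /and3P[/eqP l0' /eqP pE' /eqP c0].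
  by rewrite (blank_after t' t) // pE' ?leq_addr // pE leq_add2l.
have [//|//|t tT|t i tT|t i tT|] := history_uniq (ini_tape_rep y) (xs := h) (ps := p) _ _ _ _ _ (leqnn T).
- by have [+ _ _] := ok 0 (leq0n _) => /(_ erefl)/eqP.
- by move=> i; have [_ _ /(_ i (ltn_ord i))[/(_ erefl)]] := ok 0 (leq0n _).
- by have [/(_ erefl)/eqP] := cp t t.+1 (leqnn _) tT.
- have [_ /(_ i (ltn_ord i))[/(_ erefl) + _ _ _]] := cp t t.+1 (leqnn _) tT.
  rewrite -/(p i) /shift inord_val -/(h t); case: (scan_act _ _).2 => /=; lia.
- rewrite /contents lsE //; case E: (ls i t) => [|u]; first exact: ini_read.
  have ut : u < t by have [_ _ /(_ i (ltn_ord i))[_ + _]] := ok t tT; rewrite E.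
  have [_ /(_ i (ltn_ord i))[_ c _ _]] := cp _ _ ut tT.
  by have [_ /eqP] := c E; rewrite !inord_val.
move=> hT _; have [_ /(_ erefl)] := ok T (leqnn T).
by rewrite /is_final -/(h T) hT.
Qed.

End TableauCorrect.

(** * The reduction as a computable bit string *)

Section Output.
Variables (n m : nat) (conf : rel nat).

Definition graph_order : nat := block_count n * max_weight n m conf.

Definition graph_bound : nat :=
  threshold n m conf + (graph_order - sumf (block_count n) (block_weight n m conf)).

(** The exponent ranges up to the bound itself, so true powers of two would not be polynomially
    bounded. Cutting at [c.+1] changes neither the test [c < 2 ^ j] nor the quotient of [c] by
    [2 ^ j]. *)
Definition capped_pow (c j : nat) : nat := iteri j (fun _ v => minn c.+1 (v + v)) 1.

Lemma capped_powE c j : capped_pow c j = minn c.+1 (2 ^ j).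
Proof. by rewrite /capped_pow; elim: j => [|j IH] /=; rewrite ?expnS ?IH; lia. Qed.

Lemma ltn_capped_pow c j : (c < capped_pow c j) = (c < 2 ^ j).
Proof. by rewrite capped_powE; lia. Qed.

Lemma div_capped_pow c j : c %/ capped_pow c j = c %/ 2 ^ j.
Proof.
rewrite capped_powE; case: (leqP (2 ^ j) c) => h; first by rewrite (minn_idPr _) // leqW.
by rewrite (minn_idPl _) // !divn_small.
Qed.

Definition output_size : nat :=
  graph_order + graph_order * graph_order + findf graph_bound.+1 (fun j => graph_bound < capped_pow graph_bound j) + 2.

(** The strict inequality in the last branch makes the sign bit false: the bound is a natural
    number. *)
Definition output_bit (i : nat) : bool :=
  if i <= graph_order then i < graph_order
  else if i <= graph_order + graph_order * graph_order then
    blow_edge (max_weight n m conf) (block_weight n m conf) (block_adj n)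
      ((i - graph_order.+1) %/ graph_order) ((i - graph_order.+1) %% graph_order)
  else (graph_order + graph_order * graph_order + 1 < i) &&
    odd (graph_bound %/ capped_pow graph_bound (i - (graph_order + graph_order * graph_order + 2))).

Lemma adjn_ord N (E : rel nat) (Es : symmetric (fun p q : 'I_N => E p q)) (Ei : irreflexive (fun p q : 'I_N => E p q)) u v :
  u < N -> v < N -> adjn (SGraph Es Ei) u v = E u v.
Proof.
move=> uN vN; have uN' : u < #|'I_N| by rewrite card_ord.
have vN' : v < #|'I_N| by rewrite card_ord.
have /= := @adjnE (SGraph Es Ei) (Ordinal uN') (Ordinal vN'); rewrite !enum_val_ord /=.
by move=> <-.
Qed.

Lemma output_encode :
  encode_graph_int (reduction_graph n m conf, Posz graph_bound) = mkseq output_bit output_size.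
Proof.
have cG : #|reduction_graph n m conf| = graph_order by rewrite card_ord.
have szE : size (encode_graph_int (reduction_graph n m conf, Posz graph_bound)) = output_size.
  rewrite size_encode cG /output_size absz_nat nat_bitsE size_mkseq; congr (_ + _ + _ + _).
  by rewrite /findf; apply: eq_find => j; rewrite ltn_capped_pow.
apply: (@eq_from_nth _ false); rewrite ?size_mkseq // szE => i isz; rewrite nth_mkseq //.
rewrite /output_bit; case: (leqP i graph_order) => [|iV].
  rewrite leq_eqVlt => /orP[/eqP ->|iV].
    by rewrite ltnn /encode_graph_int nth_cat size_nseq cG ltnn subnn.
  by rewrite iV /encode_graph_int nth_cat size_nseq cG iV nth_nseq iV.
set VV := graph_order * graph_order; case: (leqP i (graph_order + VV)) => [iVV|].
  have iE : i = graph_order + 1 + (i - graph_order.+1) by lia.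
  have jV : i - graph_order.+1 < VV by lia.
  set j := i - graph_order.+1 in iE jV *.
  have V0 : 0 < graph_order by move: jV; rewrite /VV; case: graph_order.
  have := @encode_adj (reduction_graph n m conf) (Posz graph_bound) j; rewrite cG -iE => -> //.
  have := adjn_ord (@blow_edge_sym (block_count n) (max_weight n m conf) (block_weight n m conf) _ (block_adj_sym n))
    (@blow_edge_irr (block_count n) (max_weight n m conf) (block_weight n m conf) _ (block_adj_irr n))
    (_ : j %/ graph_order < block_count n * max_weight n m conf)
    (_ : j %% graph_order < block_count n * max_weight n m conf).
  move=> <-; last exact: ltn_pmod; last by rewrite ltn_divLR.
  by rewrite /adjn /= card_ord -divn_eq.
move=> iVV; case: (ltnP (graph_order + VV + 1) i) => h; last first.
  have -> : i = graph_order + 1 + VV by lia.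
  by have := @encode_sign (reduction_graph n m conf) (Posz graph_bound); rewrite cG -/VV => ->.
have iE : i = graph_order + 2 + VV + (i - (graph_order + VV + 2)) by lia.
set j := i - _ in iE *; have := @encode_bits (reduction_graph n m conf) (Posz graph_bound) j.
rewrite cG -/VV -iE => ->; rewrite absz_nat nat_bitsE nth_mkseq ?div_capped_pow //.
move: isz; rewrite /output_size (_ : findf _ _ = findf graph_bound.+1 (fun j => graph_bound < 2 ^ j)); last first.
  by rewrite /findf; apply: eq_find => r; rewrite ltn_capped_pow.
by rewrite -/VV; lia.
Qed.

End Output.

Section OutputPT.

Ltac pt_user ::= fail.

Lemma PT_levels a : PT a -> PT (fun o e => levels (a o e)).
Proof. by move=> Ha; rewrite /levels; pt. Qed.

Lemma PT_ruler_excess a : PT a -> PT (fun o e => ruler_excess (a o e)).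
Proof. by move=> Ha; rewrite /ruler_excess; pt. Qed.

Ltac pt_user ::= lazymatch goal with
  | |- PT (fun o e => levels (@?a o e)) => apply PT_levels
  | |- PT (fun o e => ruler_excess (@?a o e)) => apply PT_ruler_excess
  end.

Lemma PT_separated n c a a' : PT n -> PT c -> PT a -> PT a' ->
  PT (fun o e => nat_of_bool (separated (n o e) (c o e) (a o e) (a' o e))).
Proof. by move=> Hn Hc Ha Ha'; rewrite /separated; pt. Qed.

Ltac pt_user ::= lazymatch goal with
  | |- PT (fun o e => levels (@?a o e)) => apply PT_levels
  | |- PT (fun o e => ruler_excess (@?a o e)) => apply PT_ruler_excess
  | |- PT (fun o e => nat_of_bool (separated (@?a o e) (@?b o e) (@?c o e) (@?d o e))) => apply PT_separated
  end.

Lemma PT_block_adj n b b' : PT n -> PT b -> PT b' ->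
  PT (fun o e => nat_of_bool (block_adj (n o e) (b o e) (b' o e))).
Proof. by move=> Hn Hb Hb'; rewrite /block_adj; pt. Qed.

Lemma PT_block_count n : PT n -> PT (fun o e => block_count (n o e)).
Proof. by move=> Hn; rewrite /block_count; pt. Qed.

Lemma PT_capped_pow c j : PT c -> PT j -> PT (fun o e => capped_pow (c o e) (j o e)).
Proof.
move=> Hc Hj; rewrite /capped_pow.
by apply: (PT_iteri (f := fun _ _ _ v => v + v)); pt.
Qed.

Variables (fn fm : nat -> nat) (cf : (nat -> bool) -> nat -> rel nat).
Hypothesis PT_fn : forall a, PT a -> PT (fun o e => fn (a o e)).
Hypothesis PT_fm : forall a, PT a -> PT (fun o e => fm (a o e)).
Hypothesis PT_cf : forall a u v, PT a -> PT u -> PT v ->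
  PT (fun o e => nat_of_bool (cf (o 0) (a o e) (u o e) (v o e))).

Ltac pt_base := lazymatch goal with
  | |- PT (fun o e => levels (@?a o e)) => apply PT_levels
  | |- PT (fun o e => ruler_excess (@?a o e)) => apply PT_ruler_excess
  | |- PT (fun o e => nat_of_bool (separated (@?a o e) (@?b o e) (@?c o e) (@?d o e))) => apply PT_separated
  | |- PT (fun o e => nat_of_bool (block_adj (@?a o e) (@?b o e) (@?c o e))) => apply PT_block_adj
  | |- PT (fun o e => block_count (@?a o e)) => apply PT_block_count
  | |- PT (fun o e => capped_pow (@?a o e) (@?b o e)) => apply PT_capped_pow
  | |- PT (fun o e => fn (@?a o e)) => apply PT_fn
  | |- PT (fun o e => fm (@?a o e)) => apply PT_fm
  | |- PT (fun o e => nat_of_bool (cf (o 0) (@?a o e) (@?b o e) (@?c o e))) => apply PT_cf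
  end.
Ltac pt_user ::= pt_base.

Lemma PT_active a c : PT a -> PT c -> PT (fun o e => nat_of_bool (active (fn (a o e)) (cf (o 0) (a o e)) (c o e))).
Proof. by move=> Ha Hc; rewrite /active; pt. Qed.

Ltac pt_user ::= lazymatch goal with
  | |- PT (fun o e => nat_of_bool (active (@?a o e) (@?b o e) (@?c o e))) => apply PT_active
  | _ => pt_base
  end.

Lemma PT_weight_c a c : PT a -> PT c -> PT (fun o e => weight_c (fn (a o e)) (cf (o 0) (a o e)) (c o e)).
Proof. by move=> Ha Hc; rewrite /weight_c; pt. Qed.

Lemma PT_weight_d a c : PT a -> PT c -> PT (fun o e => weight_d (fn (a o e)) (cf (o 0) (a o e)) (c o e)).
Proof. by move=> Ha Hc; rewrite /weight_d; pt. Qed.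

Ltac pt_user ::= lazymatch goal with
  | |- PT (fun o e => weight_c (@?a o e) (@?b o e) (@?c o e)) => apply PT_weight_c
  | |- PT (fun o e => weight_d (@?a o e) (@?b o e) (@?c o e)) => apply PT_weight_d
  | _ => pt_base
  end.

Lemma PT_pair_cost a c : PT a -> PT c -> PT (fun o e => pair_cost (fn (a o e)) (cf (o 0) (a o e)) (c o e)).
Proof. by move=> Ha Hc; rewrite /pair_cost; pt. Qed.

Ltac pt_user ::= lazymatch goal with
  | |- PT (fun o e => pair_cost (@?a o e) (@?b o e) (@?c o e)) => apply PT_pair_cost
  | |- PT (fun o e => weight_c (@?a o e) (@?b o e) (@?c o e)) => apply PT_weight_c
  | |- PT (fun o e => weight_d (@?a o e) (@?b o e) (@?c o e)) => apply PT_weight_d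
  | _ => pt_base
  end.

Lemma PT_unit_weight a : PT a -> PT (fun o e => unit_weight (fn (a o e)) (fm (a o e)) (cf (o 0) (a o e))).
Proof. by move=> Ha; rewrite /unit_weight /small_bound; pt. Qed.

Ltac pt_user ::= lazymatch goal with
  | |- PT (fun o e => unit_weight (@?a o e) (@?b o e) (@?c o e)) => apply PT_unit_weight
  | |- PT (fun o e => pair_cost (@?a o e) (@?b o e) (@?c o e)) => apply PT_pair_cost
  | |- PT (fun o e => weight_c (@?a o e) (@?b o e) (@?c o e)) => apply PT_weight_c
  | |- PT (fun o e => weight_d (@?a o e) (@?b o e) (@?c o e)) => apply PT_weight_d
  | _ => pt_base
  end.

Lemma PT_threshold a : PT a -> PT (fun o e => threshold (fn (a o e)) (fm (a o e)) (cf (o 0) (a o e))).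
Proof. by move=> Ha; rewrite /threshold /small_bound; pt. Qed.

Lemma PT_max_weight a : PT a -> PT (fun o e => max_weight (fn (a o e)) (fm (a o e)) (cf (o 0) (a o e))).
Proof. by move=> Ha; rewrite /max_weight; pt. Qed.

Lemma PT_block_weight a b : PT a -> PT b ->
  PT (fun o e => block_weight (fn (a o e)) (fm (a o e)) (cf (o 0) (a o e)) (b o e)).
Proof. by move=> Ha Hb; rewrite /block_weight /weight; pt. Qed.

Ltac pt_user ::= lazymatch goal with
  | |- PT (fun o e => threshold (@?a o e) (@?b o e) (@?c o e)) => apply PT_threshold
  | |- PT (fun o e => max_weight (@?a o e) (@?b o e) (@?c o e)) => apply PT_max_weight
  | |- PT (fun o e => block_weight (@?a o e) (@?b o e) (@?c o e) (@?d o e)) => apply PT_block_weight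
  | _ => pt_base
  end.

Lemma PT_graph_order a : PT a -> PT (fun o e => graph_order (fn (a o e)) (fm (a o e)) (cf (o 0) (a o e))).
Proof. by move=> Ha; rewrite /graph_order; pt. Qed.

Ltac pt_user ::= lazymatch goal with
  | |- PT (fun o e => graph_order (@?a o e) (@?b o e) (@?c o e)) => apply PT_graph_order
  | |- PT (fun o e => threshold (@?a o e) (@?b o e) (@?c o e)) => apply PT_threshold
  | |- PT (fun o e => max_weight (@?a o e) (@?b o e) (@?c o e)) => apply PT_max_weight
  | |- PT (fun o e => block_weight (@?a o e) (@?b o e) (@?c o e) (@?d o e)) => apply PT_block_weight
  | _ => pt_base
  end.

Lemma PT_graph_bound a : PT a -> PT (fun o e => graph_bound (fn (a o e)) (fm (a o e)) (cf (o 0) (a o e))).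
Proof. by move=> Ha; rewrite /graph_bound; pt. Qed.

Ltac pt_user ::= lazymatch goal with
  | |- PT (fun o e => graph_order (@?a o e) (@?b o e) (@?c o e)) => apply PT_graph_order
  | |- PT (fun o e => graph_bound (@?a o e) (@?b o e) (@?c o e)) => apply PT_graph_bound
  | |- PT (fun o e => max_weight (@?a o e) (@?b o e) (@?c o e)) => apply PT_max_weight
  | |- PT (fun o e => block_weight (@?a o e) (@?b o e) (@?c o e) (@?d o e)) => apply PT_block_weight
  | _ => pt_base
  end.

Lemma PT_output_size a : PT a -> PT (fun o e => output_size (fn (a o e)) (fm (a o e)) (cf (o 0) (a o e))).
Proof. by move=> Ha; rewrite /output_size; pt. Qed.

Lemma PT_output_bit a i : PT a -> PT i ->
  PT (fun o e => nat_of_bool (output_bit (fn (a o e)) (fm (a o e)) (cf (o 0) (a o e)) (i o e))).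
Proof. by move=> Ha Hi; rewrite /output_bit /blow_edge /live_copy; pt. Qed.

Lemma output_polytime : polytime_computable (fun x =>
  let n := fn (size x) in let m := fm (size x) in let conf := cf (nth false x) (size x) in
  encode_graph_int (reduction_graph n m conf, Posz (graph_bound n m conf))).
Proof.
have [M [P HM]] := PT_machine (PT_output_size PT_head) (PT_cst 0)
  (PT_output_bit (a := fun _ e => head 0 (behead e)) (PT_behead PT_head) PT_head).
exists M, P => x; rewrite tm_init_blank.
have [//|C [HC Ho _]] := HM x [::]
  (output_bit (fn (size x)) (fm (size x)) (cf (nth false x) (size x))).
exists C => //; rewrite Ho subn0; apply: esym; exact: output_encode.
Qed.

End OutputPT.

Lemma PT_table2 a b (g : nat -> nat -> nat) Z : PT a -> PT b ->
  (forall o e, a o e < Z) -> (forall o e, b o e < Z) -> PT (fun o e => g (a o e) (b o e)).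
Proof.
move=> Ha Hb aZ bZ; pose h u := g (u %/ Z) (u %% Z).
have Hab : PT (fun o e => a o e * Z + b o e) by exact: PT_add (PT_mul Ha (PT_cst Z)) Hb.
apply: PT_ext (PT_table h (Z := Z * Z) Hab _) => o e; rewrite ?pair_index_lt //.
by rewrite /h divnMDl ?(leq_ltn_trans _ (bZ o e)) // divn_small // addn0 modnMDl modn_small.
Qed.

Section TableauPT.
Variable M : tm.

Ltac pt_user ::= fail.

Lemma val_scan_lt v : val_scan M v < scan_count M.
Proof. by rewrite ltn_pmod // (leq_ltn_trans (leq0n _) (index_scan_lt (scan_of M 0))). Qed.

Lemma PT_val_scan v : PT v -> PT (fun o e => val_scan M (v o e)).
Proof. by move=> Hv; rewrite /val_scan; pt. Qed.

Lemma PT_scan_table (g : nat -> nat) v : PT v -> PT (fun o e => g (val_scan M (v o e))).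
Proof. by move=> Hv; apply: PT_table (PT_val_scan Hv) _ => o e; apply: val_scan_lt. Qed.

Lemma PT_scan_table2 (g : nat -> nat -> nat) v v' : PT v -> PT v' ->
  PT (fun o e => g (val_scan M (v o e)) (val_scan M (v' o e))).
Proof.
by move=> Hv Hv'; apply: (PT_table2 (Z := scan_count M) g (PT_val_scan Hv) (PT_val_scan Hv')) => o e;
  apply: val_scan_lt.
Qed.

Lemma PT_radix T : PT T -> PT (fun o e => radix (T o e)).
Proof. by move=> HT; rewrite /radix; pt. Qed.

Ltac pt_user ::= lazymatch goal with
  | |- PT (fun o e => radix (@?a o e)) => apply PT_radix
  end.

Lemma PT_value_count T : PT T -> PT (fun o e => value_count M (T o e)).
Proof. by move=> HT; rewrite /value_count; pt. Qed.

Lemma PT_val_pos T i v : PT T -> PT v -> PT (fun o e => val_pos M (T o e) i (v o e)).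
Proof. by move=> HT Hv; rewrite /val_pos /digit; pt. Qed.

Lemma PT_val_last T i v : PT T -> PT v -> PT (fun o e => val_last M (T o e) i (v o e)).
Proof. by move=> HT Hv; rewrite /val_last /digit; pt. Qed.

Lemma PT_init_ok l T qb i c p : PT l -> PT T -> PT qb -> PT c -> PT p ->
  PT (fun o e => nat_of_bool (init_ok (o 0) (l o e) (T o e) (qb o e) i (c o e) (p o e))).
Proof. by move=> Hl HT Hq Hc Hp; rewrite /init_ok; pt. Qed.

Ltac pt_user ::= lazymatch goal with
  | |- PT (fun o e => val_pos _ (@?a o e) _ (@?b o e)) => apply PT_val_pos
  | |- PT (fun o e => val_last _ (@?a o e) _ (@?b o e)) => apply PT_val_last
  | |- PT (fun o e => nat_of_bool (init_ok (o 0) (@?a o e) (@?b o e) (@?c o e) _ (@?d o e) (@?f o e))) =>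
      apply PT_init_ok
  | |- PT (fun o e => nat_of_bool (all (@?f o e) ?s)) =>
      apply (@PT_all_const s (fun i o e => f o e i)); intro
  | |- PT (fun o e => nat_of_bool (is_start _ _)) => apply (PT_scan_table (fun z => nat_of_bool (is_start M z)))
  | |- PT (fun o e => nat_of_bool (is_final _ _)) => apply (PT_scan_table (fun z => nat_of_bool (is_final M z)))
  | |- PT (fun o e => read_code _ ?i _) => apply (PT_scan_table (read_code M i))
  | |- PT (fun o e => shift _ ?i _) => apply (PT_scan_table (shift M i))
  | |- PT (fun o e => nat_of_bool (follows _ _ _)) =>
      apply (PT_scan_table2 (fun z z' => nat_of_bool (follows M z z')))
  | |- PT (fun o e => nat_of_bool (carries _ ?i _ _)) =>
      apply (PT_scan_table2 (fun z z' => nat_of_bool (carries M i z z')))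
  end.

Lemma PT_tableau_ok l T qb t v : PT l -> PT T -> PT qb -> PT t -> PT v ->
  PT (fun o e => nat_of_bool (tableau_ok M (o 0) (l o e) (T o e) (qb o e) (t o e) (v o e))).
Proof. by move=> Hl HT Hq Ht Hv; rewrite /tableau_ok; pt. Qed.

Lemma PT_tableau_comp T t v t' v' : PT T -> PT t -> PT v -> PT t' -> PT v' ->
  PT (fun o e => nat_of_bool (tableau_comp M (T o e) (t o e) (v o e) (t' o e) (v' o e))).
Proof. by move=> HT Ht Hv Ht' Hv'; rewrite /tableau_comp; pt. Qed.

Ltac pt_user ::= lazymatch goal with
  | |- PT (fun o e => nat_of_bool (tableau_ok _ (o 0) (@?a o e) (@?b o e) (@?c o e) (@?d o e) (@?f o e))) =>
      apply PT_tableau_ok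
  | |- PT (fun o e => nat_of_bool (tableau_comp _ (@?b o e) (@?c o e) (@?d o e) (@?f o e) (@?g o e))) =>
      apply PT_tableau_comp
  | |- PT (fun o e => value_count _ (@?a o e)) => apply PT_value_count
  end.

Lemma PT_csp_conf l T qb u v : PT l -> PT T -> PT qb -> PT u -> PT v ->
  PT (fun o e => nat_of_bool (csp_conf (value_count M (T o e))
    (tableau_ok M (o 0) (l o e) (T o e) (qb o e)) (tableau_comp M (T o e)) (u o e) (v o e))).
Proof. by move=> Hl HT Hq Hu Hv; rewrite /csp_conf; pt. Qed.

End TableauPT.

Lemma advance_halted (M : tm) (C : config M) : scan_halts (observe C) -> advance C = C.
Proof. by rewrite /advance /tm_step /scan_halts /=; case: tm_trans. Qed.

Theorem chromatic_sum_NP_hard (c : int) : (3 <= c)%R ->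
  NP_hard (chromatic_sum (cliquewidth_at_most c)).
Proof.
move=> c3 L [M [p [q HV]]].
(* One step beyond the time bound: a halted configuration does not change, and there are at least
   two time steps, as [csp_choice] demands. *)
pose T len := (p.[len]%R).+1; pose qb len : nat := q.[len]%R.
pose s len := value_count M (T len); pose m len := (T len).+1; pose n len := m len * s len.
pose conf x len := csp_conf (s len) (tableau_ok M x len (T len) (qb len)) (tableau_comp M (T len)).
have PT_T a : PT a -> PT (fun o e => T (a o e)) by move=> Ha; apply/PT_succ/PT_horner.
have PT_m a : PT a -> PT (fun o e => m (a o e)) by move=> Ha; apply/PT_succ/PT_T.
have PT_n a : PT a -> PT (fun o e => n (a o e)).
  by move=> Ha; apply: PT_mul; [apply: PT_m | apply/PT_value_count/PT_T].
have PT_conf a u v : PT a -> PT u -> PT v ->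
    PT (fun o e => nat_of_bool (conf (o 0) (a o e) (u o e) (v o e))).
  move=> Ha Hu Hv; apply: (PT_csp_conf M (qb := fun o e => qb (a o e)) Ha (PT_T _ Ha)) => //.
  exact: PT_horner.
exists (fun x => let n := n (size x) in let m := m (size x) in let conf := conf (nth false x) (size x) in
  encode_graph_int (reduction_graph n m conf, Posz (graph_bound n m conf))).
  exact: output_polytime PT_n PT_m PT_conf.
move=> x; set n' := n (size x); set m' := m (size x); set conf' := conf (nth false x) (size x).
have s0 : 0 < s (size x).
  have Z0 := leq_ltn_trans (leq0n _) (val_scan_lt M 0).
  by rewrite /s /value_count muln_gt0 Z0 expn_gt0 /radix muln_gt0 addn1.
have n0 : 0 < n' by rewrite muln_gt0.
have mn : m' <= n' by rewrite leq_pmulr.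
exists (reduction_graph n' m' conf', Posz (graph_bound n' m' conf')); split=> //.
  by apply: constructible_cliquewidth => //; apply: reduction_graph_constructible.
have /= -> : L x <-> exists I, independent_choice n' m' conf' I.
  rewrite csp_choice //; have [/= halts ->] := HV x I.
  split=> [[y yq [C /run_iter[hC EC] acc]]|[a [Ha Hc]]].
    have E : iter (T (size x)) (@advance M) (tm_init M [:: x; y]) = C.
      by rewrite /T iterS -EC advance_halted // EC.
    by apply: (@accepting_tableau M x (T (size x)) (qb (size x)) y); rewrite ?E // EC.
  have [y yq /andP[hC acc]] := tableau_accepting Ha Hc; exists y => //.
  have [C HC] := halts y yq; exists C => //.
  have [hD ED] := (run_iter _ _ _).1 HC; move: acc.
  by rewrite /T iterS advance_halted -?ED // ED.
rewrite /=; split=> [[I HI]|[c' Hc' le]].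
  have [] := (blow_up_chromatic_sum (block_adj_sym n') (block_adj_irr n')
    (fun b => @block_weight_le n' m' conf' n0 mn b) (threshold n' m' conf')).2.
    exact: colouring_of_choice HI.
  by move=> c' Hc' le; exists c'; rewrite ?lez_nat.
have := (blow_up_chromatic_sum (block_adj_sym n') (block_adj_irr n')
    (fun b => @block_weight_le n' m' conf' n0 mn b) (threshold n' m' conf')).1.
case; first by exists c'.
by move=> c'' Hc'' le''; apply: choice_of_colouring Hc'' le''.
Qed.

Theorem theorem4 (c : int) :
  ((c <= 2)%R -> polytime_solvable (chromatic_sum (cliquewidth_at_most c))) /\
  ((3 <= c)%R -> NP_complete (chromatic_sum (cliquewidth_at_most c))).
Proof.
split; first exact: chromatic_sum_polytime.
by split; [apply: chromatic_sum_in_NP | apply: chromatic_sum_NP_hard].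
Qed.
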